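(* Let $\mathcal{M}$ be the matrix, in some basis, of a graded piece of an ordinary and overconvergent finite rank $\sigma$-module $(M,\phi)$ over $\widehat{A}$. Then there exists a convergent series representation $$[\mathcal{M}]=\sum_{r\geq 1}\pm[\mathcal{C}_r]$$ in $\Delta(\widehat{A})$ with nuclear overconvergent matrices $\mathcal{C}_r$ over $A$.
   Context: Setting. $K/\mathbb{Q}_p$ is finite with ring of integers $R$, uniformizer $\pi$, residue field $k=\mathbb{F}_q$; $\mathrm{ord}_\pi$ is normalized by $\mathrm{ord}_\pi(\pi)=1$, and for $x$ in an $R$-module $E$ with $\pi E\neq E$, $\mathrm{ord}_\pi(x)=\sup\{n/m : n\in\mathbb{N}_0, m\in\mathbb{N}, x^m\in\pi^nE\}$. For positive integers $m,c$ let $[m,c]=\{\sum_{j\ge0}\pi^jp_j : p_j\in R[X_1,\dots,X_n],\ \deg p_j\le m+cj\}$ and $R[X]^{\dagger}=\bigcup_{m,c}[m,c]$. $X=\mathrm{Spec}(\overline{A})$ is a smooth affine connected $k$-scheme of dimension $d$, $\overline{A}=A/\pi A$ with $A=R[X]^{\dagger}/(g_1,\dots,g_r)$, $g_j\in R[X_1,\dots,X_n]-\pi R[X_1,\dots,X_n]$, $A$ flat over $R$; $\widehat{A}$ is its $\pi$-adic completion; $\sigma$ is an $R$-algebra endomorphism of $A$ (and $\widehat{A}$) lifting the $q$-th power Frobenius of $\overline{A}$. It is assumed (shrinking $X$ if necessary) that $A$ is a finite free $\sigma(A)$-module of rank $q^d$ and that the module of $p$-adically separated differentials $\Omega^1_{A/R}$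 is free over $A$. $\sigma$-modules. A finite rank $\sigma$-module over $\widehat{A}$ is a finite rank free $\widehat{A}$-module with a $\sigma$-linear endomorphism $\phi$; it is overconvergent if it arises by base change from a finite rank free $A$-module with $\sigma$-linear endomorphism; it is unit root if $\widehat{A}_\sigma\otimes U\to U$, $a\otimes u\mapsto a\phi(u)$, is bijective. $(M,\phi)$ is ordinary if it admits a separated and exhausting $\phi$-stable filtration by free $\widehat{A}$-submodules $0=M_0\subset M_1\subset M_2\subset\cdots$ with free quotients, such that each $(M_{i+1}/M_i,\phi)$ is of the form $(U_i,\pi^i\phi_i)$ with $(U_i,\phi_i)$ a unit root $\sigma$-module. The $(U_i,\phi_i)$ are called the graded pieces of $(M,\phi)$. Nuclear matrices. For a countable index set $I$, an $I\times I$-matrix $(a_{i_1,i_2})$ with entries in an $R$-module $E\neq\pi E$ is nuclear if for each $M>0$ there are only finitely many $i_2$ with $\inf_{i_1}\mathrm{ord}_\pi(a_{i_1,i_2})<M$. It is nuclear overconvergent over $A$ if it is the entrywise image of a nuclear matrix with entries in some $[m,c]$ under $[m,c]\subset R[X]^{\dagger}\to A$. The group $\Delta(\widehat{A})$. An $I_1\times I_1$-matrix $\mathcal{M}_1$ and an $I_2\times I_2$-matrix $\mathcal{M}_2$ over $\widehat{A}$ are $\sigma$-similar if there are an $I_1\times I_2$-matrix $\mathcal{S}$ and an $I_2\times I_1$-matrix $\mathcal{S}'$ over $\widehat{A}$ with $\mathcal{S}\mathcal{S}'$ and $\mathcal{S}'\mathcal{S}$ identity matrices and $\mathcal{S}'\mathcal{M}_1\mathcal{S}^{\sigma}=\mathcal{M}_2$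 (all products being required to converge coefficientwise). $\Delta(\widehat{A})$ is the quotient of the free abelian group on $\sigma$-similarity classes of nuclear matrices over $\widehat{A}$ (over countable index sets) by the subgroup generated by all $[\mathcal{M}]-[\mathcal{M}']-[\mathcal{M}'']$, where $\mathcal{M}=(a_{i_1,i_2})_{i_1,i_2\in I}$, $I=I'\sqcup I''$, $a_{i_1,i_2}=0$ for all $(i_1,i_2)\in I'\times I''$, and $\mathcal{M}',\mathcal{M}''$ are the $I'\times I'$- and $I''\times I''$-blocks. If $\mathcal{M}_n$ ($n\in\mathbb{N}$) are nuclear matrices with $\mathrm{ord}_\pi(\mathcal{M}_n):=\min_{i_1,i_2}\mathrm{ord}_\pi(a_{i_1,i_2})\to\infty$ and $\nu_n\in\mathbb{Z}$, the (convergent) series $\sum_n\nu_n[\mathcal{M}_n]$ denotes the element $[\mathcal{M}_+]-[\mathcal{M}_-]$ where $\mathcal{M}_+$ (resp. $\mathcal{M}_-$) is the block diagonal matrix with $|\nu_n|$ copies of $\mathcal{M}_n$ for all $n$ with $\nu_n>0$ (resp. $\nu_n<0$). *)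

(* Defs.v *)
From HB Require Import structures.
From mathcomp Require Import all_boot all_order all_algebra finmap.
From mathcomp Require Import boolp classical_sets functions cardinality.
From mathcomp Require Import mpoly freeg.
From mathcomp Require Import reals constructive_ereal ereal topology Rstruct.
Set Implicit Arguments.
Unset Strict Implicit.
Unset Printing Implicit Defensive.
Import Order.TTheory GRing.Theory Num.Theory.
Local Open Scope ring_scope.
Local Open Scope classical_set_scope.

(* ord takes its values in the extended reals over Stdlib's R. *)
Notation RR := Rdefinitions.R.

(* Ring of integers of a finite extension of Q_p, intrinsically: a complete
   discrete valuation ring of characteristic 0 with finite residue field.  The
   prime p is the characteristic of k. *)
Definition padic_integer_ring (R : idomainType) (pi : R) (k : finFieldType)
    (res : {rmorphism R -> k}) : Prop :=
  [/\ [pchar R] =i pred0,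
      pi != 0 /\ (forall x : R, x != 0 ->
        exists (u : R) (n : nat), u \is a GRing.unit /\ x = u * pi ^+ n),
      (forall u : nat -> R,
        (forall n, exists y, u n.+1 - u n = pi ^+ n * y) ->
        exists l, forall n, exists y, l - u n = pi ^+ n * y),
      (forall z : k, exists x, res x = z)
    & forall x, res x = 0 <-> exists y, x = pi * y].

Section PowerSeries.
Variables (n : nat) (R : comNzRingType).

Definition mpseries := 'X_{1..n} -> R.

Implicit Types (f g h : mpseries) (m : 'X_{1..n}).

HB.instance Definition _ := gen_eqMixin mpseries.
HB.instance Definition _ := gen_choiceMixin mpseries.

Definition mps_zero : mpseries := fun=> 0.
Definition mps_one : mpseries := fun m => (m == 0%MM)%:R.
Definition mps_opp f : mpseries := fun m => - f m.
Definition mps_add f g : mpseries := fun m => f m + g m.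
Definition mps_mul f g : mpseries := fun m =>
  \sum_(k : 'X_{1..n < (mdeg m).+1, (mdeg m).+1} | m == (k.1 + k.2)%MM)
    f k.1 * g k.2.
Definition mps_scale (a : R) f : mpseries := fun m => a * f m.
Definition mps_of_mpoly (p : {mpoly R[n]}) : mpseries := fun m => p@_m.

Fact mps_addA : associative mps_add.
Proof. by move=> f g h; apply/funext => m; rewrite /mps_add addrA. Qed.
Fact mps_addC : commutative mps_add.
Proof. by move=> f g; apply/funext => m; rewrite /mps_add addrC. Qed.
Fact mps_add0 : left_id mps_zero mps_add.
Proof. by move=> f; apply/funext => m; rewrite /mps_add add0r. Qed.
Fact mps_addN : left_inverse mps_zero mps_opp mps_add.
Proof. by move=> f; apply/funext => m; rewrite /mps_add addNr. Qed.
HB.instance Definition _ :=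
  GRing.isZmodule.Build mpseries mps_addA mps_addC mps_add0 mps_addN.

Definition mps_trunc (N : nat) f : {mpoly R[n]} :=
  \sum_(m : 'X_{1..n < N}) f m *: 'X_[m].

Lemma mps_trunc_coef N f m : (mdeg m < N)%N -> (mps_trunc N f)@_m = f m.
Proof. by move=> mN; rewrite /mps_trunc mcoeff_mpoly. Qed.

Lemma mps_mul_local f g (p q : {mpoly R[n]}) N m : (mdeg m < N)%N ->
  (forall m', (mdeg m' < N)%N -> p@_m' = f m') ->
  (forall m', (mdeg m' < N)%N -> q@_m' = g m') ->
  mps_mul f g m = (p * q)@_m.
Proof.
move=> mN pf qg; rewrite (mcoeff_poly_mul _ _ (ltnSn (mdeg m))).
apply: eq_bigr => k _.
by rewrite pf ?qg // (leq_trans (bmdeg _)).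
Qed.

Fact mps_mulA : associative mps_mul.
Proof.
move=> f g h; apply/funext => m; set N := (mdeg m).+1.
pose T := mps_trunc N.
have TE u m' : (mdeg m' < N)%N -> (T u)@_m' = u m' by apply: mps_trunc_coef.
rewrite (@mps_mul_local f (mps_mul g h) (T f) (T g * T h) N) //; last 2 first.
- exact: TE.
- by move=> m' m'N; rewrite -(@mps_mul_local g h _ _ N) // => *; exact: TE.
rewrite (@mps_mul_local (mps_mul f g) h (T f * T g) (T h) N) ?mulrA //.
- by move=> m' m'N; rewrite -(@mps_mul_local f g _ _ N) // => *; exact: TE.
- exact: TE.
Qed.

Fact mps_mulC : commutative mps_mul.
Proof.
move=> f g; apply/funext => m; pose T := mps_trunc (mdeg m).+1.
rewrite (@mps_mul_local f g (T f) (T g) (mdeg m).+1) //; try exact: mps_trunc_coef.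
rewrite (@mps_mul_local g f (T g) (T f) (mdeg m).+1) 1?mulrC //;
  exact: mps_trunc_coef.
Qed.

Fact mps_mul1 : left_id mps_one mps_mul.
Proof.
move=> f; apply/funext => m; pose T := mps_trunc (mdeg m).+1.
rewrite (@mps_mul_local _ _ 1 (T f) (mdeg m).+1) ?mul1r ?mps_trunc_coef //; last first.
- exact: mps_trunc_coef.
- by move=> m' _; rewrite mcoeff1.
Qed.

Fact mps_mulD : left_distributive mps_mul mps_add.
Proof.
move=> f g h; apply/funext => m; rewrite /mps_add /mps_mul -big_split /=.
by apply: eq_bigr => k _; rewrite mulrDl.
Qed.

Fact mps_oner_neq0 : mps_one != 0 :> mpseries.
Proof.
apply/eqP => /(congr1 (fun f : mpseries => f 0%MM)) /eqP.
by rewrite /mps_one eqxx oner_eq0.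
Qed.

HB.instance Definition _ := GRing.Zmodule_isComNzRing.Build mpseries
  mps_mulA mps_mulC mps_mul1 mps_mulD mps_oner_neq0.

Fact mps_scaleA a b f : mps_scale a (mps_scale b f) = mps_scale (a * b) f.
Proof. by apply/funext => m; rewrite /mps_scale mulrA. Qed.
Fact mps_scale1 : left_id 1 mps_scale.
Proof. by move=> f; apply/funext => m; rewrite /mps_scale mul1r. Qed.
Fact mps_scaleDr : right_distributive mps_scale +%R.
Proof. by move=> a f g; apply/funext => m; rewrite /mps_scale mulrDr. Qed.
Fact mps_scaleDl f : {morph mps_scale^~ f : a b / a + b}.
Proof. by move=> a b; apply/funext => m; rewrite /mps_scale mulrDl. Qed.
HB.instance Definition _ := GRing.Zmodule_isLmodule.Build R mpseries
  mps_scaleA mps_scale1 mps_scaleDr mps_scaleDl.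

Fact mps_scaleAl a f g : a *: (f * g) = (a *: f) * g.
Proof.
apply/funext => m; rewrite /GRing.scale /GRing.mul /= /mps_scale /mps_mul.
by rewrite mulr_sumr; apply: eq_bigr => k _; rewrite mulrA.
Qed.
HB.instance Definition _ := GRing.Lmodule_isLalgebra.Build R mpseries mps_scaleAl.
Fact mps_scaleAr a f g : a *: (f * g) = f * (a *: g).
Proof. by rewrite mulrC mps_scaleAl mulrC. Qed.
HB.instance Definition _ := GRing.Lalgebra_isAlgebra.Build R mpseries mps_scaleAr.

Lemma mps_of_mpolyD p q :
  mps_of_mpoly (p + q) = mps_of_mpoly p + mps_of_mpoly q.
Proof. by apply/funext => m; rewrite /mps_of_mpoly mcoeffD. Qed.
Lemma mps_of_mpolyZ a p : mps_of_mpoly (a *: p) = a *: mps_of_mpoly p.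
Proof. by apply/funext => m; rewrite /mps_of_mpoly mcoeffZ. Qed.
Lemma mps_of_mpolyM p q :
  mps_of_mpoly (p * q) = mps_of_mpoly p * mps_of_mpoly q.
Proof.
apply/funext => m; rewrite /mps_of_mpoly.
exact/esym/(@mps_mul_local _ _ p q (mdeg m).+1).
Qed.
Lemma mps_of_mpoly1 : mps_of_mpoly 1 = 1.
Proof. by apply/funext => m; rewrite /mps_of_mpoly mcoeff1. Qed.
Lemma mps_of_mpoly0 : mps_of_mpoly 0 = 0.
Proof. by apply/funext => m; rewrite /mps_of_mpoly mcoeff0. Qed.
Lemma mps_of_mpoly_sum (I : Type) (r : seq I) (P : pred I)
    (F : I -> {mpoly R[n]}) :
  mps_of_mpoly (\sum_(i <- r | P i) F i) = \sum_(i <- r | P i) mps_of_mpoly (F i).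
Proof. exact: (big_morph _ mps_of_mpolyD mps_of_mpoly0). Qed.

End PowerSeries.

Section Dagger.
Variables (n : nat) (R : comNzRingType) (pi : R).
Local Notation S := (mpseries n R).

(* f is the pi-adically convergent sum of the pi^j p_j; msize is deg + 1. *)
Definition dagger_expansion (m c : nat) (p : nat -> {mpoly R[n]}) (f : S) :=
  (forall j, (msize (p j) <= (m + c * j).+1)%N) /\
  (forall N, exists h : S,
     f = \sum_(j < N) pi ^+ j *: mps_of_mpoly (p j) + pi ^+ N *: h).

(* The R-module [m, c], inside R[[X_1, ..., X_n]]. *)
Definition mc_set (m c : nat) : set S :=
  [set f | exists p, dagger_expansion m c p f].

Definition in_dagger : {pred S} := fun f =>
  `[< exists m c : nat, [/\ (0 < m)%N, (0 < c)%N & mc_set m c f] >].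

Lemma dagger_expansion_widen m c m' c' p f : (m <= m')%N -> (c <= c')%N ->
  dagger_expansion m c p f -> dagger_expansion m' c' p f.
Proof.
move=> mm' cc' [sz E]; split=> // j; apply: (leq_trans (sz j)).
by rewrite ltnS leq_add // leq_mul.
Qed.

Lemma in_dagger_common f g : f \in in_dagger -> g \in in_dagger ->
  exists m c p q, [/\ (0 < m)%N, (0 < c)%N,
    dagger_expansion m c p f & dagger_expansion m c q g].
Proof.
move=> /asboolP[m [c [m0 c0 [p Ep]]]] /asboolP[m' [c' [m'0 c'0 [q Eq]]]].
exists (maxn m m'), (maxn c c'), p, q; split.
- by rewrite leq_max m0.
- by rewrite leq_max c0.
- by apply: dagger_expansion_widen Ep; rewrite leq_maxl.
- by apply: dagger_expansion_widen Eq; rewrite leq_maxr.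
Qed.

Lemma in_dagger_mpoly p : mps_of_mpoly p \in in_dagger.
Proof.
apply/asboolP; exists (msize p).+1, 1%N; split=> //.
exists (fun j => if j == 0%N then p else 0); split=> [[|j]|[|N]] /=.
- by rewrite muln0 addn0 ltnW.
- by rewrite msize0.
- by exists (mps_of_mpoly p); rewrite big_ord0 add0r expr0 scale1r.
- exists 0; rewrite big_ord_recl /= expr0 scale1r scaler0 addr0 big1 ?addr0 //.
  by move=> i _; rewrite mps_of_mpoly0 scaler0.
Qed.

Fact in_dagger_lin : linear_closed in_dagger.
Proof.
move=> a f g /in_dagger_common fD /fD [m [c [p [q [m0 c0 [zp Ep] [zq Eq]]]]]].
apply/asboolP; exists m, c; split=> //.
exists (fun j => a *: p j + q j); split=> [j|N].
  apply: leq_trans (msizeD_le _ _) _; rewrite geq_max zq andbT.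
  exact: leq_trans (msizeZ_le _ _) (zp j).
have [h1 {1}->] := Ep N; have [h2 {1}->] := Eq N; exists (a *: h1 + h2).
rewrite scalerDr addrACA scaler_sumr -big_split /=; congr (_ + _).
  by apply: eq_bigr => j _; rewrite mps_of_mpolyD mps_of_mpolyZ scalerDr !scalerA mulrC.
by rewrite scalerDr !scalerA mulrC.
Qed.

Lemma sum_conv_trunc (p q : nat -> {mpoly R[n]}) N : exists h : {mpoly R[n]},
  (\sum_(j < N) pi ^+ j *: p j) * (\sum_(j < N) pi ^+ j *: q j) =
  \sum_(l < N) pi ^+ l *: (\sum_(i < l.+1) p i * q (l - i)%N) + pi ^+ N *: h.
Proof.
pose P := \poly_(j < N) p j; pose Q := \poly_(j < N) q j.
have sc a (u : {mpoly R[n]}) : a *: u = u * a%:A by rewrite -mulr_algr.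
have ev (s : nat -> {mpoly R[n]}) :
    \sum_(j < N) pi ^+ j *: s j = (\poly_(j < N) s j).[pi%:A].
  rewrite horner_poly; apply: eq_bigr => j _.
  by rewrite sc -(rmorphXn (in_alg {mpoly R[n]})).
rewrite !ev -hornerM.
exists (drop_poly N (P * Q)).[pi%:A].
rewrite -[LHS]/((P * Q).[_]) -{1}(poly_take_drop N (P * Q)) hornerD hornerM hornerXn.
rewrite [in RHS]sc -(rmorphXn (in_alg {mpoly R[n]})); congr (_ + _).
rewrite /take_poly !horner_poly; apply: eq_bigr => l _.
rewrite [RHS]sc -(rmorphXn (in_alg {mpoly R[n]})); congr (_ * _).
rewrite coefM; apply: eq_bigr => i _; rewrite !coef_poly.
have iN : (i < N)%N := leq_trans (ltn_ord i) (ltn_ord l).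
have lN : (l - i < N)%N := leq_ltn_trans (leq_subr i l) (ltn_ord l).
by rewrite iN lN.
Qed.

Fact in_dagger_mul : GRing.mulr_2closed in_dagger.
Proof.
move=> f g /in_dagger_common fD /fD [m [c [p [q [m0 c0 [zp Ep] [zq Eq]]]]]].
apply/asboolP; exists (m + m).+2, c; split=> //.
exists (fun l => \sum_(i < l.+1) p i * q (l - i)%N); split=> [l|N].
  apply: leq_trans (msize_sum _ _ _) _; apply/bigmax_leqP => i _.
  apply: leq_trans (msizeM_le _ _) _.
  have il : (i <= l)%N by rewrite -ltnS.
  have := leq_add (zp i) (zq (l - i)%N).
  rewrite addSn addnS addnACA -mulnDr (subnKC il) => H.
  by rewrite !addSn ltnS.
have [h1 {1}->] := Ep N; have [h2 {1}->] := Eq N.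
have [h hE] := sum_conv_trunc p q N.
have emb (s : nat -> {mpoly R[n]}) :
    \sum_(j < N) pi ^+ j *: mps_of_mpoly (s j) =
    mps_of_mpoly (\sum_(j < N) pi ^+ j *: s j).
  by rewrite mps_of_mpoly_sum; apply: eq_bigr => j _; rewrite mps_of_mpolyZ.
rewrite !emb; set s := mps_of_mpoly _; set t := mps_of_mpoly _.
have stE : s * t = mps_of_mpoly (\sum_(l < N) pi ^+ l *:
    (\sum_(i < l.+1) p i * q (l - i)%N)) + pi ^+ N *: mps_of_mpoly h.
  by rewrite -mps_of_mpolyM hE mps_of_mpolyD mps_of_mpolyZ.
exists (mps_of_mpoly h + s * h2 + h1 * t + pi ^+ N *: (h1 * h2)).
rewrite mulrDl !mulrDr stE -!scalerAl -!scalerAr.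
by rewrite (emb (fun l => \sum_(i < l.+1) p i * q (l - i)%N)) !scalerDr !addrA.
Qed.

Fact in_dagger_closed : subalg_closed in_dagger.
Proof.
split; [|exact: in_dagger_lin|exact: in_dagger_mul].
by rewrite -mps_of_mpoly1; apply: in_dagger_mpoly.
Qed.

HB.instance Definition _ := GRing.isSubalgClosed.Build R S in_dagger
  in_dagger_closed.

(* R[X]^dagger *)
Record dagger := Dagger { dagger_val : S; dagger_valP : dagger_val \in in_dagger }.
HB.instance Definition _ := [isSub for dagger_val].
HB.instance Definition _ := [Choice of dagger by <:].
HB.instance Definition _ := [SubChoice_isSubComNzRing of dagger by <:].
HB.instance Definition _ := [SubZmodule_isSubLmodule of dagger by <:].
HB.instance Definition _ := [SubNzRing_SubLmodule_isSubLalgebra of dagger by <:].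
HB.instance Definition _ := [SubLalgebra_isSubAlgebra of dagger by <:].

End Dagger.

Section Modules.
Variables (B S : comNzRingType) (f : B -> S).

Definition semilinear (U : lmodType B) (V : lmodType S) (h : U -> V) : Prop :=
  (forall u v, h (u + v) = h u + h v) /\ (forall a u, h (a *: u) = f a *: h u).

Definition is_basis (V : lmodType S) (r : nat) (e : 'I_r -> V) : Prop :=
  forall v, exists! c : {ffun 'I_r -> S}, v = \sum_i c i *: e i.

(* For a ring homomorphism f, let S_f be S viewed as a B-module through f.  The
   element \sum_(x <- s) x.1 (x) x.2 of the tensor product of S_f and U over B
   vanishes iff every biadditive B-balanced map kills it. *)
Definition tensor_eq0 (U : lmodType B) (s : seq (S * U)) : Prop :=
  forall (W : zmodType) (b : S -> U -> W),
    (forall a a' u, b (a + a') u = b a u + b a' u) ->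
    (forall a u u', b a (u + u') = b a u + b a u') ->
    (forall a c u, b (a * f c) u = b a (c *: u)) ->
    \sum_(x <- s) b x.1 x.2 = 0.

(* The S-linear map from the tensor product of S_f and U to V sending a (x) u
   to a *: h u is bijective. *)
Definition linearization_bij (U : lmodType B) (V : lmodType S) (h : U -> V)
    : Prop :=
  (forall v, exists s : seq (S * U), v = \sum_(x <- s) x.1 *: h x.2) /\
  (forall s : seq (S * U), \sum_(x <- s) x.1 *: h x.2 = 0 -> tensor_eq0 s).

Definition flat : Prop :=
  forall (U U' : lmodType B) (g : {linear U -> U'}), injective g ->
  forall s : seq (S * U),
    tensor_eq0 [seq (x.1, g x.2) | x <- s] -> tensor_eq0 s.

End Modules.

Section Schemes.
Variables (k : fieldType) (C : comAlgType k).

Definition finitely_presented : Prop :=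
  exists (n r : nat) (h : {lrmorphism {mpoly k[n]} -> C})
    (g : 'I_r -> {mpoly k[n]}),
  (forall y, exists x, h x = y) /\
  (forall x, h x = 0 <-> exists c : 'I_r -> {mpoly k[n]}, x = \sum_i c i * g i).

(* Infinitesimal lifting along square-zero extensions B -> B' of k-algebras. *)
Definition formally_smooth : Prop :=
  forall (B B' : comAlgType k) (s : {lrmorphism B -> B'}),
    (forall y, exists x, s x = y) ->
    (forall x y, s x = 0 -> s y = 0 -> x * y = 0) ->
  forall h : {lrmorphism C -> B'},
  exists h' : {lrmorphism C -> B}, forall x, s (h' x) = h x.

Definition smooth : Prop := finitely_presented /\ formally_smooth.

Definition prime_ideal (P : {pred C}) : Prop :=
  idealr_closed P /\ prime_idealr_closed P.

(* Spec C is not the disjoint union of two nonempty closed sets V(Z), V(Z')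
   (it is nonempty since 1 != 0 in C). *)
Definition connected_spec : Prop :=
  forall Z Z' : {pred C},
    (forall P, prime_ideal P -> {subset Z <= P} \/ {subset Z' <= P}) ->
    (forall P, prime_ideal P -> ~ ({subset Z <= P} /\ {subset Z' <= P})) ->
    (forall P, prime_ideal P -> ~ {subset Z <= P}) \/
    (forall P, prime_ideal P -> ~ {subset Z' <= P}).

Definition prime_chain (l : nat) : Prop :=
  exists P : nat -> {pred C},
    (forall i, (i <= l)%N -> prime_ideal (P i)) /\
    (forall i, (i < l)%N ->
      {subset P i <= P i.+1} /\ ~ {subset P i.+1 <= P i}).

Definition krull_dim (d : nat) : Prop := prime_chain d /\ ~ prime_chain d.+1.

End Schemes.

Section Lifts.
Variables (R : comNzRingType) (pi : R).

Definition separated (V : lmodType R) : Prop :=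
  forall x : V, (forall n, exists y, x = pi ^+ n *: y) -> x = 0.

(* io : A -> Ah identifies Ah with the pi-adic completion of A. *)
Definition pi_completion (A Ah : comAlgType R) (io : {lrmorphism A -> Ah})
    : Prop :=
  [/\ separated Ah,
      (forall u : nat -> Ah,
        (forall n, exists y, u n.+1 - u n = pi ^+ n *: y) ->
        exists l, forall n, exists y, l - u n = pi ^+ n *: y),
      (forall n x, exists a y, x = io a + pi ^+ n *: y)
    & (forall n a, (exists y, io a = pi ^+ n *: y) -> exists b, a = pi ^+ n *: b)].

Definition derivation (A : comAlgType R) (V : lmodType A) (D : A -> V) : Prop :=
  [/\ forall a b, D (a + b) = D a + D b,
      forall a b, D (a * b) = a *: D b + b *: D a
    & forall c : R, D c%:A = 0].

Definition separated_over (A : comAlgType R) (V : lmodType A) : Prop :=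
  forall x : V, (forall n, exists y, x = (pi%:A : A) ^+ n *: y) -> x = 0.

(* (Om, D) is the quotient of the Kaehler differentials of A over R by the
   elements that are infinitely divisible by pi, i.e. D is the universal
   derivation into separated A-modules. *)
Definition separated_differentials (A : comAlgType R) (Om : lmodType A)
    (D : A -> Om) : Prop :=
  [/\ separated_over Om, derivation D
    & forall (V : lmodType A) (D' : A -> V), separated_over V -> derivation D' ->
      exists h : {linear Om -> V}, (forall a, D' a = h (D a)) /\
        forall h' : {linear Om -> V}, (forall a, D' a = h' (D a)) -> h' =1 h].

(* A is free of rank N over its subring sg(A). *)
Definition free_over_image (A : comAlgType R) (sg : A -> A) (N : nat) : Prop :=
  exists b : 'I_N -> A, forall a, exists! c : {ffun 'I_N -> A},
    (forall i, exists x, c i = sg x) /\ a = \sum_i c i * b i.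

End Lifts.

Section SigmaModules.
Variables (B : comNzRingType) (sg : B -> B).

Definition finite_free (V : lmodType B) : Prop :=
  exists (r : nat) (e : 'I_r -> V), is_basis e.

Definition sigma_module (M : lmodType B) (phi : M -> M) : Prop :=
  finite_free M /\ semilinear sg phi.

Definition unit_root (U : lmodType B) (phi : U -> U) : Prop :=
  linearization_bij sg phi.

Definition free_submodule (M : lmodType B) (F : {pred M}) : Prop :=
  submod_closed F /\
  exists (r : nat) (e : 'I_r -> M), (forall i, e i \in F) /\
    forall x, x \in F -> exists! c : {ffun 'I_r -> B}, x = \sum_i c i *: e i.

(* The filtration F (with F 0 = 0, so it is separated) makes (M, phi) ordinary
   with graded pieces (U i, psi i): pr i, which only matters on F i.+1, induces
   an isomorphism from (F i.+1 / F i, phi) to (U i, pi^i psi i). *)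
Definition ordinary_filtration (pi : B) (M : lmodType B) (phi : M -> M)
    (F : nat -> {pred M}) (U : nat -> lmodType B) (pr : forall i, M -> U i)
    (psi : forall i, U i -> U i) : Prop :=
  [/\ (forall x, (x \in F 0%N) = (x == 0)),
      (forall i, {subset F i <= F i.+1}),
      (forall x, exists i, x \in F i),
      (forall i, free_submodule (F i) /\
        (forall x, x \in F i -> phi x \in F i))
    & forall i,
      [/\ sigma_module (@psi i) /\ unit_root (@psi i),
          (forall a x y, x \in F i.+1 -> y \in F i.+1 ->
            pr i (a *: x + y) = a *: pr i x + pr i y),
          (forall x, x \in F i.+1 -> (pr i x = 0 <-> x \in F i)),
          (forall u, exists2 x, x \in F i.+1 & pr i x = u)
        & (forall x, x \in F i.+1 -> pr i (phi x) = pi ^+ i *: psi i (pr i x))]].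

(* Columns are the images of the basis vectors. *)
Definition matrix_of (U : lmodType B) (phi : U -> U) (r : nat)
    (e : 'I_r -> U) (m : 'M[B]_r) : Prop :=
  forall j, phi (e j) = \sum_i m i j *: e i.

End SigmaModules.

Definition overconvergent (A Ah : comNzRingType) (io : A -> Ah) (sg : A -> A)
    (M : lmodType Ah) (phi : M -> M) : Prop :=
  exists (M0 : lmodType A) (phi0 : M0 -> M0) (j : M0 -> M),
    [/\ sigma_module sg phi0, semilinear io j, linearization_bij io j
      & forall x, j (phi0 x) = phi (j x)].

Local Open Scope ereal_scope.

Section Nuclear.
Variables (S : comNzRingType) (w : S) (E : set S).

(* ord_pi relative to the module E; w is the image of pi in the ambient ring S,
   in which the powers of x are taken. *)
Definition ord (x : S) : \bar RR :=
  ereal_sup [set z | exists n m : nat, [/\ (0 < m)%N,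
    exists2 y, E y & (x ^+ m = w ^+ n * y)%R & z = (n%:R / m%:R)%:E]].

Definition nuclear (I : countType) (a : I -> I -> S) : Prop :=
  (forall i j, E (a i j)) /\
  forall C : RR, (0 < C)%R ->
    finite_set [set j | ereal_inf [set ord (a i j) | i in [set: I]] < C%:E].

Definition ord_mx (I : countType) (a : I -> I -> S) : \bar RR :=
  ereal_inf [set ord (a ij.1 ij.2) | ij in [set: I * I]].

End Nuclear.

Section Delta.
Variables (B : comNzRingType) (w : B) (sg : {rmorphism B -> B}).
Local Notation ordB := (ord w [set: B]).

Definition has_sum (J : choiceType) (a : J -> B) (s : B) : Prop :=
  forall n : nat, exists F : {fset J}, forall F' : {fset J}, (F `<=` F')%fset ->
    exists y, (s - \sum_(j <- F') a j = w ^+ n * y)%R.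

Definition is_mxprod (I J L : choiceType) (P : I -> J -> B) (Q : J -> L -> B)
    (T : I -> L -> B) : Prop :=
  forall i l, has_sum (fun j => P i j * Q j l)%R (T i l).

Definition mx_one (I : choiceType) (i j : I) : B := ((i == j)%:R)%R.

(* Index sets are subsets of nat, so that nuclear matrices form a small type;
   nucmat_of transports a matrix over any countType through pickle. *)
Record nucmat := NucMat {
  ndom : pred nat;
  nent :> {i : nat | ndom i} -> {i : nat | ndom i} -> B;
  nentP : nuclear w [set: B] nent }.

Definition nidx (N : nucmat) : countType := {i : nat | ndom N i}.

Lemma nuclear_reindex (I J : countType) (f : J -> I) (a : I -> I -> B) :
  bijective f -> nuclear w [set: B] a ->
  nuclear w [set: B] (fun i j => a (f i) (f j)).
Proof.
move=> [g fK gK] [_ fin]; split=> // C C0.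
apply: (sub_finite_set _ (finite_image g (fin C C0))) => j /= jC.
exists (f j) => //=; apply: le_lt_trans jC.
apply: ereal_inf_le_tmp => _ [i _ <-].
by exists (f i).
Qed.

Section NucmatOf.
Variables (I : countType) (a : I -> I -> B).

Let code (i : I) : nat := choice.pickle i.
Definition pickle_dom : pred nat := fun n => isSome (@pickle_inv I n).

Lemma pickle_domP (i : I) : pickle_dom (code i).
Proof. by rewrite /pickle_dom pickleK_inv. Qed.

Definition of_pickle_dom (x : {n | pickle_dom n}) : I := oextract (valP x).

Lemma of_pickle_dom_bij : bijective of_pickle_dom.
Proof.
exists (fun i => Sub (code i) (pickle_domP i)) => [x|i].
  apply: val_inj; rewrite /= /of_pickle_dom /code.
  have := pickle_invK (T := I) (val x).
  by rewrite -{1}(Some_oextract (valP x)) /=.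
apply: Some_inj; rewrite /of_pickle_dom Some_oextract.
by rewrite /= pickleK_inv.
Qed.

Definition nucmat_of (aP : nuclear w [set: B] a) : nucmat :=
  NucMat (nuclear_reindex of_pickle_dom_bij aP).

End NucmatOf.

HB.instance Definition _ := gen_eqMixin nucmat.
HB.instance Definition _ := gen_choiceMixin nucmat.

(* All products in S S', S' S and, for both bracketings, in S' N1 S^sg are
   required to converge. *)
Definition sigma_similar (N1 N2 : nucmat) : Prop :=
  exists (S : nidx N1 -> nidx N2 -> B) (S' : nidx N2 -> nidx N1 -> B),
    let Ssg i j := sg (S i j) in
    [/\ is_mxprod S S' (@mx_one _), is_mxprod S' S (@mx_one _),
        (exists P, is_mxprod S' N1 P /\ is_mxprod P Ssg N2)
      & (exists Q, is_mxprod N1 Ssg Q /\ is_mxprod S' Q N2)].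

Definition block_triangular (N N' N'' : nucmat) : Prop :=
  exists f : nidx N' + nidx N'' -> nidx N,
    [/\ bijective f,
        forall i j, N (f (inl i)) (f (inr j)) = 0%R,
        forall i j, N (f (inl i)) (f (inl j)) = N' i j
      & forall i j, N (f (inr i)) (f (inr j)) = N'' i j].

Local Open Scope ring_scope.

Inductive delta_relator : {freeg nucmat} -> Prop :=
| DeltaSimilar N1 N2 : sigma_similar N1 N2 ->
    delta_relator (<< N1 >> - << N2 >>)
| DeltaBlock N N' N'' : block_triangular N N' N'' ->
    delta_relator (<< N >> - << N' >> - << N'' >>).

Definition delta_relations : {pred {freeg nucmat}} := fun x =>
  `[< forall P : {pred {freeg nucmat}}, zmod_closed P ->
        (forall y, delta_relator y -> y \in P) -> x \in P >].

Fact delta_relations_closed : zmod_closed delta_relations.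
Proof.
split; first by apply/asboolP => P [].
move=> x y /asboolP Dx /asboolP Dy; apply/asboolP => P cP rP.
by case: (cP) => _; apply; [exact: Dx|exact: Dy].
Qed.
HB.instance Definition _ := GRing.isZmodClosed.Build _ delta_relations
  delta_relations_closed.

(* Dividing the free abelian group on the matrices themselves also by the
   differences of sigma-similar ones amounts to taking sigma-similarity classes
   as generators. *)
Definition Delta : zmodType := Quotient.quot delta_relations.

Definition delta_class (N : nucmat) : Delta := \pi_(Delta)%qT << N >>.

Fact finite_nuclear (I : finType) (a : I -> I -> B) : nuclear w [set: B] a.
Proof. by split=> // C _; apply: finite_finset. Qed.

Definition finite_class (r : nat) (m : 'M[B]_r) : Delta :=
  delta_class (nucmat_of (@finite_nuclear 'I_r (fun i j => m i j))).

(* pi-adic convergence of a sequence of matrices to 0 *)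
Definition ord_to_infty (N : nat -> nucmat) : Prop :=
  (fun n => ord_mx w [set: B] (N n)) @ \oo --> +oo%E.

Section BlockDiag.
Variables (N : nat -> nucmat) (mult : nat -> nat).

Definition block_idx : countType := {n : nat & (nidx (N n) * 'I_(mult n))%type}.

(* mult n diagonal copies of N n, for all n *)
Definition block_diag (x y : block_idx) : B :=
  let y' := tagged_as x y in
  if (tag x == tag y) && ((tagged x).2 == y'.2)
  then N (tag x) (tagged x).1 y'.1 else 0.

Lemma ord0 : ord w [set: B] 0 = +oo%E.
Proof.
apply/eqyP => C C0; apply: (@le_trans _ _ (((Num.truncn C).+1)%:R%:E)).
  by rewrite lee_fin ltW // truncnS_gt.
apply: ereal_sup_ubound; exists (Num.truncn C).+1, 1%N; split=> //.
  by exists 0; rewrite // expr1 mulr0.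
by rewrite divr1.
Qed.

Fact block_diag_nuclear : ord_to_infty N -> nuclear w [set: B] block_diag.
Proof.
move=> cv; split=> // C C0.
have [n0 _ n0P] : \forall n \near \oo, (C%:E <= ord_mx w [set: B] (N n))%E.
  apply: (cv [set x | (C%:E <= x)%E]); exists C.
  by split=> [|x /ltW //]; rewrite num_real.
pose bad n := [set j | (ereal_inf [set ord w [set: B] (N n i j)
                                  | i in [set: nidx (N n)]] < C%:E)%E].
pose BX n : set block_idx :=
  (fun p => Tagged (fun n => (nidx (N n) * 'I_(mult n))%type) p) @`
  (bad n `*` [set: 'I_(mult n)]).
apply: (@sub_finite_set _ _ (\bigcup_(n in `I_n0) BX n)); last first.
  apply: bigcup_finite => [|n _]; first exact: finite_II.
  apply: finite_image; apply: finite_setX => //.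
  exact: (nentP (N n)).2.
move=> [n [j c]] /= jC.
have badj : bad n j.
  rewrite /bad /= ltNge; apply/negP => Cle; move: jC; rewrite ltNge => /negP; apply.
  apply: le_ereal_inf_tmp => _ [[n' [i c']] _ <-]; rewrite /block_diag /=.
  have [E|_] := eqVneq n' n; last by rewrite ord0 leey.
  subst n'; rewrite tagged_asE /=; case: ifP => _; last by rewrite ord0 leey.
  by apply: le_trans Cle _; apply: ereal_inf_lbound; exists i.
exists n; last by exists (j, c).
rewrite /= ltnNge; apply/negP => n0n; move: badj; rewrite /bad /= ltNge => /negP.
apply; apply: le_trans (n0P n n0n) _; apply: ereal_inf_le_tmp => _ [i _ <-].
by exists (i, j).
Qed.

End BlockDiag.

Definition mult_pos (nu : nat -> int) (n : nat) : nat :=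
  if 0 < nu n then `|nu n|%N else 0%N.
Definition mult_neg (nu : nat -> int) (n : nat) : nat :=
  if nu n < 0 then `|nu n|%N else 0%N.

(* \sum_n nu n [N n] *)
Definition delta_series (nu : nat -> int) (N : nat -> nucmat)
    (cv : ord_to_infty N) : Delta :=
  delta_class (nucmat_of (block_diag_nuclear (mult_pos nu) cv)) -
  delta_class (nucmat_of (block_diag_nuclear (mult_neg nu) cv)).

End Delta.

(* pr is the quotient map from R[X]^dagger to A. *)
Definition nuclear_overconvergent (n : nat) (R : comNzRingType) (pi : R)
    (A : comAlgType R) (pr : dagger n pi -> A) (I : countType)
    (a : I -> I -> A) : Prop :=
  exists (m c : nat) (b : I -> I -> dagger n pi),
    [/\ (0 < m)%N, (0 < c)%N,
        nuclear (pi%:A : mpseries n R) (mc_set pi m c)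
          (fun i j => dagger_val (b i j))
      & forall i j, a i j = pr (b i j)].

(* Main.v *)
(** A graded piece is the value at a fixed point of a matrix of power series.  In a
    suitably rescaled overconvergent basis approximating the filtration, a step of the
    filtration is spanned by the columns of [P + pi^e y] for a projection [P], and its
    stability under [phi] is a Riccati equation [y = F (sigma y)], where [F] is a
    contracting power series with overconvergent coefficients.  Using the two steps around
    the given piece, its matrix is sigma-similar to [rho = G (sigma y)] for another such
    series [G].

    The operator [h (x) e_b |-> h (F) (x) G_b] on power series in non-commuting letters has a
    nuclear overconvergent matrix [C (F, G)] in the basis of words.  Translating the letters
    to the fixed point is a sigma-similarity over the completion, after which the matrix is
    triangular for the length of words, with graded pieces [W^l (x) rho], where [W] is the
    linear part of [F] at the fixed point.  Hence [C (F, G)] is the sum of the classes of all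
    [W^l (x) rho] with [l >= 0], while [C (F, dF (x) G)] is the sum of those with [l >= 1], and
    [rho] is the difference of the two. *)
Require Import Defs.
From HB Require Import structures.
From mathcomp Require Import all_boot all_order all_algebra finmap.
From mathcomp Require Import boolp classical_sets functions cardinality.
From mathcomp Require Import mpoly freeg.
From mathcomp Require Import reals constructive_ereal ereal topology Rstruct.
From mathcomp Require Import perm zify.
Set Implicit Arguments.
Unset Strict Implicit.
Unset Printing Implicit Defensive.
Import Order.TTheory GRing.Theory Num.Theory.
Local Open Scope ring_scope.

(** The fixed point lives only over [Ahat], but the operator is built from the coefficients of [F]
    and [G] alone, and the fixed point enters only through a similarity over [Ahat]. Non-commuting
    letters keep the elimination short: with commuting ones the graded pieces would be symmetric
    powers of [W] tensored with [rho], and isolating [rho] would take an alternating sum over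
    exterior powers, whereas the tensor algebra satisfies T(W) = 1 + W (x) T(W), so two classes
    suffice. The obstacle is uniformity: the rows of the operator are products of arbitrarily many
    entries of [F], and all of them must lie in a single [m, c]. A factor [pi] on each coefficient
    of [F] lets the slope c absorb the degree offset m. These factors come from the rescaling:
    conjugation by powers of [pi] growing fast with the level makes the blocks above the diagonal
    highly divisible, and the overconvergent basis must approximate the adapted one closely enough
    to survive this conjugation. *)

(** * Words, and power series in non-commuting letters *)

Section Words.
Variable X : finType.

(** The bound on the length is strict, so that a series whose coefficient at [v] is divisible by
    [w ^+ size v] is determined modulo [w ^+ n] by its coefficients on [words n]. *)
Fixpoint words (n : nat) : seq (seq X) :=
  if n is n'.+1 then [::] :: [seq x :: v | x <- enum X, v <- words n'] else [::].

Lemma mem_words n v : (v \in words n) = (size v < n)%N.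
Proof.
elim: n v => [|n IH] [|x v] //=; rewrite inE /= ltnS -IH.
apply/allpairsP/idP => [[[y u] /= [_ uw [_ ->]]] //|vw].
by exists (x, v); rewrite mem_enum.
Qed.

Lemma words_uniq n : uniq (words n).
Proof.
elim: n => //= n IH; apply/andP; split.
  by apply/negP => /allpairsP[[y u] /= [_ _]].
by apply: allpairs_uniq => //; [exact: enum_uniq|move=> [a b] [c d] _ _ /= [-> ->]].
Qed.

Lemma sum_words (V : nmodType) n (f : seq X -> V) :
  \sum_(v <- words n.+1) f v = f [::] + \sum_x \sum_(v <- words n) f (x :: v).
Proof. by rewrite /= big_cons big_allpairs_dep /= big_enum. Qed.

(** Cutting a word in two gives a pair of words with total length below [n]; a truncated evaluation
    of a product thus becomes a double sum. *)
Lemma sum_words_split (V : nmodType) n (f : seq X -> seq X -> V) :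
  \sum_(v <- words n) \sum_(i < (size v).+1) f (take i v) (drop i v) =
  \sum_(v <- words n) \sum_(u <- words (n - size v)) f v u.
Proof.
elim: n f => [|n IH] f; first by rewrite !big_nil.
have S (v : seq X) : \sum_(i < (size v).+1) f (take i v) (drop i v) =
    f [::] v + (if v is x :: v' then
      \sum_(i < (size v').+1) f (x :: take i v') (drop i v') else 0).
  by rewrite big_ord_recl take0 drop0; case: v => //=; rewrite big_ord0.
under eq_bigr => v _ do rewrite S.
rewrite big_split /= -/(words n.+1) [X in _ + X = _]sum_words add0r.
rewrite [RHS]sum_words subn0; congr (_ + _); apply: eq_bigr => x _.
by under [RHS]eq_bigr => v _ do rewrite subSS; exact: (IH (fun u v => f (x :: u) v)).
Qed.

End Words.

(* A function [seq X -> B] is a power series in non-commuting letters. *)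
Section Series.
Variables (X : finType) (B : comNzRingType).
Implicit Types (f g h : seq X -> B) (s : X -> B) (u v : seq X).

Definition smul f g v := \sum_(i < (size v).+1) f (take i v) * g (drop i v).

(** The product F_{k_1} ... F_{k_r} h for the word [I] = k_1 ... k_r: substitution of [F] in the
    monomial [I], times [h]. *)
Definition act (F : X -> seq X -> B) (I : seq X) h := foldr (fun k => smul (F k)) h I.

Lemma smulDl f f' g v : smul (fun v => f v + f' v) g v = smul f g v + smul f' g v.
Proof. by rewrite /smul -big_split; apply: eq_bigr => i _; rewrite mulrDl. Qed.

Lemma eq_smul f f' g g' : f =1 f' -> g =1 g' -> smul f g =1 smul f' g'.
Proof. by move=> ff gg v; apply: eq_bigr => i _; rewrite ff gg. Qed.

Lemma eq_act F F' I h h' : (forall k, F k =1 F' k) -> h =1 h' -> act F I h =1 act F' I h'.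
Proof. by move=> FF hh; elim: I => //= k I IH; apply: eq_smul. Qed.

Lemma smul_const c g v : smul (fun v => c * (v == [::])%:R) g v = c * g v.
Proof.
rewrite /smul big_ord_recl take0 drop0 eqxx mulr1 big1 ?addr0 // => i _.
by case: v i => [|x v] [i /= iv] //; rewrite mulr0 mul0r.
Qed.

Lemma smul_nil f g : smul f g [::] = f [::] * g [::].
Proof. by rewrite /smul big_ord1. Qed.

(* The coefficient of the word [u] in the product over [x <- v] of the s_x + x. *)
Fixpoint shift s v u : B :=
  if v is x :: v' then
    s x * shift s v' u + (if u is y :: u' then (x == y)%:R * shift s v' u' else 0)
  else (u == [::])%:R.

Lemma shift_gt s v u : (size v < size u)%N -> shift s v u = 0.
Proof.
elim: v u => [|x v IH] [|y u] //= vu.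
by rewrite !IH ?mulr0 ?addr0 // ltnW.
Qed.

Lemma shift_cat s v v' u : shift s (v ++ v') u =
  \sum_(i < (size u).+1) shift s v (take i u) * shift s v' (drop i u).
Proof.
elim: v u => [|x v IH] u /=.
  rewrite big_ord_recl take0 drop0 eqxx mul1r big1 ?addr0 // => i _.
  by case: u i => [|y u] [i /= iu] //; rewrite mul0r.
under eq_bigr => i _ do rewrite mulrDl -mulrA.
rewrite IH big_split /= -mulr_sumr; congr (_ + _).
case: u => [|y u]; first by rewrite big_ord1 mul0r.
rewrite big_ord_recl take0 mul0r add0r IH mulr_sumr.
by apply: eq_bigr => i _ /=; rewrite mulrA.
Qed.

Lemma shift0 v u : shift (fun=> 0) v u = (v == u)%:R.
Proof.
elim: v u => [|x v IH] [|y u] //=; rewrite mul0r add0r // IH eqseq_cons.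
by case: eqP; rewrite /= ?mul1r ?mul0r.
Qed.

(** Translations compose additively. The sum is finite because translating [v] produces no word
    longer than [v]; the case [s' = - s] inverts the base change below. *)
Lemma shift_comp s s' v u n : (size v < n)%N ->
  \sum_(t <- words X n) shift s v t * shift s' t u = shift (fun x => s x + s' x) v u.
Proof.
elim: v u n => [|x v IH] u [//|n] vn.
  rewrite sum_words /= mul1r big1 ?addr0 // => y _.
  by rewrite big1 // => t _; rewrite mul0r.
under eq_bigr => t _ do rewrite /= mulrDl -mulrA.
rewrite big_split /= -mulr_sumr (IH u n.+1 (ltnW vn)).
rewrite -/(words X n.+1) sum_words /= mul0r add0r.
have -> : \sum_(y : X) \sum_(t <- words X n) (x == y)%:R * shift s v t *
      (s' y * shift s' t u + (if u is z :: u' then (y == z)%:R * shift s' t u' else 0))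
  = \sum_(t <- words X n) shift s v t *
      (s' x * shift s' t u + (if u is z :: u' then (x == z)%:R * shift s' t u' else 0)).
  rewrite (bigD1 x) //= [X in _ + X]big1 ?addr0 => [|y /negPf yx].
    by apply: eq_bigr => t _; rewrite eqxx mul1r.
  by rewrite big1 // => t _; rewrite eq_sym yx !mul0r.
under eq_bigr => t _ do rewrite mulrDr mulrCA.
rewrite big_split /= -mulr_sumr IH // mulrDl addrA; congr (_ + _).
case: u => [|y u]; first by rewrite big1 // => t _; rewrite mulr0.
by under eq_bigr => t _ do rewrite mulrCA; rewrite -mulr_sumr IH.
Qed.

End Series.

Lemma shift_rmorph (X : finType) (B C : comNzRingType) (h : {rmorphism B -> C})
  (s : X -> B) v u : h (shift s v u) = shift (h \o s) v u.
Proof.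
elim: v u => [|x v IH] u /=; first by rewrite rmorph_nat.
rewrite rmorphD rmorphM IH; congr (_ + _); case: u => [|y u]; first by rewrite rmorph0.
by rewrite rmorphM rmorph_nat IH.
Qed.

Lemma smul_rmorph (X : finType) (B C : comNzRingType) (h : {rmorphism B -> C})
  (f g : seq X -> B) v : h (smul f g v) = smul (h \o f) (h \o g) v.
Proof. by rewrite rmorph_sum; apply: eq_bigr => i _; rewrite rmorphM. Qed.

Lemma act_rmorph (X : finType) (B C : comNzRingType) (h : {rmorphism B -> C})
  (F : X -> seq X -> B) I (g : seq X -> B) v :
  h (act F I g v) = act (fun k => h \o F k) I (h \o g) v.
Proof.
elim: I v => //= k I IH v; rewrite smul_rmorph.
exact: eq_smul.
Qed.

(** * Adic limits: translation and evaluation of convergent series *)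

Section Limits.
Variables (B : comNzRingType) (w : B).

Definition dvw n (x : B) := exists y, x = w ^+ n * y.

Lemma dvw0 n : dvw n 0. Proof. by exists 0; rewrite mulr0. Qed.
Lemma dvwn0 x : dvw 0 x. Proof. by exists x; rewrite mul1r. Qed.
Lemma dvwD n x y : dvw n x -> dvw n y -> dvw n (x + y).
Proof. by move=> [a ->] [b ->]; exists (a + b); rewrite mulrDr. Qed.
Lemma dvwN n x : dvw n x -> dvw n (- x).
Proof. by move=> [a ->]; exists (- a); rewrite mulrN. Qed.
Lemma dvwB n x y : dvw n x -> dvw n y -> dvw n (x - y).
Proof. by move=> hx hy; apply: dvwD => //; apply: dvwN. Qed.
Lemma dvwM m n x y : dvw m x -> dvw n y -> dvw (m + n) (x * y).
Proof. by move=> [a ->] [b ->]; exists (a * b); rewrite exprD mulrACA. Qed.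
Lemma dvwMl n x y : dvw n y -> dvw n (x * y).
Proof. exact: (@dvwM 0 n x y (dvwn0 x)). Qed.
Lemma dvwMr n x y : dvw n x -> dvw n (x * y).
Proof. by rewrite mulrC; exact: dvwMl. Qed.
Lemma dvw_le m n x : (m <= n)%N -> dvw n x -> dvw m x.
Proof. by move=> mn [y ->]; exists (w ^+ (n - m) * y); rewrite mulrA -exprD subnKC. Qed.
Lemma dvw_exp n x : dvw n (w ^+ n * x). Proof. by exists x. Qed.
Lemma dvw_sum n (I : Type) (r : seq I) (P : pred I) (F : I -> B) :
  (forall i, P i -> dvw n (F i)) -> dvw n (\sum_(i <- r | P i) F i).
Proof. by move=> H; elim/big_ind: _ => //; [exact: dvw0|exact: dvwD]. Qed.
Lemma dvw_sumseq n (I : eqType) (r : seq I) (F : I -> B) :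
  (forall i, i \in r -> dvw n (F i)) -> dvw n (\sum_(i <- r) F i).
Proof. by move=> H; rewrite big_seq; apply: dvw_sum. Qed.
Lemma dvw_trans n x y z : dvw n (x - y) -> dvw n (y - z) -> dvw n (x - z).
Proof. by move=> h1 h2; have := dvwD h1 h2; rewrite addrA subrK. Qed.
Lemma dvw_sym n x y : dvw n (x - y) -> dvw n (y - x).
Proof. by move=> /dvwN; rewrite opprB. Qed.

Definition sepw := forall x, (forall n, dvw n x) -> x = 0.
Definition complw := forall u : nat -> B, (forall n, dvw n (u n.+1 - u n)) ->
  exists l, forall n, dvw n (l - u n).

Lemma sepw_eq : sepw -> forall x y, (forall n, dvw n (x - y)) -> x = y.
Proof. by move=> sep x y h; apply/eqP; rewrite -subr_eq0; apply/eqP/sep. Qed.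

Section Shift.
Variables (X : finType).
Implicit Types (f g : seq X -> B) (s : X -> B).

(** These series converge at every point of a complete ring, and products respect the condition
    without loss. *)
Definition cvs f := forall v, dvw (size v) (f v).

(* g(x) = f(s + x) *)
Definition slim s f g := forall n u,
  dvw n (g u - \sum_(v <- words X n) f v * shift s v u).

Lemma cvs_mul f g : cvs f -> cvs g -> cvs (smul f g).
Proof.
move=> hf hg v; apply: dvw_sum => i _.
have {1}-> : size v = (size (take i v) + size (drop i v))%N.
  by rewrite -size_cat cat_take_drop.
exact: dvwM.
Qed.

Lemma cvs_act (F : X -> seq X -> B) I h :
  (forall k, cvs (F k)) -> cvs h -> cvs (act F I h).
Proof. by move=> hF hh; elim: I => //= k I IH; apply: cvs_mul. Qed.

(** At precision [size u] only words shorter than [u] contribute, and their translates have no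
    coefficient at [u]. *)
Lemma slim_cvs s f g : slim s f g -> cvs f -> cvs g.
Proof.
move=> h _ u; have := h (size u) u; rewrite big1_seq ?subr0 // => v /=.
by rewrite mem_words => vu; rewrite shift_gt ?mulr0.
Qed.

Lemma slim_exists s f : complw -> cvs f -> exists g, slim s f g.
Proof.
move=> cmp cf.
have H u : exists l, forall n, dvw n (l - \sum_(v <- words X n) f v * shift s v u).
  apply: cmp => n.
  have fil m k : (m <= k)%N -> forall F : seq X -> B, \sum_(v <- words X m) F v =
      \sum_(v <- words X k | (size v < m)%N) F v.
    move=> mk F; rewrite -[RHS]big_filter; apply: perm_big.
    apply: uniq_perm; rewrite ?filter_uniq ?words_uniq // => v.
    rewrite mem_filter !mem_words; apply/idP/andP => [vm|[]//].
    by split=> //; exact: leq_trans vm mk.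
  rewrite (fil n n.+1) // (bigID (fun v => size v < n)%N) /= addrC addrK.
  apply: dvw_sum => v; rewrite -leqNgt => nv; apply: dvwMr; exact: dvw_le (cf v).
have [g hg] := choice H.
by exists g => n u; apply: hg.
Qed.

(** In a product truncated by total length, the second factor is only known modulo
    [w ^+ (n - size v)] next to the word [v] of the first; the divisibility of [f v] by
    [w ^+ size v] makes up for the difference. *)
Lemma slim_mul s f f' g g' : cvs f -> slim s f f' -> slim s g g' ->
  slim s (smul f g) (smul f' g').
Proof.
move=> cf hf hg n u.
have -> : \sum_(v <- words X n) smul f g v * shift s v u =
  \sum_(j < (size u).+1) \sum_(v <- words X n) \sum_(v' <- words X (n - size v))
    (f v * shift s v (take j u)) * (g v' * shift s v' (drop j u)).
  rewrite [RHS]exchange_big /=.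
  under [RHS]eq_bigr => v _ do rewrite exchange_big /=.
  rewrite -(sum_words_split n (fun v v' => \sum_(j < (size u).+1)
    (f v * shift s v (take j u)) * (g v' * shift s v' (drop j u)))).
  apply: eq_bigr => v _; rewrite mulr_suml; apply: eq_bigr => i _.
  rewrite -[X in shift s X u](cat_take_drop i v) shift_cat mulr_sumr; apply: eq_bigr => j _.
  by rewrite mulrACA.
rewrite /smul -sumrB; apply: dvw_sum => j _.
apply: (@dvw_trans _ _ ((\sum_(v <- words X n) f v * shift s v (take j u)) * g' (drop j u))).
  by rewrite -mulrBl; apply: dvwMr.
rewrite mulr_suml -sumrB; apply: dvw_sumseq => v; rewrite mem_words => vn.
rewrite -mulr_sumr -mulrBr -{1}(subnKC (ltnW vn)); apply: dvwM; last exact: hg.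
exact: dvwMr.
Qed.

Lemma slim_act s (F F' : X -> seq X -> B) I h h' : (forall k, cvs (F k)) ->
  (forall k, slim s (F k) (F' k)) -> slim s h h' -> slim s (act F I h) (act F' I h').
Proof. by move=> cF sF sh; elim: I => //= k I IH; apply: slim_mul. Qed.

(* f(s) = a *)
Definition sev s f a := forall n, dvw n (a - \sum_(v <- words X n) f v * shift s v [::]).

Lemma slim_sev s f g : slim s f g -> sev s f (g [::]).
Proof. by move=> h n; apply: h. Qed.

Lemma sev_uniq s f a b : sepw -> sev s f a -> sev s f b -> a = b.
Proof.
move=> sep h h'; apply: sepw_eq => // n; exact: dvw_trans (h n) (dvw_sym (h' n)).
Qed.

Lemma sev_mul s f g a b : cvs f -> sev s f a -> sev s g b -> sev s (smul f g) (a * b).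
Proof.
move=> cf hf hg n.
have -> : \sum_(v <- words X n) smul f g v * shift s v [::] =
  \sum_(v <- words X n) \sum_(v' <- words X (n - size v))
    (f v * shift s v [::]) * (g v' * shift s v' [::]).
  rewrite -(sum_words_split n (fun v v' =>
    (f v * shift s v [::]) * (g v' * shift s v' [::]))).
  apply: eq_bigr => v _; rewrite mulr_suml; apply: eq_bigr => i _.
  by rewrite -[X in shift s X [::]](cat_take_drop i v) shift_cat big_ord1 mulrACA.
apply: (@dvw_trans _ _ ((\sum_(v <- words X n) f v * shift s v [::]) * b)).
  by rewrite -mulrBl; apply: dvwMr.
rewrite mulr_suml -sumrB; apply: dvw_sumseq => v; rewrite mem_words => vn.
rewrite -mulr_sumr -mulrBr -{1}(subnKC (ltnW vn)); apply: dvwM; last exact: hg.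
exact: dvwMr.
Qed.

Lemma eq_sev s f f' a : f =1 f' -> sev s f a -> sev s f' a.
Proof. by move=> ff h n; under eq_bigr => v _ do rewrite -ff; exact: h. Qed.

Lemma sevD s f g a b : sev s f a -> sev s g b -> sev s (fun v => f v + g v) (a + b).
Proof.
move=> h h' n; under eq_bigr => v _ do rewrite mulrDl.
by rewrite big_split /= opprD addrACA; apply: dvwD.
Qed.

Lemma sevN s f a : sev s f a -> sev s (fun v => - f v) (- a).
Proof.
move=> h n; under eq_bigr => v _ do rewrite mulNr.
by rewrite sumrN -opprD; apply: dvwN.
Qed.

Lemma sev_sum s (I : Type) (r : seq I) (f : I -> seq X -> B) (a : I -> B) :
  (forall i, sev s (f i) (a i)) ->
  sev s (fun v => \sum_(i <- r) f i v) (\sum_(i <- r) a i).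
Proof.
move=> h; elim: r => [|i r IH].
  move=> n; rewrite big_nil big1 ?subrr; first exact: dvw0.
  by move=> v _; rewrite big_nil mul0r.
rewrite big_cons; apply: eq_sev (sevD (h i) IH) => v.
by rewrite big_cons.
Qed.

End Shift.
End Limits.

(** A common divisor [w ^+ l j] of column [j] bounds its orders from below: the fraction with
    numerator [l j] and denominator 1 already occurs in the supremum defining [ord]. *)
Lemma nuclear_of_exponent (S : comNzRingType) (w : S) (E : set S) (I : countType)
    (a : I -> I -> S) (l : I -> nat) :
  (forall i j, E (a i j)) ->
  (forall i j, exists2 y, E y & a i j = w ^+ l j * y) ->
  (forall c, finite_set [set j | (l j < c)%N]%classic) -> nuclear w E a.
Proof.
move=> Ea div fin; split=> // C C0.
apply: sub_finite_set (fin (Num.truncn C).+1) => j /=; rewrite ltNge => /negP h.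
rewrite ltnNge; apply/negP => lj; apply: h.
apply: le_ereal_inf_tmp => _ [i _ <-].
apply: (@le_trans _ _ ((l j)%:R%:E)).
  rewrite lee_fin ltW //; apply: lt_le_trans (truncnS_gt C) _.
  by rewrite ler_nat.
apply: ereal_sup_ubound; exists (l j), 1%N; split=> //; last by rewrite divr1.
by have [y Ey ->] := div i j; exists y; rewrite ?expr1.
Qed.

(** * Convergent sums over index sets *)

Section HasSum.
Variables (B : comNzRingType) (w : B).

Lemma has_sum_seq (J : choiceType) (a : J -> B) s :
  (forall n, exists W : seq J, [/\ uniq W, forall j, j \notin W -> dvw w n (a j)
    & dvw w n (s - \sum_(j <- W) a j)]) -> has_sum w a s.
Proof.
move=> H n; have [W [uW aW sW]] := H n.
exists [fset j in W]%fset => F' /fsubsetP sub.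
rewrite (bigID (fun j => j \in W)) /= opprD addrA.
have -> : \sum_(j <- F' | j \in W) a j = \sum_(j <- W) a j.
  rewrite -big_filter; apply: perm_big; apply: uniq_perm => //.
    by rewrite filter_uniq // fset_uniq.
  move=> j; rewrite mem_filter; case jW: (j \in W) => //=.
  by apply: sub; rewrite !inE.
by apply: dvwB => //; apply: dvw_sum.
Qed.

Lemma has_sum_finsupp (J : choiceType) (a : J -> B) s (W : seq J) : uniq W ->
  (forall j, j \notin W -> a j = 0) -> s = \sum_(j <- W) a j -> has_sum w a s.
Proof.
move=> uW aW ->; apply: has_sum_seq => n; exists W; split=> //.
  by move=> j /aW ->; exact: dvw0.
by rewrite subrr; exact: dvw0.
Qed.

Lemma has_sum_fin (J : finType) (a : J -> B) : has_sum w a (\sum_j a j).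
Proof.
apply: (@has_sum_finsupp _ _ _ (enum J)); first exact: enum_uniq.
  by move=> j; rewrite mem_enum.
by rewrite big_enum.
Qed.

Lemma has_sum_exponent (J : choiceType) (a : J -> B) s (l : J -> nat) (W : nat -> seq J) :
  (forall n, uniq (W n)) -> (forall n j, (j \in W n) = (l j < n)%N) ->
  (forall j, dvw w (l j) (a j)) ->
  (forall n, dvw w n (s - \sum_(j <- W n) a j)) -> has_sum w a s.
Proof.
move=> uW mW aW sW; apply: has_sum_seq => n; exists (W n); split=> // j.
by rewrite mW -leqNgt => nl; exact: dvw_le (aW j).
Qed.

Lemma has_sum_reindex (J J' : choiceType) (f : J' -> J) (a : J -> B) s :
  bijective f -> has_sum w a s -> has_sum w (a \o f) s.
Proof.
move=> [g fK gK] H n; have [F hF] := H n.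
exists [fset g j | j in F]%fset => F' /fsubsetP sub.
have [|y hy] := hF [fset f j | j in F']%fset.
  apply/fsubsetP => j jF; apply/imfsetP; exists (g j); last by rewrite gK.
  by apply: sub; apply/imfsetP; exists j.
exists y; rewrite -hy big_imfset //= => i j _ _ /(congr1 g).
by rewrite !fK.
Qed.

Lemma is_mxprod_reindex (I J L I' J' L' : choiceType) (f : I' -> I) (g : J' -> J)
    (h : L' -> L) (P : I -> J -> B) (Q : J -> L -> B) T : bijective g ->
  is_mxprod w P Q T ->
  is_mxprod w (fun i j => P (f i) (g j)) (fun j l => Q (g j) (h l))
    (fun i l => T (f i) (h l)).
Proof. by move=> bg H i l; apply: (has_sum_reindex bg (H (f i) (h l))). Qed.

End HasSum.

(** * Relations between classes in Delta *)

Section Classes.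
Variables (B : comNzRingType) (w : B) (sg : {rmorphism B -> B}).
Local Notation nuc := (nuclear w [set: B]).

Lemma delta_relatorE x : delta_relator sg x -> \pi_(Delta w sg)%qT x = 0.
Proof.
move=> rx; have xI : x \in delta_relations sg by apply/asboolP => P cP; apply.
apply/eqP; rewrite -(raddf0 (\pi_(Delta w sg)%qT)) -Quotient.idealrBE.
by rewrite subr0.
Qed.

Definition cls (I : countType) (a : I -> I -> B) (aP : nuc a) : Delta w sg :=
  delta_class sg (nucmat_of aP).

Lemma cls_block (I I' I'' : countType) (a : I -> I -> B) a' a''
    (aP : nuc a) (aP' : nuc a') (aP'' : nuc a'') (f : I' + I'' -> I) : bijective f ->
  (forall i j, a (f (inl i)) (f (inr j)) = 0) ->
  (forall i j, a (f (inl i)) (f (inl j)) = a' i j) ->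
  (forall i j, a (f (inr i)) (f (inr j)) = a'' i j) ->
  cls aP = cls aP' + cls aP''.
Proof.
move=> [f' fK f'K] h0 h1 h2.
have [g gK g'K] := of_pickle_dom_bij I.
have [g1 g1K g1'K] := of_pickle_dom_bij I'.
have [g2 g2K g2'K] := of_pickle_dom_bij I''.
have bt : block_triangular (nucmat_of aP) (nucmat_of aP') (nucmat_of aP'').
  exists (fun x => g (f (match x with inl x => inl (of_pickle_dom x)
                        | inr x => inr (of_pickle_dom x) end))); split.
  - exists (fun y => match f' (of_pickle_dom y) with
      inl x => inl (g1 x) | inr x => inr (g2 x) end).
      by move=> [x|x]; rewrite g'K fK ?g1K ?g2K.
    move=> y; case E: (f' (of_pickle_dom y)) => [x|x]; rewrite ?g1'K ?g2'K -E f'K gK //.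
  - by move=> i j /=; rewrite !g'K h0.
  - by move=> i j /=; rewrite !g'K h1.
  - by move=> i j /=; rewrite !g'K h2.
have := delta_relatorE (DeltaBlock sg bt).
by rewrite !raddfB /= => /eqP; rewrite -addrA -opprD subr_eq0 => /eqP.
Qed.

(** An empty matrix is the block sum of two copies of itself, so its class is its own double. *)
Lemma cls_empty (I : countType) (a : I -> I -> B) (aP : nuc a) : (I -> False) -> cls aP = 0.
Proof.
move=> I0; have: cls aP = cls aP + cls aP.
  apply: (@cls_block _ _ _ _ _ _ _ _ _
    (fun x : I + I => match x with inl x => x | inr x => x end)).
  - by exists inl => [[]|] x; case: (I0 x).
  - by move=> x; case: (I0 x).
  - by move=> x; case: (I0 x).
  - by move=> x; case: (I0 x).
by move=> /eqP; rewrite -subr_eq0 opprD addNKr oppr_eq0 => /eqP.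
Qed.

Lemma nuclear_void (a : void -> void -> B) : nuc a.
Proof. exact: finite_nuclear. Qed.

(** A bijection of index sets is a block decomposition with empty second block. *)
Lemma cls_reindex (I J : countType) (a : I -> I -> B) (b : J -> J -> B)
    (aP : nuc a) (bP : nuc b) (f : J -> I) : bijective f ->
  (forall i j, a (f i) (f j) = b i j) -> cls aP = cls bP.
Proof.
move=> [g fK gK] h; pose z (x y : void) : B := 0.
pose F (x : J + void) : I := match x with inl x => f x
  | inr x => match x with end end.
rewrite -[RHS]addr0 -(@cls_empty void z (nuclear_void z)); last by case.
apply: (@cls_block _ _ _ _ _ _ _ _ _ F) => //; try by move=> ? [].
by exists (inl \o g) => [[x|[]]|x] /=; rewrite ?fK ?gK.
Qed.

Lemma cls_sim (I1 I2 : countType) (a1 : I1 -> I1 -> B) (a2 : I2 -> I2 -> B)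
    (aP1 : nuc a1) (aP2 : nuc a2) (S : I1 -> I2 -> B) (S' : I2 -> I1 -> B)
    (P : I2 -> I1 -> B) (Q : I1 -> I2 -> B) :
  is_mxprod w S S' (@mx_one B _) -> is_mxprod w S' S (@mx_one B _) ->
  is_mxprod w S' a1 P -> is_mxprod w P (fun i j => sg (S i j)) a2 ->
  is_mxprod w a1 (fun i j => sg (S i j)) Q -> is_mxprod w S' Q a2 ->
  cls aP1 = cls aP2.
Proof.
move=> SS S'S S'a Pa aS S'Q.
have b1 := of_pickle_dom_bij I1; have b2 := of_pickle_dom_bij I2.
pose o1 := @of_pickle_dom I1; pose o2 := @of_pickle_dom I2.
have sim : sigma_similar sg (nucmat_of aP1) (nucmat_of aP2).
  exists (fun i j => S (o1 i) (o2 j)), (fun i j => S' (o2 i) (o1 j)); split.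
  - have one i j : mx_one B i j = mx_one B (o1 i) (o1 j).
      by rewrite /mx_one (inj_eq (bij_inj b1)).
    move=> i j; rewrite one.
    exact: (@is_mxprod_reindex _ _ _ _ _ _ _ _ o1 o2 o1 _ _ _ b2 SS i j).
  - have one i j : mx_one B i j = mx_one B (o2 i) (o2 j).
      by rewrite /mx_one (inj_eq (bij_inj b2)).
    move=> i j; rewrite one.
    exact: (@is_mxprod_reindex _ _ _ _ _ _ _ _ o2 o1 o2 _ _ _ b1 S'S i j).
  - exists (fun i j => P (o2 i) (o1 j)); split.
      exact: (@is_mxprod_reindex _ _ _ _ _ _ _ _ o2 o1 o1 _ _ _ b1 S'a).
    exact: (@is_mxprod_reindex _ _ _ _ _ _ _ _ o2 o1 o2 _ _ _ b1 Pa).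
  - exists (fun i j => Q (o1 i) (o2 j)); split.
      exact: (@is_mxprod_reindex _ _ _ _ _ _ _ _ o1 o1 o2 _ _ _ b1 aS).
    exact: (@is_mxprod_reindex _ _ _ _ _ _ _ _ o2 o1 o2 _ _ _ b1 S'Q).
have := delta_relatorE (DeltaSimilar sim).
by rewrite raddfB /= => /eqP; rewrite subr_eq0 => /eqP.
Qed.

(* A swindle: the blocks [l >= m] of [a], for all [m], stack up to a nuclear matrix
   from which either the bottom or the top layer may be split off. *)
Lemma cls_graded (Z : countType) (l : Z -> nat) (a b : Z -> Z -> B) (aP : nuc a)
    (bP : nuc b) :
  (forall c, finite_set [set z | (l z < c)%N]%classic) ->
  (forall x y, dvw w (l y) (a x y)) ->
  (forall x y, (l y < l x)%N -> a x y = 0) ->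
  (forall x y, b x y = if l x == l y then a x y else 0) -> cls aP = cls bP.
Proof.
move=> fin div tri bE.
pose Z1 : countType := {z : Z & 'I_(l z).+1}.
pose Z0 : countType := {z : Z & 'I_(l z)}.
pose A1 (x y : Z1) := (tagged x == tagged y :> nat)%:R * a (tag x) (tag y).
pose A0 (x y : Z0) := (tagged x == tagged y :> nat)%:R * a (tag x) (tag y).
have nucA (k : Z -> nat) (A : {z : Z & 'I_(k z)} -> {z : Z & 'I_(k z)} -> B) :
    (forall x y, A x y = (tagged x == tagged y :> nat)%:R * a (tag x) (tag y)) -> nuc A.
  move=> AE; apply: (@nuclear_of_exponent _ _ _ _ _ (fun x => l (tag x))) => //.
    move=> x y; have [u hu] := div (tag x) (tag y).
    by exists ((tagged x == tagged y :> nat)%:R * u); rewrite // AE hu mulrCA.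
  move=> c; apply: (@sub_finite_set _ _ (\bigcup_(z in [set z | (l z < c)%N])
    (fun i => Tagged (fun z => 'I_(k z)) i) @` [set: 'I_(k z)])%classic).
    by move=> [z i] /= zc; exists z => //; exists i.
  by apply: bigcup_finite => // z _; apply: finite_image; exact: finite_finset.
have P1 : nuc A1 by apply: nucA.
have P0 : nuc A0 by apply: nucA.
(* [f1] splits off the top layer [l z] over each [z], and [f2] the layer 0, lowering the others by
   one. What remains is [A0] both times, while the split-off blocks are [b] and [a]. *)
pose f1 (x : Z0 + Z) : Z1 := match x with
  | inl x => existT (fun z => 'I_(l z).+1) (tag x) (widen_ord (leqnSn _) (tagged x))
  | inr z => existT (fun z => 'I_(l z).+1) z ord_max end.
pose f2 (x : Z0 + Z) : Z1 := match x with
  | inl x => existT (fun z => 'I_(l z).+1) (tag x) (fintype.lift ord0 (tagged x))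
  | inr z => existT (fun z => 'I_(l z).+1) z ord0 end.
have tagE (x y : Z1) : tag x = tag y -> tagged x = tagged y :> nat -> x = y.
  case: x y => [x i] [y j] /= e; subst y => /= /val_inj -> //.
have f1b : bijective f1.
  pose g (x : Z1) : Z0 + Z := match unliftP ord_max (tagged x) with
    | UnliftSome j _ => inl (existT (fun z => 'I_(l z)) (tag x) j)
    | UnliftNone _ => inr (tag x) end.
  exists g => [[[z i]|z]|x].
  - rewrite /g /=; case: unliftP => /= [j /(congr1 val) /=|/(congr1 val) /= e].
      by rewrite /bump leqNgt ltn_ord add0n => /val_inj ->.
    by have := ltn_ord i; rewrite e ltnn.
  - rewrite /g /=; case: unliftP => //= j /(congr1 val) /=.
    by rewrite /bump leqNgt ltn_ord add0n => e; have := ltn_ord j; rewrite -e ltnn.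
  - rewrite /g; case: unliftP => [j|] e; apply: tagE => //=; rewrite e //=.
    by rewrite /bump leqNgt ltn_ord add0n.
have f2b : bijective f2.
  pose g (x : Z1) : Z0 + Z := match unliftP ord0 (tagged x) with
    | UnliftSome j _ => inl (existT (fun z => 'I_(l z)) (tag x) j)
    | UnliftNone _ => inr (tag x) end.
  exists g => [[[z i]|z]|x].
  - rewrite /g /=; case: unliftP => /= [j /(congr1 val) /=|/(congr1 val) //].
    by move=> [] /val_inj ->.
  - by rewrite /g /=; case: unliftP.
  - by rewrite /g; case: unliftP => [j|] e; apply: tagE => //=; rewrite e.
have E1 : cls P1 = cls P0 + cls bP.
  apply: (@cls_block Z1 Z0 Z A1 A0 b P1 P0 bP f1 f1b) => [x z|x y|y z].
  (* A layer index of [x] remaining in [Z0] is below [l (tag x)]; if it equals [l z], then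
     [l z < l (tag x)] and triangularity applies. *)
  - rewrite /A1 /=; case: eqP => [e|]; last by rewrite mul0r.
    by rewrite tri ?mulr0 // -e ltn_ord.
  - by [].
  - by rewrite /A1 /= bE; case: eqP; rewrite ?mul1r ?mul0r.
have E2 : cls P1 = cls P0 + cls aP.
  apply: (@cls_block Z1 Z0 Z A1 A0 a P1 P0 aP f2 f2b) => [x z|x y|y z].
  - by rewrite /A1 /= mul0r.
  - by rewrite /A1 /A0 /= eqSS.
  - by rewrite /A1 /= mul1r.
by apply: (addrI (cls P0)); rewrite -E1 -E2.
Qed.

End Classes.

Arguments words : simpl never.

(** * The matrix of a substitution operator *)

Section SystemMatrix.
Variables (X : finType) (B : comNzRingType).
Implicit Types (F : X -> seq X -> B) (f h : seq X -> B).

(* The operator h (x) e_b |-> h(F) G_b on vectors of power series, in the basis of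
   words. *)
Definition system_mx (Y : finType) F (G : Y -> Y -> seq X -> B) (p q : seq X * Y) :=
  act F p.1 (G p.2 q.2) q.1.

(** A partial derivative up to the order of the letters: inserting [y] everywhere gives a series
    whose value at s is the coefficient of [y] in f(s + x). Only such values are used. *)
Definition deriv_series (y : X) f v :=
  \sum_(i < (size v).+1) f (take i v ++ y :: drop i v).

Definition tensor_deriv (Y : finType) F (G : Y -> Y -> seq X -> B) (p q : X * Y) :=
  smul (deriv_series q.1 (F p.1)) (G p.2 q.2).

Lemma act_short F I h v : (forall k, F k [::] = 0) -> (size v < size I)%N -> act F I h v = 0.
Proof.
move=> F0; elim: I v => //= k I IH v vI; apply: big1 => i _.
case: i => [[|i] /= iv]; first by rewrite take0 F0 mul0r.
rewrite IH ?mulr0 // size_drop; move: vI iv; clear; lia.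
Qed.

(** Factors without constant term consume at least one letter each; when the lengths agree, each
    consumes exactly one, and only linear parts survive. *)
Lemma act_diag F I h v : (forall k, F k [::] = 0) -> size v = size I ->
  act F I h v = (\prod_(p <- zip I v) F p.1 [:: p.2]) * h [::].
Proof.
move=> F0; elim: I v => [|k I IH] [|x v] //=; first by rewrite big_nil mul1r.
move=> [vI]; rewrite /smul 2!big_ord_recl /= F0 mul0r add0r take0 drop0.
rewrite big1 => [|i _].
  by rewrite addr0 IH // big_cons /= mulrA.
rewrite act_short ?mulr0 // size_drop /bump /=.
have iv : (i < size v)%N := ltn_ord i.
by move: iv vI; clear; lia.
Qed.

End SystemMatrix.

(** * Translation to the fixed point *)

Section FixedPoint.
Variables (B : comNzRingType) (w : B) (sg : {rmorphism B -> B}).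
Hypotheses (sep : sepw w) (cmp : complw w).
Variable X : finType.
Local Notation nuc := (nuclear w [set: B]).

Lemma finite_short_words (Y : finType) c :
  finite_set [set p : seq X * Y | (size p.1 < c)%N]%classic.
Proof.
apply: (@sub_finite_set _ _ [set` [seq (v, y) | v <- words X c, y <- enum Y]]%classic).
  move=> [v y] /= vc; apply/allpairsP; exists (v, y).
  by rewrite mem_words mem_enum.
exact: finite_seq.
Qed.

Lemma nuclear_words (Y : finType) (a : seq X * Y -> seq X * Y -> B) :
  (forall p q, dvw w (size q.1) (a p q)) -> nuc a.
Proof.
move=> h; apply: (@nuclear_of_exponent _ _ _ _ _ (fun q => size q.1)) => //.
  by move=> p q; have [y hy] := h p q; exists y.
exact: finite_short_words.
Qed.

Lemma system_dvw (Y : finType) (F : X -> seq X -> B) (G : Y -> Y -> seq X -> B) :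
  (forall k, cvs w (F k)) -> (forall a b, cvs w (G a b)) ->
  forall p q, dvw w (size q.1) (system_mx F G p q).
Proof. by move=> cF cG p q; apply: cvs_act. Qed.

Lemma cvs_deriv (f : seq X -> B) y : cvs w f -> cvs w (deriv_series y f).
Proof.
move=> cf v; apply: dvw_sum => i _; apply: dvw_le (cf _).
by rewrite size_cat /= addnS -size_cat cat_take_drop.
Qed.

(** The coefficient of [y] in a translated word is a sum over the position at which [y] is taken
    instead of the constant. Inserting [y] adds a letter, whence [n] on one side and [n.+1] on the
    other. *)
Lemma sev_deriv s (f g : seq X -> B) y : slim w s f g -> sev w s (deriv_series y f) (g [:: y]).
Proof.
move=> h n.
have -> : \sum_(v <- words X n) deriv_series y f v * shift s v [::] =
    \sum_(v <- words X n.+1) f v * shift s v [:: y].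
  transitivity (\sum_(v <- words X n) \sum_(v' <- words X (n - size v))
      f (v ++ y :: v') * (shift s v [::] * shift s v' [::])).
    rewrite -(sum_words_split n (fun v v' =>
      f (v ++ y :: v') * (shift s v [::] * shift s v' [::]))).
    apply: eq_bigr => v _; rewrite mulr_suml; apply: eq_bigr => i _; congr (_ * _).
    by rewrite -[X in shift s X [::]](cat_take_drop i v) shift_cat big_ord1.
  clear; elim: n f => [|n IH] f; first by rewrite sum_words /= big_nil mulr0 add0r big1 // => x _; rewrite big_nil.
  rewrite [RHS]sum_words [LHS]sum_words /= mulr0 add0r subn0.
  under [RHS]eq_bigr => x _.
    under eq_bigr => v _ do rewrite mulrDr mulrCA.
    rewrite big_split /= -mulr_sumr -(IH (fun v => f (x :: v))); over.
  rewrite big_split /= addrC; congr (_ + _).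
    apply: eq_bigr => x _; rewrite mulr_sumr; apply: eq_bigr => v _.
    rewrite subSS mulr_sumr; apply: eq_bigr => v' _.
    by rewrite addr0 -!mulrA mulrCA.
  rewrite (bigD1 y) //= [X in _ + X]big1 => [|x /negPf xy].
    by rewrite addr0; apply: eq_bigr => v _; rewrite eqxx !mul1r.
  by apply: big1 => v _; rewrite xy mul0r mulr0.
exact: dvw_le (h _ _).
Qed.

Variables (F : X -> seq X -> B) (s0 : X -> B).
Hypothesis cF : forall k, cvs w (F k).

Section Translate.
Variables (Y : finType) (G : Y -> Y -> seq X -> B) (F1 : X -> seq X -> B)
  (G1 : Y -> Y -> seq X -> B).
Hypothesis cG : forall a b, cvs w (G a b).
Hypothesis sF : forall k, slim w (sg \o s0) (F k) (F1 k).
Hypothesis sG : forall a b, slim w (sg \o s0) (G a b) (G1 a b).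

(** The system in coordinates centred at [s0]: arguments move by [sg \o s0] but values by [s0], as
    befits a semilinear operator. *)
Definition centered k v := F1 k v - s0 k * (v == [::])%:R.

Lemma cvs_centered k : cvs w (centered k).
Proof.
move=> v; apply: dvwB; first exact: (slim_cvs (sF k) (cF k)).
by case: v => [|x v]; [exact: dvwn0|rewrite mulr0; exact: dvw0].
Qed.

(** Multiply out the factors [F1 k = s0 k + centered k]; the word [t] records the factors from which
    the centred part was taken. *)
Lemma act_translate I h v n : (size I < n)%N ->
  act F1 I h v = \sum_(t <- words X n) shift s0 I t * act centered t h v.
Proof.
elim: I v n => [|k I IH] v [//|n] In.
  rewrite sum_words /= mul1r big1 ?addr0 // => x _.
  by apply: big1 => t _; rewrite mul0r.
transitivity (s0 k * act F1 I h v + smul (centered k) (act F1 I h) v).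
  rewrite -smul_const -smulDl; apply: eq_smul => // u.
  by rewrite /centered addrC subrK.
rewrite (IH v n.+1 (ltnW In)) mulr_sumr sum_words /=.
rewrite (_ : smul _ _ v =
    \sum_(t <- words X n) shift s0 I t * smul (centered k) (act centered t h) v); last first.
  rewrite /smul; under eq_bigr => i _ do rewrite (IH _ n) // mulr_sumr.
  rewrite exchange_big /=; apply: eq_bigr => t _; rewrite mulr_sumr.
  by apply: eq_bigr => i _; rewrite mulrCA.
rewrite [RHS](sum_words n) /= addr0 -addrA mulrA; congr (_ + _).
under [in RHS]eq_bigr => x _.
  under eq_bigr => t _ do rewrite mulrDl.
  rewrite big_split /=; over.
rewrite big_split /=; congr (_ + _).
  by apply: eq_bigr => x _; apply: eq_bigr => t _; rewrite mulrA.
rewrite [RHS](bigD1 k) //= [X in _ = _ + X]big1 => [|x /negPf xk].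
  by rewrite addr0; apply: eq_bigr => t _; rewrite eqxx mul1r.
by apply: big1 => t _; rewrite eq_sym xk !mul0r.
Qed.

(** The matrix of a translation of the letters. Its rows are finite, so products with it on the left
    are finite sums; on the right, convergence comes from the divisibility of the columns of the
    other factor. *)
Definition word_mx (s : X -> B) (p q : seq X * Y) :=
  shift s p.1 q.1 * (p.2 == q.2)%:R.

Lemma sum_pairs_delta n (b : Y) (f : seq X * Y -> B) :
  (forall v c, c != b -> f (v, c) = 0) ->
  \sum_(p <- [seq (v, c) | v <- words X n, c <- enum Y]) f p =
  \sum_(v <- words X n) f (v, b).
Proof.
move=> f0; rewrite big_allpairs_dep /=; apply: eq_bigr => v _.
rewrite big_enum /= (bigD1 b) //= big1 ?addr0 // => c cb; exact: f0.
Qed.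

Lemma uniq_pairs n : uniq [seq (v, c) | v <- words X n, c <- enum Y].
Proof.
by apply: allpairs_uniq; rewrite ?words_uniq ?enum_uniq // => -[a b] [c d] _ _ /= [-> ->].
Qed.

Lemma mem_pairs n p :
  (p \in [seq (v, c) | v <- words X n, c <- enum Y]) = (size p.1 < n)%N.
Proof.
case: p => v c; apply/allpairsP/idP => /= [[[u d] /= [uw _ [-> _]]]|vn].
  by rewrite -mem_words.
by exists (v, c); rewrite mem_words mem_enum.
Qed.

Lemma word_mx_prod_l s (b : seq X * Y -> seq X * Y -> B) n (c : seq X * Y -> seq X * Y -> B) :
  (forall p q, (size p.1 < n p)%N /\
     c p q = \sum_(t <- words X (n p)) shift s p.1 t * b (t, p.2) q) ->
  is_mxprod w (word_mx s) b c.
Proof.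
move=> H p q; have [pn ->] := H p q.
apply: (@has_sum_finsupp _ _ _ _ _ [seq (v, c) | v <- words X (n p), c <- enum Y]) => [|r|].
- exact: uniq_pairs.
- rewrite mem_pairs -leqNgt => nr; rewrite /word_mx shift_gt ?mul0r //.
  exact: leq_trans nr.
- rewrite (sum_pairs_delta _ (b := p.2)) => [|v e /negPf ep].
    by apply: eq_bigr => v _; rewrite /word_mx /= eqxx mulr1.
  by rewrite /word_mx /= eq_sym ep mulr0 mul0r.
Qed.

Lemma word_mx_prod_r s (b c : seq X * Y -> seq X * Y -> B) :
  (forall p q, dvw w (size q.1) (b p q)) ->
  (forall p q n, dvw w n (c p q - \sum_(t <- words X n) b p (t, q.2) * shift s t q.1)) ->
  is_mxprod w b (word_mx s) c.
Proof.
move=> div H p q.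
apply: (@has_sum_exponent _ _ _ _ _ (fun r => size r.1)
  (fun n => [seq (v, c) | v <- words X n, c <- enum Y])).
- exact: uniq_pairs.
- by move=> n r; rewrite mem_pairs.
- by move=> r; apply: dvwMr.
- move=> n; rewrite (sum_pairs_delta _ (b := q.2)) => [|v e /negPf eq].
    under eq_bigr => v _ do rewrite /word_mx /= eqxx mulr1.
    exact: H.
  by rewrite /word_mx /= eq mulr0 mulr0.
Qed.

Lemma word_mx_inv s : is_mxprod w (word_mx s) (word_mx (fun x => - s x)) (@mx_one B _).
Proof.
apply: (word_mx_prod_l (n := fun p => (size p.1).+1)) => p q; split=> //.
under eq_bigr => t _ do rewrite /word_mx /= mulrA.
rewrite -mulr_suml shift_comp // (_ : (fun x => s x + - s x) = fun=> 0); last first.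
  by apply/funext => x; rewrite subrr.
by rewrite shift0 /mx_one -natrM mulnb; case: p q => [? ?] [? ?].
Qed.

Lemma cls_translate (CP : nuc (system_mx F G)) (DP : nuc (system_mx centered G1)) :
  cls sg CP = cls sg DP.
Proof.
have lact I b a : slim w (sg \o s0) (act F I (G b a)) (act F1 I (G1 b a)).
  exact: slim_act.
have Ssg : (fun p q : seq X * Y => sg (word_mx s0 p q)) = word_mx (sg \o s0).
  apply/funext => p; apply/funext => q.
  by rewrite /word_mx rmorphM rmorph_nat shift_rmorph.
(* [Q] is the matrix multiplied by the twisted translation on the right, [P] the matrix multiplied
   by the inverse translation on the left. The system is translated by combining the two. *)
pose Q p q := act F1 p.1 (G1 p.2 q.2) q.1.
pose P (p q : seq X * Y) := \sum_(t <- words X (size p.1).+1)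
  shift (fun x => - s0 x) p.1 t * system_mx F G (t, p.2) q.
have S'Q p q : system_mx centered G1 p q = \sum_(t <- words X (size p.1).+1)
    shift (fun x => - s0 x) p.1 t * Q (t, p.2) q.
  transitivity (\sum_(t <- words X (size p.1).+1)
    \sum_(u <- words X (size p.1).+1) shift (fun x => - s0 x) p.1 t *
      (shift s0 t u * act centered u (G1 p.2 q.2) q.1)).
    rewrite exchange_big /=.
    under eq_bigr => u _.
      under eq_bigr => t _ do rewrite mulrA.
      rewrite -mulr_suml shift_comp //.
      rewrite (_ : (fun x => - s0 x + s0 x) = fun=> 0); last first.
        by apply/funext => x; rewrite addNr.
      rewrite shift0; over.
    rewrite (bigD1_seq p.1) ?words_uniq ?mem_words //= eqxx mul1r big1 ?addr0 //.
    by move=> u /negPf up; rewrite eq_sym up mul0r.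
  apply: eq_big_seq => t; rewrite mem_words => tp.
  by rewrite /Q (@act_translate _ _ _ (size p.1).+1) // mulr_sumr.
apply: (@cls_sim _ _ _ _ _ _ _ _ _ (word_mx s0) (word_mx (fun x => - s0 x)) P Q).
- exact: word_mx_inv.
- have := word_mx_inv (fun x => - s0 x).
  by rewrite (_ : (fun x => - - s0 x) = s0) //; apply/funext => x; rewrite opprK.
- by apply: (word_mx_prod_l (n := fun p => (size p.1).+1)) => p q; split.
- rewrite Ssg; apply: word_mx_prod_r => [p q|p q n].
    by apply: dvw_sum => t _; apply: dvwMl; apply: system_dvw.
  rewrite S'Q /P; under [X in _ - X]eq_bigr => t _ do rewrite mulr_suml.
  rewrite exchange_big /= -sumrB; apply: dvw_sum => t _.
  under eq_bigr => u _ do rewrite -mulrA.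
  rewrite -mulr_sumr -mulrBr; apply: dvwMl; exact: lact.
- rewrite Ssg; apply: word_mx_prod_r => [p q|p q n]; first exact: system_dvw.
  exact: lact.
- by apply: (word_mx_prod_l (n := fun p => (size p.1).+1)) => p q; split.
Qed.

End Translate.

Hypothesis fixF : forall k, sev w (sg \o s0) (F k) (s0 k).

(* The right-hand side consists of the operator on functions and the operator on
   differentials: their common translation to the fixed point [s0] is triangular for
   the word length, and all the graded pieces but the one of the empty word cancel. *)
Theorem cls_fixed_point (Y : finType) (G : Y -> Y -> seq X -> B) (rho : Y -> Y -> B)
    (rhoP : nuc rho) (CP : nuc (system_mx F G))
    (CP' : nuc (system_mx F (tensor_deriv F G))) :
  (forall a b, cvs w (G a b)) ->
  (forall a b, sev w (sg \o s0) (G a b) (rho a b)) ->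
  cls sg rhoP = cls sg CP - cls sg CP'.
Proof.
move=> cG eG.
have [F1 sF] := choice (fun k => slim_exists (sg \o s0) cmp (cF k)).
have /choice[G1' sG'] : forall ab : Y * Y, exists g, slim w (sg \o s0) (G ab.1 ab.2) g.
  by move=> ab; apply: slim_exists.
pose G1 a b := G1' (a, b).
have sG a b : slim w (sg \o s0) (G a b) (G1 a b) by exact: (sG' (a, b)).
have G10 a b : G1 a b [::] = rho a b.
  exact: sev_uniq sep (slim_sev (sG a b)) (eG a b).
pose Z := centered F1.
(* The fixed point equation is used here: it kills the constant term of the centred system, which
   makes the matrix triangular. *)
have Z0 k : Z k [::] = 0.
  by rewrite /Z /centered (sev_uniq sep (slim_sev (sF k)) (fixF k)) mulr1 subrr.
have cH x y : cvs w (deriv_series y (F x)) by apply: cvs_deriv.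
have cT a b : cvs w (tensor_deriv F G a b) by apply: cvs_mul.
have /choice[H1 sH] : forall xy : X * X, exists g,
    slim w (sg \o s0) (deriv_series xy.2 (F xy.1)) g.
  by move=> xy; apply: slim_exists.
pose T1 (a b : X * Y) := smul (H1 (a.1, b.1)) (G1 a.2 b.2).
have sT a b : slim w (sg \o s0) (tensor_deriv F G a b) (T1 a b).
  by apply: slim_mul => //; apply: (sH (a.1, b.1)).
have T10 a b : T1 a b [::] = Z a.1 [:: b.1] * rho a.2 b.2.
  rewrite /T1 smul_nil G10; congr (_ * _); rewrite /Z /centered mulr0 subr0.
  exact: sev_uniq sep (slim_sev (sH (a.1, b.1))) (sev_deriv _ (sF _)).
have cZ k : cvs w (Z k) by apply: cvs_centered.
pose gr (Y' : finType) (K : Y' -> Y' -> seq X -> B) (p q : seq X * Y') :=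
  if size p.1 == size q.1 then system_mx Z K p q else 0.
have red (Y' : finType) (K K1 : Y' -> Y' -> seq X -> B) (KP : nuc (system_mx F K))
    (grP : nuc (gr Y' K1)) : (forall a b, cvs w (K a b)) ->
    (forall a b, slim w (sg \o s0) (K a b) (K1 a b)) -> cls sg KP = cls sg grP.
  move=> cK sK.
  have cK1 a b : cvs w (K1 a b) by apply: slim_cvs (sK a b) (cK a b).
  have DP : nuc (system_mx Z K1) by apply: nuclear_words; apply: system_dvw.
  rewrite (cls_translate cK sF sK KP DP).
  apply: (@cls_graded _ _ _ _ (fun p => size p.1)) => //.
  - exact: finite_short_words.
  - exact: system_dvw.
  - by move=> p q qp; apply: act_short.
have grN (Y' : finType) (K : Y' -> Y' -> seq X -> B) : (forall a b, cvs w (K a b)) ->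
    nuc (gr Y' K).
  move=> cK; apply: nuclear_words => p q; rewrite /gr; case: eqP => _; last exact: dvw0.
  exact: system_dvw.
have gP : nuc (gr Y G1) by apply: grN => a b; apply: slim_cvs (sG a b) (cG a b).
have gP' : nuc (gr _ T1) by apply: grN => a b; apply: slim_cvs (sT a b) (cT a b).
rewrite (red _ _ _ CP gP cG sG) (red _ _ _ CP' gP' cT sT).
apply/eqP; rewrite eq_sym subr_eq addrC; apply/eqP.
(* A non-empty word hands its first letter to the auxiliary index. This identifies the piece of
   length l + 1 for [G1] with the piece of length l for [T1]; the empty word leaves [rho]. *)
pose f (t : seq X * (X * Y) + Y) : seq X * Y := match t with
  | inl p => (p.2.1 :: p.1, p.2.2) | inr y => ([::], y) end.
apply: (@cls_block _ _ _ _ _ _ _ _ _ _ _ _ f).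
- exists (fun p : seq X * Y => if p.1 is x :: v then inl (v, (x, p.2)) else inr p.2).
    by move=> [[v [x y]]|y].
  by move=> [[|x v] y].
- by move=> [v [x y]] z; rewrite /gr.
- move=> [v [x y]] [u [z t]]; rewrite /gr /= eqSS; case: eqP => // vu.
  rewrite /system_mx !act_diag //= ?vu // T10 G10 big_cons /= mulrA.
  by rewrite [_ * Z x _]mulrC.
- by move=> y z; rewrite /gr /system_mx /= G10.
Qed.

End FixedPoint.

(** * Uniform degree bounds for overconvergent series *)

Section DaggerFiltration.
Variables (n : nat) (R : idomainType) (pi : R).
Local Notation T := (dagger n pi).
Local Notation S := (mpseries n R).
Implicit Types (p q : {mpoly R[n]}) (x y : T).

(* For fixed c, filtration degrees L and m add up in products; so products of arbitrarily
   many factors with m = 0 stay in a common [m, c]. *)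
Definition dfil (c L m : nat) x :=
  exists p : nat -> {mpoly R[n]}, dagger_expansion pi m c p (dagger_val x) /\
    forall j, (j < L)%N -> p j = 0.

(** A constant loss per factor would accumulate over products of arbitrarily many factors; over a
    domain degrees add exactly. *)
Lemma msizeM_bound a b p q : (msize p <= a.+1)%N -> (msize q <= b.+1)%N ->
  (msize (p * q) <= (a + b).+1)%N.
Proof.
have [->|p0] := eqVneq p 0; first by rewrite mul0r msize0.
have [->|q0] := eqVneq q 0; first by rewrite mulr0 msize0.
by rewrite msizeM //; lia.
Qed.

Lemma dfil_le c c' L L' m m' x : (c <= c')%N -> (L' <= L)%N -> (m <= m')%N ->
  dfil c L m x -> dfil c' L' m' x.
Proof.
move=> cc LL mm [p [Ep p0]]; exists p; split.
  exact: dagger_expansion_widen Ep.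
by move=> j jL; apply: p0; exact: leq_trans jL LL.
Qed.

Lemma dfil0 c L m : dfil c L m 0.
Proof.
exists (fun=> 0); split=> //; split=> [j|N]; first by rewrite msize0.
exists 0; rewrite big1 ?scaler0 ?addr0 // => i _.
by rewrite mps_of_mpoly0 scaler0.
Qed.

Lemma dfil1 c m : dfil c 0 m 1.
Proof.
exists (fun j => if j == 0%N then 1 else 0); split=> //; split=> [[|j]|[|N]] /=.
- by rewrite msize1.
- by rewrite msize0.
- by exists 1; rewrite big_ord0 add0r expr0 scale1r.
- exists 0; rewrite big_ord_recl /= expr0 scale1r scaler0 addr0 big1 ?addr0.
    by rewrite mps_of_mpoly1.
  by move=> i _; rewrite mps_of_mpoly0 scaler0.
Qed.

Lemma dfilD c L m x y : dfil c L m x -> dfil c L m y -> dfil c L m (x + y).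
Proof.
move=> [p [[zp Ep] p0]] [q [[zq Eq] q0]]; exists (fun j => p j + q j).
split=> [|j jL]; last by rewrite p0 ?q0 ?addr0.
split=> [j|N].
  by apply: leq_trans (msizeD_le _ _) _; rewrite geq_max zp zq.
have [h1 e1] := Ep N; have [h2 e2] := Eq N; exists (h1 + h2).
rewrite (_ : dagger_val (x + y) = dagger_val x + dagger_val y) // e1 e2.
rewrite scalerDr addrACA -big_split /=; congr (_ + _).
by apply: eq_bigr => j _; rewrite mps_of_mpolyD scalerDr.
Qed.

Lemma dfilN c L m x : dfil c L m x -> dfil c L m (- x).
Proof.
move=> [p [[zp Ep] p0]]; exists (fun j => - p j).
split=> [|j jL]; last by rewrite p0 ?oppr0.
split=> [j|N]; first by rewrite msizeN.
have [h1 e1] := Ep N; exists (- h1).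
rewrite (_ : dagger_val (- x) = - dagger_val x) // e1.
rewrite opprD -sumrN scalerN; congr (_ - _); apply: eq_bigr => j _.
rewrite -scalerN; congr (_ *: _); apply/funext => t.
by rewrite /mps_of_mpoly mcoeffN.
Qed.

Lemma dfil_sum c L m (I : Type) (r : seq I) (P : pred I) (F : I -> T) :
  (forall i, P i -> dfil c L m (F i)) -> dfil c L m (\sum_(i <- r | P i) F i).
Proof. by move=> H; elim/big_ind: _ => //; [exact: dfil0|exact: dfilD]. Qed.

Lemma expansion_sum_mpoly (s : nat -> {mpoly R[n]}) N :
  \sum_(j < N) pi ^+ j *: mps_of_mpoly (s j) =
  mps_of_mpoly (\sum_(j < N) pi ^+ j *: s j).
Proof. by rewrite mps_of_mpoly_sum; apply: eq_bigr => j _; rewrite mps_of_mpolyZ. Qed.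

Lemma expansion_mul (p q : nat -> {mpoly R[n]}) (f g : S) N :
  (exists h : S, f = \sum_(j < N) pi ^+ j *: mps_of_mpoly (p j) + pi ^+ N *: h) ->
  (exists h : S, g = \sum_(j < N) pi ^+ j *: mps_of_mpoly (q j) + pi ^+ N *: h) ->
  exists h : S, f * g = \sum_(l < N) pi ^+ l *:
    mps_of_mpoly (\sum_(i < l.+1) p i * q (l - i)%N) + pi ^+ N *: h.
Proof.
move=> [h1 ->] [h2 ->]; have [h hE] := sum_conv_trunc pi p q N.
rewrite !expansion_sum_mpoly.
rewrite (expansion_sum_mpoly (fun l => \sum_(i < l.+1) p i * q (l - i)%N)).
set s := mps_of_mpoly (\sum_(j < N) _); set t := mps_of_mpoly (\sum_(j < N) _).
have stE : s * t = mps_of_mpoly (\sum_(l < N) pi ^+ l *: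
    (\sum_(i < l.+1) p i * q (l - i)%N)) + pi ^+ N *: mps_of_mpoly h.
  by rewrite -mps_of_mpolyM hE mps_of_mpolyD mps_of_mpolyZ.
exists (mps_of_mpoly h + s * h2 + h1 * t + pi ^+ N *: (h1 * h2)).
by rewrite mulrDl !mulrDr stE -!scalerAl -!scalerAr !scalerDr !addrA.
Qed.

Lemma dfilM c L L' m m' x y : dfil c L m x -> dfil c L' m' y ->
  dfil c (L + L') (m + m') (x * y).
Proof.
move=> [p [[zp Ep] p0]] [q [[zq Eq] q0]].
exists (fun l => \sum_(i < l.+1) p i * q (l - i)%N); split; last first.
  move=> j jL; apply: big1 => i _; have := ltn_ord i.
  have [iL _|Li ij] := ltnP i L; first by rewrite p0 ?mul0r.
  by rewrite q0 ?mulr0 //; lia.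
split=> [l|N]; last exact: expansion_mul (Ep N) (Eq N).
apply: leq_trans (msize_sum _ _ _) _; apply/bigmax_leqP => i _.
have il : (i <= l)%N by rewrite -ltnS.
apply: leq_trans (msizeM_bound (zp i) (zq (l - i)%N)) _.
by rewrite addnACA -mulnDr subnKC.
Qed.

Lemma dfil_exists x : exists c m, dfil c 0 m x.
Proof. by have /asboolP[m [c [_ _ [p Ep]]]] := dagger_valP x; exists c, m, p. Qed.

(** Multiplication by [pi] moves [p j] to the index [j.+1], where the slope [m + c] pays for the
    offset [m]. Offset 0 is what allows products of any length. *)
Lemma dfil_pi c m x : dfil c 0 m x -> dfil (m + c) 1 0 (pi *: x).
Proof.
move=> [p [[zp Ep] _]]; exists (fun j => if j is j'.+1 then p j' else 0).
split; last by case.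
split=> [[|j]|N]; [by rewrite msize0| |].
  by apply: leq_trans (zp j) _; rewrite ltnS add0n mulnDl mulnS; nia.
have vE : dagger_val (pi *: x) = pi *: dagger_val x by [].
case: N => [|N]; first by exists (pi *: dagger_val x); rewrite big_ord0 add0r expr0 scale1r.
have [h hE] := Ep N; exists h; rewrite vE {1}hE big_ord_recl /= mps_of_mpoly0 scaler0 add0r.
rewrite scalerDr scaler_sumr scalerA -exprS; congr (_ + _).
by apply: eq_bigr => j _; rewrite scalerA -exprS.
Qed.

(** Only finitely many series enter the coefficients of the system, so maxima give bounds valid for
    all of them. *)
Lemma dfil_family (I : finType) (f : I -> T) : exists c m, forall i,
  dfil c 0 m (f i) /\ dfil c 1 0 (pi *: f i).
Proof.
have /choice[c0 H] : forall i, exists cm : nat * nat, dfil cm.1 0 cm.2 (f i).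
  by move=> i; have [c [m h]] := dfil_exists (f i); exists (c, m).
pose c := \max_i ((c0 i).2 + (c0 i).1); pose m := \max_i (c0 i).2.
exists c, m => i; have lec : ((c0 i).2 + (c0 i).1 <= c)%N.
  exact: (leq_bigmax_cond (F := fun i => ((c0 i).2 + (c0 i).1)%N)).
have lem : ((c0 i).2 <= m)%N by exact: (leq_bigmax_cond (F := fun i => (c0 i).2)).
split; last exact: (@dfil_le ((c0 i).2 + (c0 i).1) _ 1 _ 0) lec _ _ (dfil_pi (H i)).
by apply: dfil_le (H i) => //; lia.
Qed.

(** Division by [pi ^+ k] moves the index [j + k] back to [j], so the quotient inherits at [j] the
    degree bound of [j + k]. *)
Lemma dfil_factor c L m x k : pi != 0 -> (k <= L)%N -> dfil c L m x ->
  exists (y : S) (q : nat -> {mpoly R[n]}), [/\ dagger_val x = pi ^+ k *: y,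
    forall j, (msize (q j) <= (m + c * (j + k)).+1)%N,
    forall j, (j < L - k)%N -> q j = 0
  & forall N, exists h : S, y = \sum_(j < N) pi ^+ j *: mps_of_mpoly (q j) + pi ^+ N *: h].
Proof.
move=> pi0 kL [p [[zp Ep] p0]].
have pi_inj (u v : S) : pi ^+ k *: u = pi ^+ k *: v -> u = v.
  move=> e; apply/funext => t; have /(congr1 (fun f : S => f t)) := e.
  by apply: mulfI; rewrite expf_neq0.
have [y yE] := Ep k.
have xE : dagger_val x = pi ^+ k *: y.
  rewrite yE big1 ?add0r // => t _; rewrite p0 ?mps_of_mpoly0 ?scaler0 //.
  exact: leq_trans (ltn_ord t) kL.
exists y, (fun t => p (t + k)%N); split=> // [j jL|N]; first by apply: p0; lia.
have [h hE] := Ep (k + N)%N; exists h; apply: pi_inj.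
rewrite scalerDr scalerA -exprD scaler_sumr -xE hE big_split_ord /= big1 ?add0r => [|t _].
  by congr (_ + _); apply: eq_bigr => t _; rewrite scalerA -exprD addnC.
rewrite p0 ?mps_of_mpoly0 ?scaler0 //.
exact: leq_trans (ltn_ord t) kL.
Qed.

Lemma dfil_div c L m x : pi != 0 -> dfil c L m x -> exists y : T, x = pi ^+ L *: y.
Proof.
move=> pi0 xF; have [y [q [xE zq _ qE]]] := dfil_factor pi0 (leqnn L) xF.
have yD : y \in in_dagger pi.
  apply/asboolP; exists (m + c * L).+1, c.+1; split=> //; exists q; split=> // j.
  by apply: leq_trans (zq j) _; rewrite ltnS; nia.
by exists (Dagger yD); apply: val_inj.
Qed.

(** Taking the whole of [pi ^+ l j] out of column [j] would leave degree bounds that depend on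
    [l j]. With half the exponent, k, the quotient has no terms at indices t below [l j - k], which
    is at least k; hence c (t + k) is at most 2 c t, uniformly in [j]. *)
Lemma dfil_nuclear (I : countType) (b : I -> I -> T) c m (l : I -> nat) :
  pi != 0 -> (forall i j, dfil c (l j) m (b i j)) ->
  (forall k, finite_set [set j | (l j < k)%N]%classic) ->
  nuclear (pi%:A : S) (mc_set pi m.+1 (c + c).+1) (fun i j => dagger_val (b i j)).
Proof.
move=> pi0 bF fin; apply: (@nuclear_of_exponent _ _ _ _ _ (fun j => (l j)./2)).
- move=> i j; have [p [Ep _]] := bF i j; exists p.
  by apply: dagger_expansion_widen Ep; lia.
- move=> i j; set k := (l j)./2.
  have kl : (k + k <= l j)%N.
    by rewrite addnn -[X in (_ <= X)%N](odd_double_half (l j)) leq_addl.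
  have [|y [q [xE zq q0 qE]]] := dfil_factor (k := k) pi0 _ (bF i j).
    exact: leq_trans (leq_addr _ _) kl.
  exists y; last first.
    by rewrite xE -[RHS]/((pi%:A) ^+ k * y) -(rmorphXn (in_alg S)) /= mulr_algl.
  exists q; split=> // t; have [tl|lt] := ltnP t (l j - k); first by rewrite q0 // msize0.
  by apply: leq_trans (zq _) _; rewrite ltnS; nia.
- move=> k; apply: sub_finite_set (fin (k + k)%N) => j /=.
  by move=> h; rewrite -(odd_double_half (l j)); move: h; case: odd => /=; lia.
Qed.

Lemma dfil_smul (X : finType) c m (f g : seq X -> T) :
  (forall v, dfil c (size v) 0 (f v)) -> (forall v, dfil c (size v) m (g v)) ->
  forall v, dfil c (size v) m (smul f g v).
Proof.
move=> hf hg v; apply: dfil_sum => i _.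
have := dfilM (hf (take i v)) (hg (drop i v)).
by rewrite -size_cat cat_take_drop.
Qed.

Lemma dfil_system (X Y : finType) c m (F : X -> seq X -> T) (G : Y -> Y -> seq X -> T) :
  (forall k v, dfil c (size v) 0 (F k v)) ->
  (forall a b v, dfil c (size v) m (G a b v)) ->
  forall (t u : seq X * Y), dfil c (size u.1) m (system_mx F G t u).
Proof.
move=> hF hG [I b] [J a]; rewrite /system_mx /=.
by elim: I J => [|k I IH] J //=; apply: dfil_smul.
Qed.

Lemma dfil_tensor_deriv (X Y : finType) c m (F : X -> seq X -> T)
    (G : Y -> Y -> seq X -> T) : (forall k v, dfil c (size v) 0 (F k v)) ->
  (forall a b v, dfil c (size v) m (G a b v)) ->
  forall a b v, dfil c (size v) m (tensor_deriv F G a b v).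
Proof.
move=> hF hG [x a] [y b]; apply: dfil_smul => // v; apply: dfil_sum => i _.
apply: dfil_le (hF _ _) => //.
by rewrite size_cat /= addnS -size_cat cat_take_drop.
Qed.

End DaggerFiltration.

(** * Units congruent to 1 in the overconvergent algebra *)

Section DaggerUnits.
Variables (n : nat) (R : idomainType) (pi : R) (k : finFieldType)
  (res : {rmorphism R -> k}).
Hypothesis hR : padic_integer_ring pi res.
Local Notation T := (dagger n pi).
Local Notation S := (mpseries n R).

Lemma padic_separated (x : R) : (forall N, exists y, x = pi ^+ N * y) -> x = 0.
Proof.
case: hR => _ [pi0 dvr] _ _ res0 H; apply/eqP/negPn/negP => x0.
have [u [N [uU xE]]] := dvr x x0; have [y] := H N.+1.
rewrite xE mulrC exprSr -mulrA => /(mulfI (expf_neq0 _ pi0)) uE.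
have : res u = 0 by apply/res0; exists y.
have /(rmorph_unit res) := uU.
by move=> rU r0; rewrite r0 unitr0 in rU.
Qed.

Lemma mpseries_separated (f : S) : (forall N, exists g : S, f = pi ^+ N *: g) -> f = 0.
Proof.
move=> H; apply/funext => t; apply: padic_separated => N.
by have [g ->] := H N; exists (g t).
Qed.

Lemma expansion_limit (p : nat -> {mpoly R[n]}) : exists f : S, forall N,
  exists h : S, f = \sum_(j < N) pi ^+ j *: mps_of_mpoly (p j) + pi ^+ N *: h.
Proof.
case: hR => _ _ cmp _ _.
pose s N : S := \sum_(j < N) pi ^+ j *: mps_of_mpoly (p j).
have /choice[f fE] : forall t, exists l, forall N, exists y, l - s N t = pi ^+ N * y.
  move=> t; apply: cmp => N; exists (mps_of_mpoly (p N) t).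
  by rewrite /s big_ord_recr /= -[(_ + _ : S) t]/(_ + _) addrAC subrr add0r.
exists f => N; have /choice[h hE] : forall t, exists y, f t - s N t = pi ^+ N * y.
  by move=> t; apply: fE.
exists h; apply/funext => t; rewrite -[RHS]/(s N t + pi ^+ N * h t) -hE.
by rewrite addrC subrK.
Qed.

(** The recursion comes from z = 1 + pi x z for the inverse z of 1 - pi x, by comparing powers of
    [pi] with polynomial coefficients. *)
Lemma inverse_expansion (p : nat -> {mpoly R[n]}) : exists q : nat -> {mpoly R[n]},
  q 0%N = 1 /\ forall j, q j.+1 = \sum_(i < j.+1) p i * q (j - i)%N.
Proof.
pose step (s : seq {mpoly R[n]}) :=
  rcons s (\sum_(i < size s) p i * s`_((size s).-1 - i)).
pose s j := iter j step [:: 1].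
have sz j : size (s j) = j.+1.
  by elim: j => //= j IH; rewrite size_rcons IH.
have stable i j : (i <= j)%N -> (s j)`_i = (s i)`_i.
  elim: j => [|j IH]; first by rewrite leqn0 => /eqP ->.
  rewrite leq_eqVlt => /orP[/eqP -> //|]; rewrite ltnS => ij.
  by rewrite /= /step nth_rcons sz ltnS ij IH.
exists (fun j => (s j)`_j); split=> // j.
rewrite /= /step nth_rcons -/(s j) sz ltnn eqxx; apply: eq_bigr => i _.
by rewrite stable // leq_subr.
Qed.

(** This takes the place of completeness over the overconvergent algebra: approximate inverses can
    be corrected without leaving it. *)
Lemma dagger_unit (x : T) : exists z : T, (1 - pi *: x) * z = 1.
Proof.
have [c [m [p [[zp Ep] _]]]] := dfil_exists x.
have [q [q0 qS]] := inverse_expansion p.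
have [f fE] := expansion_limit q.
(* Each step of the recursion gains a power of [pi], so the slope [m + c] pays for the offset [m] of
   the new factor [p i]. *)
have zq j : (msize (q j) <= (0 + (m + c) * j).+1)%N.
  elim/ltn_ind: j => -[_|j IH]; first by rewrite q0 msize1.
  rewrite qS; apply: leq_trans (msize_sum _ _ _) _; apply/bigmax_leqP => i _.
  have ij : (i <= j)%N by rewrite -ltnS.
  apply: leq_trans (msizeM_bound (zp i) (IH (j - i)%N _)) _; first by lia.
  by rewrite ltnS; nia.
have fD : f \in in_dagger pi.
  apply/asboolP; exists 1%N, (m + c).+1; split=> //; exists q; split=> // j.
  by apply: leq_trans (zq j) _; nia.
exists (Dagger fD); apply: val_inj.
rewrite -[LHS]/((1 - pi *: dagger_val x) * f) -[RHS]/(1 : S).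
apply/eqP; rewrite -subr_eq0; apply/eqP; apply: mpseries_separated => N.
have [h hE] := expansion_mul (Ep N) (fE N).
have [h' h'E] := fE N.+1.
exists (pi *: h' - pi *: h).
rewrite mulrBl mul1r -scalerAl hE {1}h'E big_ord_recl /= q0 expr0 scale1r mps_of_mpoly1.
have -> : \sum_(i < N) pi ^+ bump 0 i *: mps_of_mpoly (q (bump 0 i)) =
   pi *: \sum_(l < N) pi ^+ l *: mps_of_mpoly (\sum_(i < l.+1) p i * q (l - i)%N).
  by rewrite scaler_sumr; apply: eq_bigr => i _; rewrite /bump /= add1n qS scalerA -exprS.
rewrite scalerBr scalerDr !scalerA -!exprSr -exprS; set u := pi *: _.
have -> (V : zmodType) (o a b c' : V) : o + a + b - (a + c') - o = b - c'.
  by rewrite addrAC -[o + a + b]addrA [o + _]addrC addrK opprD addrACA subrr add0r.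
by [].
Qed.

End DaggerUnits.

(** * Series with a single effective term *)

Section BlockDiagonal.
Variables (B : comNzRingType) (w : B) (sg : {rmorphism B -> B}).

Lemma inj_surj_bij (S T : Type) (f : S -> T) :
  injective f -> (forall y, exists x, f x = y) -> bijective f.
Proof.
move=> fI /choice[g gK]; exists g => // x.
by apply: fI; rewrite gK.
Qed.

Lemma cls_nucmat_of (I : countType) (a : I -> I -> B) (aP : nuclear w [set: B] a) :
  cls sg (nentP (nucmat_of aP)) = cls sg aP.
Proof. by apply/esym; apply: (@cls_reindex _ _ _ _ _ _ _ aP _ (@of_pickle_dom I)) => //; exact: of_pickle_dom_bij. Qed.

Lemma cls_block_diag_single (N : nat -> nucmat w) (mult : nat -> nat) r0
    (cv : ord_to_infty N) : mult r0 = 1%N ->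
  (forall r, r != r0 -> mult r = 0%N \/ (nidx (N r) -> False)) ->
  delta_class sg (nucmat_of (block_diag_nuclear mult cv)) = cls sg (nentP (N r0)).
Proof.
move=> m1 mr; pose o : 'I_(mult r0) := cast_ord (esym m1) ord0.
pose f (j : nidx (N r0)) : block_idx N mult :=
  existT (fun n => (nidx (N n) * 'I_(mult n))%type) r0 (j, o).
apply: (@cls_reindex _ _ _ _ _ _ _ (block_diag_nuclear mult cv) _ f).
  apply: inj_surj_bij => [i j /eqP|[r [j c]]].
    by rewrite -tag_eqE /tag_eq /= eqxx tagged_asE /= xpair_eqE eqxx andbT => /eqP.
  have [e|/mr[m0|v]] := eqVneq r r0; last by case: (v j).
    subst r; exists j; rewrite /f (_ : c = o) //; apply: val_inj => /=.
    have : (c < 1)%N by rewrite -m1.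
    by case: (nat_of_ord c).
  have : (c < 0)%N by rewrite -m0.
  by [].
by move=> i j; rewrite /block_diag /= eqxx tagged_asE.
Qed.

End BlockDiagonal.

(** * Systems with overconvergent coefficients *)

Section OverconvergentSystem.
Variables (R : idomainType) (pi : R) (n : nat) (A Ahat : comAlgType R)
  (pr : {lrmorphism dagger n pi -> A}) (io : {lrmorphism A -> Ahat})
  (sgh : {lrmorphism Ahat -> Ahat}).
Hypotheses (pi0 : pi != 0) (io_compl : pi_completion pi io).
Local Notation T := (dagger n pi).
Local Notation w := (pi%:A : Ahat).

Definition theta : {rmorphism T -> Ahat} := io \o pr.

Lemma scale_w m (x : Ahat) : pi ^+ m *: x = w ^+ m * x.
Proof. by rewrite -(rmorphXn (in_alg Ahat)) /= mulr_algl. Qed.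

Lemma sgh_w : sgh w = w.
Proof. by rewrite rmorph_alg. Qed.

Lemma Ahat_sepw : sepw w.
Proof.
case: io_compl => sep _ _ _ x H; apply: sep => m; have [y ->] := H m.
by exists y; rewrite scale_w.
Qed.

Lemma Ahat_complw : complw w.
Proof.
case: io_compl => _ cmp _ _ u H; have [|l lP] := cmp u.
  by move=> m; have [y ->] := H m; exists y; rewrite scale_w.
by exists l => m; have [y ->] := lP m; exists y; rewrite scale_w.
Qed.

Lemma theta_dfil c L m x : dfil c L m x -> dvw w L (theta x).
Proof.
move=> /(dfil_div pi0)[y ->]; exists (theta y).
by rewrite /theta /= linearZ linearZ /= scale_w.
Qed.

Theorem overconvergent_fixed_point (X : finType) (F : X -> seq X -> T) (s0 : X -> Ahat)
    c m (rk : nat) (G : 'I_rk -> 'I_rk -> seq X -> T) (rho : 'M[Ahat]_rk) :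
  (forall k v, dfil c (size v) 0 (F k v)) ->
  (forall a b v, dfil c (size v) m (G a b v)) ->
  (forall k, sev w (sgh \o s0) (theta \o F k) (s0 k)) ->
  (forall a b, sev w (sgh \o s0) (theta \o G a b) (rho a b)) ->
  exists (C : nat -> nucmat w) (cv : ord_to_infty C) (nu : nat -> int),
    [/\ forall r, nu r = 1 \/ nu r = -1,
        forall r, exists Cr : nidx (C r) -> nidx (C r) -> A,
          nuclear_overconvergent pr Cr /\ forall x y, C r x y = io (Cr x y)
      & finite_class w sgh rho = delta_series sgh nu cv].
Proof.
move=> dF dG fF eG.
pose F' k := theta \o F k; pose G' a b := theta \o G a b.
have cF k : cvs w (F' k) by move=> v; apply: theta_dfil (dF k v).
have cG a b : cvs w (G' a b) by move=> v; apply: theta_dfil (dG a b v).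
have sysE (Y : finType) (K : Y -> Y -> seq X -> T) p q :
    system_mx F' (fun a b => theta \o K a b) p q = theta (system_mx F K p q).
  by rewrite /system_mx act_rmorph.
have nucS (Y : finType) (K : Y -> Y -> seq X -> T) :
    (forall a b v, dfil c (size v) m (K a b v)) ->
    nuclear w [set: Ahat] (system_mx F' (fun a b => theta \o K a b)).
  move=> dK; apply: nuclear_words => p q; rewrite sysE.
  exact: theta_dfil (dfil_system dF dK p q).
have dT := dfil_tensor_deriv dF dG.
have CP := nucS _ G dG; have CP1 := nucS _ _ dT.
(* Two terms carry the content. The series is completed by empty matrices, whose class is zero
   whatever their sign. *)
pose C r := match r with 0 => nucmat_of CP | 1 => nucmat_of CP1
  | _ => nucmat_of (@nuclear_void _ w (fun _ _ => 0)) end.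
have C0 r : (1 < r)%N -> nidx (C r) -> False.
  by case: r => [|[|r]] // _ /of_pickle_dom.
have cv : ord_to_infty C.
  (* From index 2 on the order is an infimum over the empty set, hence infinite. *)
  apply: cvg_near_cst; exists 2 => // r /= r2.
  rewrite /ord_mx (_ : [set _ | _ in _]%classic = set0) ?ereal_inf0 //.
  by rewrite -subset0 => z [[x y] _ _]; case: (C0 r r2 x).
pose nu (r : nat) : int := if r == 1%N then -1 else 1.
exists C, cv, nu; split.
- by move=> r; rewrite /nu; case: eqP; [right|left].
- have ov (Y : finType) (K : Y -> Y -> seq X -> T) (KP : nuclear w [set: Ahat] _) :
      (forall a b v, dfil c (size v) m (K a b v)) ->
      exists Cr : nidx (@nucmat_of _ _ _ (system_mx F' (fun a b => theta \o K a b)) KP) -> _ -> A,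
      nuclear_overconvergent pr Cr /\ forall x y, (nucmat_of KP) x y = io (Cr x y).
    move=> dK; pose b (x y : nidx (nucmat_of KP)) :=
      system_mx F K (of_pickle_dom x) (of_pickle_dom y).
    exists (fun x y => pr (b x y)); split; last first.
      by move=> x y; rewrite -[LHS]/(system_mx F' _ _ _) sysE.
    exists m.+1, (c + c).+1, b; split=> //.
    apply: (dfil_nuclear (l := fun y => size (of_pickle_dom y).1)) => // [x y|k].
      exact: dfil_system.
    apply: (@finite_preimage _ _ [set p | (size p.1 < k)%N]%classic
      (@of_pickle_dom (seq X * Y)%type)).
      by move=> x y _ _; apply: bij_inj; exact: of_pickle_dom_bij.
    exact: finite_short_words.
  case=> [|[|r]]; [exact: ov|exact: ov|].
  exists (fun _ _ => 0); split=> [|x]; last by case: (C0 r.+2 isT x).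
  exists 1%N, 1%N, (fun _ _ => 0); split=> // [|x]; last by case: (C0 r.+2 isT x).
  apply: (dfil_nuclear (m := 0) (c := 0) (l := fun=> 0%N)) => // [x|k].
    by case: (C0 r.+2 isT x).
  by apply: sub_finite_set (finite_set0 _) => x; case: (C0 r.+2 isT x).
(* Here the derivative is formed over [Ahat], in [CP1] over the overconvergent algebra; the entries
   agree because [theta] is a ring morphism. *)
- have CP1' : nuclear w [set: Ahat] (system_mx F' (tensor_deriv F' G')).
    by apply: nuclear_words; apply: system_dvw => // a b; apply: cvs_mul => //; apply: cvs_deriv.
  have fx := @cls_fixed_point _ w sgh Ahat_sepw Ahat_complw X F' s0 cF fF _ G'
    (fun a b => rho a b) (finite_nuclear w _) CP CP1' cG eG.
  rewrite /finite_class -/(cls sgh (finite_nuclear w (fun i j => rho i j))) fx.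
  rewrite /delta_series; congr (_ - _).
    rewrite (@cls_block_diag_single _ _ _ _ _ 0) ?cls_nucmat_of // => -[|[|r]] // _.
      by left.
    by right; apply: C0.
  rewrite (@cls_block_diag_single _ _ _ _ _ 1).
  + rewrite cls_nucmat_of; apply: (@cls_reindex _ _ _ _ _ _ _ _ _ id); first by exists id.
    move=> p q; rewrite /system_mx; apply: eq_act => // v.
    rewrite -[RHS]/(theta (tensor_deriv F G p.2 q.2 v)) [X in theta X]/tensor_deriv.
    rewrite (smul_rmorph theta); apply: eq_smul => // u.
    by rewrite -[RHS]/(theta _) rmorph_sum.
  + by [].
  + by move=> [|[|r]] // _; left.
Qed.

End OverconvergentSystem.

(** * Matrices congruent to the identity *)

Section MatrixCongruence.
Variables (B : comNzRingType) (w : B).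

Definition mdvw m n k (M : 'M[B]_(m, n)) := exists E, M = w ^+ k *: E.

Lemma mdvwP m n k (M : 'M[B]_(m, n)) : (forall i j, dvw w k (M i j)) <-> mdvw k M.
Proof.
split=> [H|[E ->] i j]; last by exists (E i j); rewrite mxE.
have /choice[f fE] : forall ij : 'I_m * 'I_n, exists y, M ij.1 ij.2 = w ^+ k * y.
  by move=> ij; apply: H.
exists (\matrix_(i, j) f (i, j)); apply/matrixP => i j.
by rewrite !mxE -(fE (i, j)).
Qed.

Lemma mdvw0 m n k : mdvw k (0 : 'M[B]_(m, n)).
Proof. by exists 0; rewrite scaler0. Qed.
Lemma mdvwD m n k (M N : 'M[B]_(m, n)) : mdvw k M -> mdvw k N -> mdvw k (M + N).
Proof. by move=> [E ->] [E' ->]; exists (E + E'); rewrite scalerDr. Qed.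
Lemma mdvwN m n k (M : 'M[B]_(m, n)) : mdvw k M -> mdvw k (- M).
Proof. by move=> [E ->]; exists (- E); rewrite scalerN. Qed.
Lemma mdvwB m n k (M N : 'M[B]_(m, n)) : mdvw k M -> mdvw k N -> mdvw k (M - N).
Proof. by move=> hM hN; apply: mdvwD => //; apply: mdvwN. Qed.
Lemma mdvwMl m n p k (M : 'M[B]_(m, n)) (N : 'M[B]_(n, p)) : mdvw k N -> mdvw k (M *m N).
Proof. by move=> [E ->]; exists (M *m E); rewrite scalemxAr. Qed.
Lemma mdvwMr m n p k (M : 'M[B]_(m, n)) (N : 'M[B]_(n, p)) : mdvw k M -> mdvw k (M *m N).
Proof. by move=> [E ->]; exists (E *m N); rewrite scalemxAl. Qed.
Lemma mdvw_le m n k l (M : 'M[B]_(m, n)) : (l <= k)%N -> mdvw k M -> mdvw l M.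
Proof.
by move=> lk [E ->]; exists (w ^+ (k - l) *: E); rewrite scalerA -exprD subnKC.
Qed.
Lemma dvw_prod (I : Type) (r : seq I) (f g : I -> B) k :
  (forall i, dvw w k (f i - g i)) -> dvw w k (\prod_(i <- r) f i - \prod_(i <- r) g i).
Proof.
move=> H; elim: r => [|i r IH]; first by rewrite !big_nil subrr; exact: dvw0.
rewrite !big_cons; apply: (@dvw_trans _ _ _ _ (f i * \prod_(i <- r) g i)).
  by rewrite -mulrBr; apply: dvwMl.
by rewrite -mulrBl; apply: dvwMr.
Qed.

Lemma dvw_det n k (M N : 'M[B]_n) : mdvw k (M - N) -> dvw w k (\det M - \det N).
Proof.
move=> /mdvwP H; rewrite -sumrB; apply: dvw_sum => s _; rewrite -mulrBr; apply: dvwMl.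
by apply: dvw_prod => i; have := H i (s i); rewrite !mxE.
Qed.

Hypothesis unit1 : forall x, exists z, (1 + w * x) * z = 1.

(** The determinant is congruent to 1, hence a unit, and the adjugate does the rest. The hypothesis
    on units is abstract so that this applies to both [A] and [Ahat]. *)
Lemma invertible_1D n (M : 'M[B]_n) : mdvw 1 (M - 1%:M) ->
  exists J, M *m J = 1%:M /\ J *m M = 1%:M.
Proof.
move=> /dvw_det; rewrite det1 => -[x xE]; have [z] := unit1 x.
rewrite -[w]expr1 -xE addrC subrK => dz.
exists (z *: \adj M); rewrite -scalemxAr -scalemxAl mul_mx_adj mul_adj_mx.
by rewrite scale_scalar_mx mulrC dz.
Qed.

Lemma invertible_1D_cong n k (M J : 'M[B]_n) :
  mdvw k (M - 1%:M) -> J *m M = 1%:M -> mdvw k (J - 1%:M).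
Proof.
move=> kM JM; have -> : J - 1%:M = - (J *m (M - 1%:M)).
  by rewrite mulmxBr JM mulmx1 opprB.
by apply: mdvwN; apply: mdvwMl.
Qed.

End MatrixCongruence.

Lemma complete_unit (B : comNzRingType) (w : B) : sepw w -> complw w ->
  forall x, exists z, (1 + w * x) * z = 1.
Proof.
move=> sep cmp x; pose t := - (w * x).
have tn n : dvw w n (t ^+ n).
  by rewrite /t -mulrN exprMn; exact: dvw_exp.
have [|z zE] := cmp (fun n => \sum_(i < n) t ^+ i).
  by move=> n; rewrite big_ord_recr /= addrAC subrr add0r.
exists z; apply: (sepw_eq sep) => n.
apply: (@dvw_trans _ _ _ _ ((1 + w * x) * \sum_(i < n) t ^+ i)).
  by rewrite -mulrBr; apply: dvwMl.
have -> : 1 + w * x = 1 - t by rewrite opprK.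
rewrite -(opprB t 1) mulNr -subrX1 opprB addrAC subrr add0r.
by apply: dvwN.
Qed.

(** * Evaluation and degree bounds of rational series *)

Section RationalSeries.
Variables (X : finType) (B : comNzRingType) (d : nat).
Implicit Types (C : 'M[B]_d) (D L : X -> 'M[B]_d).

Definition word_prod L v : 'M[B]_d := foldr (fun x => mulmx (L x)) 1%:M v.

(* (C + sum_x D_x x) (1 - sum_x L_x x)^-1 *)
Definition rational_series C D L (v : seq X) : 'M[B]_d :=
  C *m word_prod L v + (if v is x :: v' then D x *m word_prod L v' else 0).

Variable w : B.

Lemma rational_series_ev C D L (s : X -> B) (Y : 'M[B]_d) :
  (forall x, mdvw w 1 (D x)) -> (forall x, mdvw w 1 (L x)) ->
  Y *m (1%:M - \sum_x s x *: L x) = C + \sum_x s x *: D x ->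
  forall i j, sev w s (fun v => rational_series C D L v i j) (Y i j).
Proof.
move=> dD dL YE; set l := \sum_x s x *: L x in YE; set e := \sum_x s x *: D x in YE.
have dsum (K : X -> 'M[B]_d) : (forall x, mdvw w 1 (K x)) -> mdvw w 1 (\sum_x s x *: K x).
  move=> dK; elim/big_ind: _ => [||x _]; [exact: mdvw0|exact: mdvwD|].
  by have [E ->] := dK x; exists (s x *: E); rewrite !scalerA mulrC.
have dl : mdvw w 1 l by exact: dsum.
have de : mdvw w 1 e by exact: dsum.
(* The partial sums of the geometric series of [l]. *)
pose g n := \sum_(v <- words X n) shift s v [::] *: word_prod L v.
have gS n : g n.+1 = 1%:M + l *m g n.
  rewrite /g sum_words /= scale1r; congr (_ + _).
  rewrite mulmx_suml; apply: eq_bigr => x _; rewrite mulmx_sumr.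
  by apply: eq_bigr => v _; rewrite addr0 -scalemxAl -scalemxAr scalerA.
have gD n : mdvw w n (g n.+1 - g n).
  elim: n => [|n IH]; first by exists (g 1 - g 0); rewrite scale1r.
  rewrite (gS n.+1) [in X in _ - X]gS opprD addrACA subrr add0r -mulmxBr.
  have [E ->] := IH; have [E' ->] := dl.
  by exists (E' *m E); rewrite -scalemxAl -scalemxAr scalerA -exprD add1n.
have Yg n : mdvw w n (Y - (C + e) *m g n).
  have -> : Y - (C + e) *m g n = Y *m (g n.+1 - g n).
    rewrite -YE -mulmxA mulmxBl mul1mx gS -addrA -[l *m g n - g n]opprB.
    by rewrite [RHS]mulmxDr mulmx1 mulmxN.
  exact: mdvwMl.
pose Z n := \sum_(v <- words X n) shift s v [::] *: rational_series C D L v.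
(* A term with [D] spends one letter on [D] itself, so [e] meets [g n] where [C] meets [g n.+1]. *)
have ZS n : Z n.+1 = C *m g n.+1 + e *m g n.
  rewrite /Z /rational_series; under eq_bigr => v _ do rewrite scalerDr.
  rewrite big_split /=; congr (_ + _).
    by rewrite mulmx_sumr; apply: eq_bigr => v _; rewrite scalemxAr.
  rewrite sum_words /= scaler0 add0r mulmx_suml; apply: eq_bigr => x _.
  rewrite mulmx_sumr; apply: eq_bigr => v _.
  by rewrite addr0 -scalemxAl -scalemxAr scalerA.
have YZ n : mdvw w n (Y - Z n).
  case: n => [|n]; first by exists (Y - Z 0); rewrite scale1r.
  have -> : Y - Z n.+1 = (Y - (C + e) *m g n.+1) + e *m (g n.+1 - g n).
    by rewrite ZS mulmxDl mulmxBr !opprD !addrA subrK.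
  apply: mdvwD; first exact: Yg.
  have [E ->] := gD n; have [E' ->] := de.
  by exists (E' *m E); rewrite -scalemxAl -scalemxAr scalerA -exprD add1n.
move=> i j n; have /mdvwP/(_ i j) := YZ n; rewrite !mxE.
rewrite (_ : Z n i j = \sum_(v <- words X n) rational_series C D L v i j * shift s v [::]) //.
by rewrite summxE; apply: eq_bigr => v _; rewrite mxE mulrC.
Qed.

End RationalSeries.

Lemma rational_series_rmorph (X : finType) (B B' : comNzRingType) (h : {rmorphism B -> B'})
    d C (D L : X -> 'M[B]_d) v :
  map_mx h (rational_series C D L v) =
  rational_series (map_mx h C) (map_mx h \o D) (map_mx h \o L) v.
Proof.
have wE u : map_mx h (word_prod L u) = word_prod (map_mx h \o L) u.
  by elim: u => [|x u IH] /=; rewrite ?map_mx1 // map_mxM IH.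
rewrite /rational_series map_mxD map_mxM wE; congr (_ + _).
by case: v => [|x v]; rewrite ?map_mx0 // map_mxM wE.
Qed.

(** [L] occurs arbitrarily often and must have offset 0; [C] and [D] occur at most once per term and
    may keep the offset [m]. *)
Lemma dfil_rational_series n (R : idomainType) (pi : R) (X : finType) d c m
    (C : 'M[dagger n pi]_d) (D L : X -> 'M_d) :
  (forall i j, dfil c 0 m (C i j)) -> (forall x i j, dfil c 1 m (D x i j)) ->
  (forall x i j, dfil c 1 0 (L x i j)) ->
  forall v i j, dfil c (size v) m (rational_series C D L v i j).
Proof.
move=> dC dD dL.
have dP v i j : dfil c (size v) 0 (word_prod L v i j).
  elim: v i j => [|x v IH] i j /=.
    by rewrite mxE; case: eqP => _; [exact: dfil1|exact: dfil0].
  by rewrite mxE; apply: dfil_sum => k _; exact: (dfilM (dL _ _ _) (IH _ _)).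
move=> v i j; rewrite mxE; apply: dfilD.
  by rewrite mxE; apply: dfil_sum => k _; rewrite -[m]addn0; exact: (dfilM (dC _ _) (dP _ _ _)).
case: v => [|x v]; first by rewrite mxE; exact: dfil0.
by rewrite mxE; apply: dfil_sum => k _; rewrite -[m]addn0; exact: (dfilM (dD _ _ _) (dP _ _ _)).
Qed.

(** * Descent from the completion *)

Section Descent.
Variables (R : idomainType) (pi : R) (A Ahat : comAlgType R) (io : {lrmorphism A -> Ahat}).
Hypothesis io_compl : pi_completion pi io.
Hypothesis A_unit : forall x : A, exists z, (1 + pi%:A * x) * z = 1.
Local Notation w := (pi%:A : Ahat).

Lemma io_scale k (x : A) : io (pi%:A ^+ k * x) = w ^+ k * io x.
Proof. by rewrite rmorphM rmorphXn /= rmorph_alg. Qed.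

Lemma io_dvw k x : dvw w k (io x) -> dvw (pi%:A : A) k x.
Proof.
case: io_compl => _ _ _ H [y yE]; have [|b ->] := H k x.
  by exists y; rewrite yE scale_w.
by exists b; rewrite -(rmorphXn (in_alg A)) /= mulr_algl.
Qed.

Lemma io_mdvw m n k (M : 'M[A]_(m, n)) : mdvw w k (map_mx io M) -> mdvw (pi%:A : A) k M.
Proof.
by move=> /mdvwP H; apply/mdvwP => i j; apply: io_dvw; have := H i j; rewrite mxE.
Qed.

Lemma io_approx m n k (M : 'M[Ahat]_(m, n)) : exists N : 'M[A]_(m, n), mdvw w k (map_mx io N - M).
Proof.
case: io_compl => _ _ H _.
have /choice[f fE] : forall ij : 'I_m * 'I_n, exists a, dvw w k (io a - M ij.1 ij.2).
  move=> ij; have [a [y ->]] := H k (M ij.1 ij.2); exists a.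
  by exists (- y); rewrite opprD addNKr scale_w mulrN.
exists (\matrix_(i, j) f (i, j)); apply/mdvwP => i j.
by rewrite !mxE; exact: (fE (i, j)).
Qed.

Lemma map_io_scale m n k (M : 'M[A]_(m, n)) :
  map_mx io ((pi%:A : A) ^+ k *: M) = w ^+ k *: map_mx io M.
Proof. by apply/matrixP => i j; rewrite !mxE io_scale. Qed.

(** Approximating [N] to one power of [pi] beyond [k] gives a product [pi ^+ k] (1 + [pi] E) with E
    over [A]; the second factor is invertible over [A]. *)
Lemma right_inverse_descent m n k (M : 'M[A]_(m, n)) (N : 'M[Ahat]_(n, m)) :
  map_mx io M *m N = w ^+ k *: 1%:M -> exists N' : 'M[A]_(n, m), M *m N' = (pi%:A) ^+ k *: 1%:M.
Proof.
move=> MN; have [N0 N0E] := io_approx k.+1 N.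
have [|E EE] := @io_mdvw _ _ k.+1 (M *m N0 - (pi%:A) ^+ k *: 1%:M).
  rewrite map_mxB map_mxM map_io_scale map_mx1 -MN -mulmxBr.
  exact: mdvwMl.
have [|J [J1 _]] := @invertible_1D _ _ A_unit _ (1%:M + pi%:A *: E).
  by exists E; rewrite addrC addKr expr1.
exists (N0 *m J); rewrite mulmxA.
rewrite (_ : M *m N0 = (pi%:A) ^+ k *: (1%:M + pi%:A *: E)) -?scalemxAl ?J1 //.
by rewrite scalerDr scalerA -exprSr -EE addrC subrK.
Qed.

End Descent.

(** * Coordinate projections *)

Section Projections.
Variables (B : comNzRingType) (d : nat).
Implicit Types p q : pred 'I_d.

Definition proj p : 'M[B]_d := \matrix_(i, j) ((i == j) && p i)%:R.

Lemma proj_mull p m (M : 'M[B]_(d, m)) i j : (proj p *m M) i j = (p i)%:R * M i j.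
Proof.
rewrite mxE (bigD1 i) //= big1 ?addr0 => [|k /negPf ki]; first by rewrite mxE eqxx.
by rewrite mxE eq_sym ki mul0r.
Qed.

Lemma proj_mulr p m (M : 'M[B]_(m, d)) i j : (M *m proj p) i j = M i j * (p j)%:R.
Proof.
rewrite mxE (bigD1 j) //= big1 ?addr0 => [|k /negPf kj]; first by rewrite mxE eqxx.
by rewrite mxE kj mulr0.
Qed.

Lemma projM p q : proj p *m proj q = proj (predI p q).
Proof.
by apply/matrixP => i j; rewrite proj_mull !mxE -natrM mulnb /= andbCA.
Qed.

Lemma proj_idem p : proj p *m proj p = proj p.
Proof. by apply/matrixP => i j; rewrite projM !mxE /= andbb. Qed.

Lemma projC p : 1%:M - proj p = proj (predC p).
Proof.
apply/matrixP => i j; rewrite !mxE; case: eqP => _ /=; last by rewrite subrr.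
by case: (p i); rewrite /= ?subrr ?subr0.
Qed.

End Projections.

Lemma map_proj (B B' : comNzRingType) (h : {rmorphism B -> B'}) d (p : pred 'I_d) :
  map_mx h (proj B p) = proj B' p.
Proof. by apply/matrixP => i j; rewrite !mxE rmorph_nat. Qed.

(** * Normalized frames and the Riccati equation *)

Section Flags.
Variables (B : comNzRingType) (w : B) (sg : {rmorphism B -> B}).
Hypothesis sgw : sg w = w.
Hypothesis unit1 : forall x, exists z, (1 + w * x) * z = 1.
Hypothesis tfree : forall x, w * x = 0 -> x = 0.
Variable d : nat.
Implicit Types (P M N X Phi Psi Th : 'M[B]_d).
Local Notation "M ^s" := (map_mx sg M) (at level 2, format "M ^s").

Lemma scale_w_inj k m n : injective (fun M : 'M[B]_(m, n) => w ^+ k *: M).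
Proof.
have H x : w ^+ k * x = 0 -> x = 0.
  by elim: k => [|k IH]; rewrite ?mul1r // exprS -mulrA => /tfree.
move=> M N /= e; apply/eqP; rewrite -subr_eq0; apply/eqP/matrixP => i j.
by rewrite !mxE; apply: H; rewrite mulrBr; have /matrixP/(_ i j) := e; rewrite !mxE => ->; rewrite subrr.
Qed.

Lemma map_scale_w k m n (M : 'M[B]_(m, n)) : map_mx sg (w ^+ k *: M) = w ^+ k *: map_mx sg M.
Proof. by rewrite map_mxZ rmorphXn sgw. Qed.

(** Filling the complement of the corner with the identity makes [q] invertible; compressing the
    inverse by [P] inverts it within the corner. *)
Lemma corner_inverse P q : P *m P = P -> P *m q = q -> q *m P = q ->
  mdvw w 1 (q - P) ->
  exists j, [/\ P *m j = j, j *m P = j, q *m j = P & j *m q = P].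
Proof.
move=> PP Pq qP q1.
have [|J [qJ Jq]] := @invertible_1D _ _ unit1 _ (q + (1%:M - P)).
  by rewrite addrA addrAC addrK.
have P0 : (1%:M - P) *m P = 0 by rewrite mulmxBl mul1mx PP subrr.
have P0' : P *m (1%:M - P) = 0 by rewrite mulmxBr mulmx1 PP subrr.
exists (P *m J *m P); split.
- by rewrite !mulmxA PP.
- by rewrite -!mulmxA PP.
- have := congr1 (fun M => P *m M *m P) qJ.
  by rewrite mulmx1 PP mulmxDl mulmxDr !mulmxA P0' !mul0mx addr0 Pq qP.
- have := congr1 (fun M => P *m M *m P) Jq.
  by rewrite mulmx1 PP mulmxDr mulmxDr mulmxDl -!mulmxA P0 !mulmx0 addr0 qP Pq.
Qed.

(* X spans, in normalized form, the subspace corresponding to the image of P under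
   the base change Th. *)
Lemma flag_frame k P Th Th' Phi Psi :
  P *m P = P -> P^s = P -> Th *m Th' = 1%:M -> Th' *m Th = 1%:M ->
  Th *m Phi = Psi *m Th^s -> mdvw w k.+1 (Th - 1%:M) -> Psi *m P = P *m Psi *m P ->
  exists X j q, [/\ X = Th' *m P *m j, X *m q = Th' *m P /\ P *m q = q, P *m X = P /\ X *m P = X,
    Phi *m X^s = X *m P *m Phi *m X^s & mdvw w k.+1 (X - P)].
Proof.
move=> PP sP TT' T'T ThE Th1 PsiP.
have Th'1 : mdvw w k.+1 (Th' - 1%:M) by apply: invertible_1D_cong Th1 T'T.
(* [q] is the [P]-corner of [Th']. Its inverse [j] within the corner normalizes the frame [Th' P] so
   that [P X = P]. *)
have [q qE] : exists q, q = P *m Th' *m P by eexists.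
have Pq : P *m q = q by rewrite qE !mulmxA PP.
have qP : q *m P = q by rewrite qE -!mulmxA PP.
have q1 : mdvw w k.+1 (q - P).
  have -> : q - P = P *m (Th' - 1%:M) *m P by rewrite qE mulmxBr mulmxBl mulmx1 PP.
  by apply: mdvwMr; apply: mdvwMl.
have [j [Pj jP qj jq]] := corner_inverse PP Pq qP (mdvw_le (isT : (1 <= k.+1)%N) q1).
have j1 : mdvw w k.+1 (j - P).
  have -> : j - P = - (j *m (q - P)) by rewrite mulmxBr jq jP opprB.
  by apply: mdvwN; apply: mdvwMl.
have PTq : P *m Th' *m P = q by rewrite qE.
have [X XE] : exists X, X = Th' *m P *m j by eexists.
have Xq : X *m q = Th' *m P by rewrite XE -!mulmxA jq PP.
have PX : P *m X = P by rewrite XE !mulmxA PTq qj.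
have XP : X *m P = X by rewrite XE -!mulmxA jP.
exists X, j, q; split=> //.
  have TTs : Th^s *m Th'^s = 1%:M by rewrite -map_mxM TT' map_mx1.
  have PhiT : Phi *m Th'^s = Th' *m Psi.
    by rewrite -[Phi]mul1mx -T'T -[Th' *m Th *m Phi]mulmxA ThE -!mulmxA TTs mulmx1.
  have PhiX : Phi *m X^s = X *m (q *m Psi *m P *m j^s).
    rewrite !mulmxA Xq XE !map_mxM sP !mulmxA PhiT.
    by rewrite -[Th' *m Psi *m P]mulmxA PsiP !mulmxA.
  (* Since [P X = P], applying [P] reads off coordinates with respect to the frame [X]. *)
  have PPhiX : P *m (Phi *m X^s) = q *m Psi *m P *m j^s.
    by rewrite PhiX mulmxA PX !mulmxA Pq.
  by rewrite -!mulmxA PPhiX PhiX.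
have -> : X - P = (Th' - 1%:M) *m P *m j + P *m (j - P).
  by rewrite XE !mulmxBl mul1mx mulmxBr PP Pj addrA subrK.
by apply: mdvwD; [do 2!apply: mdvwMr|apply: mdvwMl].
Qed.

(** The part of [Phi X^s a] outside the image of [P] is computed in two ways: from the blocks of
    [Phi] ([E1]) and from stability of the frame ([E2]). The exponents are such that cancelling
    [w ^+ (t.+1 + t)] frees [y] and leaves a factor [w] on every other term. *)
Lemma riccati t P Phi X y a c0 c1 :
  P *m P = P -> P^s = P -> X = P + w ^+ t.+1 *: y -> y *m P = y -> P *m y = 0 ->
  Phi *m X^s = X *m P *m Phi *m X^s ->
  P *m Phi *m P *m a = w ^+ t *: P -> P *m a = a ->
  (1%:M - P) *m Phi *m P = w ^+ (t.+1 + t.+1) *: c0 ->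
  (1%:M - P) *m Phi *m (1%:M - P) = w ^+ t.+1 *: c1 ->
  y *m (1%:M + w *: (Phi *m y^s *m a)) = w *: (c0 *m a) + w *: (c1 *m y^s *m a).
Proof.
move=> PP sP XE yP Py frame PhiPa Pa c0E c1E.
have Py' : P *m y^s = 0 by rewrite -{1}sP -map_mxM Py map_mx0.
have y' : (1%:M - P) *m y^s = y^s by rewrite mulmxBl mul1mx Py' subr0.
have Xs : X^s = P + w ^+ t.+1 *: y^s by rewrite XE map_mxD map_scale_w sP.
have P0 : (1%:M - P) *m P = 0 by rewrite mulmxBl mul1mx PP subrr.
have QX : (1%:M - P) *m X = w ^+ t.+1 *: y.
  by rewrite XE mulmxDr P0 add0r -scalemxAr mulmxBl mul1mx Py subr0.
have E1 : (1%:M - P) *m Phi *m X^s *m a =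
    w ^+ (t.+1 + t.+1) *: (c0 *m a) + w ^+ (t.+1 + t.+1) *: (c1 *m y^s *m a).
  rewrite Xs mulmxDr mulmxDl c0E -scalemxAl -scalemxAr; congr (_ + _).
  by rewrite -scalemxAl -{1}y' mulmxA c1E -!scalemxAl scalerA -exprD.
have E2 : (1%:M - P) *m Phi *m X^s *m a =
    w ^+ (t.+1 + t) *: y + w ^+ (t.+1 + t.+1) *: (y *m Phi *m y^s *m a).
  rewrite -[(1%:M - P) *m Phi *m X^s]mulmxA frame !mulmxA QX Xs.
  rewrite mulmxDr mulmxDl -!scalemxAl yP -!scalemxAr -!scalemxAl !scalerA -!exprD.
  congr (_ + _).
  have -> : y *m Phi *m P *m a = y *m (P *m Phi *m P *m a).
    by rewrite !mulmxA yP.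
  by rewrite PhiPa -scalemxAr yP scalerA -exprD.
apply: (@scale_w_inj (t.+1 + t)); rewrite /= mulmxDr mulmx1 !scalerDr -scalemxAr !scalerA.
by rewrite -!exprSr -!addnS !mulmxA -E2 E1.
Qed.

(** For two nested steps framed by [X1] and [X2], the map [R - R X1] takes the [R]-coordinates
    modulo the smaller step. The corner [c] compares this quotient with the adapted one, where the
    map is [R Psi R]. *)
Lemma graded_conjugate P1 P2 X1 j1 X2 j2 q2 Th Th' Phi Psi R c :
  R = P2 - P1 -> c = R *m Th *m X2 *m R ->
  P1 *m P1 = P1 -> P2 *m P2 = P2 -> P1 *m P2 = P1 -> P2 *m P1 = P1 ->
  P1^s = P1 -> P2^s = P2 -> Th *m Th' = 1%:M -> Th *m Phi = Psi *m Th^s ->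
  Psi *m P1 = P1 *m Psi *m P1 ->
  X1 = Th' *m P1 *m j1 -> P1 *m X1 = P1 -> X1 *m P1 = X1 ->
  X2 = Th' *m P2 *m j2 -> X2 *m q2 = Th' *m P2 -> P2 *m X2 = P2 -> X2 *m P2 = X2 ->
  Phi *m X2^s = X2 *m P2 *m Phi *m X2^s -> P2 *m q2 = q2 ->
  c *m ((R - R *m X1) *m Phi *m X2^s *m R) = R *m Psi *m R *m c^s.
Proof.
move=> RE cE P11 P22 P12 P21 s1 s2 TT' ThE PsiP1 X1E P1X1 X1P1 X2E X2q P2X2 X2P2 frame Pq.
have RR : R *m R = R.
  by rewrite RE mulmxBr !mulmxBl P11 P22 P12 P21 subrr subr0.
have RP1 : R *m P1 = 0 by rewrite RE mulmxBl P21 P11 subrr.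
have sR : R^s = R by rewrite RE map_mxB s1 s2.
have P2E : P2 = P1 + R by rewrite RE addrC subrK.
have ThX1 : Th *m X1 = P1 *m j1 by rewrite X1E !mulmxA TT' mul1mx.
have ThX2 : Th *m X2 = P2 *m j2 by rewrite X2E !mulmxA TT' mul1mx.
(* The smaller step expressed in the frame of the larger one. *)
have X21 : X2 *m (P1 + R *m X1) = X1.
  have X1E' : X1 = X2 *m (q2 *m P1 *m j1).
    by rewrite !mulmxA X2q X1E -[Th' *m P2 *m P1]mulmxA P21.
  have <- : P2 *m X1 = P1 + R *m X1 by rewrite P2E mulmxDl P1X1.
  by rewrite {1}X1E' !mulmxA -[X2 *m P2 *m X2]mulmxA P2X2 X2P2 X2q
     -[Th' *m P2 *m P1]mulmxA P21 -X1E.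
have RTX2P1 : R *m Th *m X2 *m P1 = - (R *m Th *m X2 *m R *m X1).
  apply/eqP; rewrite -addr_eq0 -[_ *m R *m X1]mulmxA -mulmxDr -[_ *m X2 *m _]mulmxA X21.
  by rewrite -mulmxA ThX1 mulmxA RP1 mul0mx.
have L : R *m Th *m Phi *m X2^s *m R = c *m ((R - R *m X1) *m Phi *m X2^s *m R).
  have -> : R *m Th *m Phi *m X2^s *m R = R *m Th *m X2 *m P2 *m Phi *m X2^s *m R.
    by rewrite -[R *m Th *m Phi *m X2^s]mulmxA frame !mulmxA.
  rewrite {1}P2E mulmxDr RTX2P1 !mulmxA cE mulmxBr -[_ *m R *m R]mulmxA RR mulmxA.
  by rewrite -[_ *m R *m R]mulmxA RR [- _ + _]addrC.
rewrite -L -[R *m Th *m Phi]mulmxA ThE.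
have -> : R *m (Psi *m Th^s) *m X2^s *m R = R *m Psi *m (Th *m X2)^s *m R.
  by rewrite map_mxM !mulmxA.
have RPsi : R *m Psi *m P2 = R *m Psi *m R.
  rewrite P2E mulmxDr -[X in X + _]mulmxA PsiP1 !mulmxA RP1 !mul0mx add0r //.
have TX2s : (Th *m X2)^s = P2 *m (Th *m X2)^s.
  by rewrite -[in RHS]s2 -map_mxM ThX2 mulmxA P22.
rewrite TX2s mulmxA RPsi cE !map_mxM sR !mulmxA.
by rewrite -[R *m Psi *m R *m R]mulmxA RR.
Qed.

End Flags.

Lemma cls_sim_fin (B : comNzRingType) (w : B) (sg : {rmorphism B -> B}) r
    (M N S S' : 'M[B]_r) : S *m S' = 1%:M -> S' *m S = 1%:M ->
  S' *m M *m map_mx sg S = N -> finite_class w sg M = finite_class w sg N.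
Proof.
move=> SS' S'S MN.
have prod (P Q T : 'M[B]_r) : P *m Q = T ->
    is_mxprod w (fun i j => P i j) (fun i j => Q i j) (fun i j => T i j).
  by move=> <- i j; rewrite mxE; apply: has_sum_fin.
have one : (fun i j : 'I_r => (1%:M : 'M[B]_r) i j) = (@mx_one B _).
  by apply/funext => i; apply/funext => j; rewrite mxE.
have Ssg : (fun i j : 'I_r => sg (S i j)) = (fun i j => (map_mx sg S) i j).
  by apply/funext => i; apply/funext => j; rewrite mxE.
apply: (@cls_sim _ _ _ _ _ _ _ _ _ (fun i j => S i j) (fun i j => S' i j)
  (fun i j => (S' *m M) i j) (fun i j => (M *m map_mx sg S) i j)).
- by rewrite -one; apply: prod.
- by rewrite -one; apply: prod.
- exact: prod.
- by rewrite Ssg; apply: prod.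
- by rewrite Ssg; apply: prod.
- by apply: prod; rewrite mulmxA.
Qed.

(** * The Riccati system of one slope *)

Section SlopeData.
Variables (R : idomainType) (pi : R) (n : nat) (A Ahat : comAlgType R)
  (pr : {lrmorphism dagger n pi -> A}) (io : {lrmorphism A -> Ahat})
  (sgh : {lrmorphism Ahat -> Ahat}).
Hypotheses (pi0 : pi != 0) (io_compl : pi_completion pi io).
Hypothesis pr_surj : forall a, exists x, pr x = a.
Hypothesis A_unit : forall x : A, exists z, (1 + pi%:A * x) * z = 1.
Local Notation T := (dagger n pi).
Local Notation w := (pi%:A : Ahat).
Local Notation piA := (pi%:A : A).
Hypothesis Ahat_tfree : forall x : Ahat, w * x = 0 -> x = 0.
Local Notation "M ^s" := (map_mx sgh M) (at level 2, format "M ^s").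

Let unit1 : forall x, exists z, (1 + w * x) * z = 1.
Proof. exact: complete_unit (Ahat_sepw io_compl) (Ahat_complw io_compl). Qed.

Variables (d : nat) (s : 'I_d -> nat) (Phi : 'M[A]_d) (Th Th' Psi U V : 'M[Ahat]_d) (K : nat).
Hypotheses (ThTh' : Th *m Th' = 1%:M) (Th'Th : Th' *m Th = 1%:M).
Hypothesis ThE : Th *m map_mx io Phi = Psi *m Th^s.
Hypothesis Th1 : mdvw w K.+1 (Th - 1%:M).
Hypothesis Psi0 : forall i j, (s j < s i)%N -> Psi i j = 0.
Hypothesis PsiU : forall i j, s i = s j -> Psi i j = w ^+ s j * U i j.
Hypothesis PsiK : forall i j, (s i < s j)%N -> dvw w K.+1 (Psi i j).
Hypothesis U0 : forall i j, s i != s j -> U i j = 0.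
Hypothesis UV : U *m V = 1%:M.

Let Ph := map_mx io Phi.

Lemma Phi_congr : mdvw w K.+1 (Ph - Psi).
Proof.
have -> : Ph - Psi = Psi *m (Th^s - 1%:M) - (Th - 1%:M) *m Ph.
  by rewrite mulmxBr mulmx1 mulmxBl mul1mx ThE opprB [RHS]addrC addrA subrK.
apply: mdvwB; last exact: mdvwMr.
apply: mdvwMl; have [E EE] := Th1; exists (E^s).
have -> : Th^s - 1%:M = (Th - 1%:M)^s by rewrite map_mxB map_mx1.
by rewrite EE map_mxZ rmorphXn /= rmorph_alg.
Qed.

Lemma Phi_offdiag i j : s i != s j -> dvw w K.+1 (Ph i j).
Proof.
move=> sij; rewrite -[Ph i j](subrK (Psi i j)); apply: dvwD.
  by have /mdvwP/(_ i j) := Phi_congr; rewrite !mxE.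
move: sij; rewrite neq_ltn => /orP[|/Psi0 ->]; [exact: PsiK|exact: dvw0].
Qed.

Lemma Phi_diag i j : s i = s j -> dvw w K.+1 (Ph i j - w ^+ s j * U i j).
Proof. by move=> sij; have /mdvwP/(_ i j) := Phi_congr; rewrite !mxE PsiU. Qed.

Lemma Phi_dvw i j k : (k <= s j)%N -> (k <= K.+1)%N -> dvw w k (Ph i j).
Proof.
move=> ks kK; have [sij|/Phi_offdiag] := eqVneq (s i) (s j); last exact: dvw_le.
rewrite -[Ph i j](subrK (w ^+ s j * U i j)); apply: dvwD.
  exact: dvw_le kK (Phi_diag sij).
by apply: dvw_le ks _; exact: dvw_exp.
Qed.

(** [a] is [w ^+ t] times the inverse of the corner [P Ph P], whose columns have slopes at most [t].
    It is approximated from [V], corrected over [Ahat], and then descended to [A]. *)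
Lemma threshold_data t (p := [pred j | (s j <= t)%N]) (P := proj Ahat p) :
  (t.+1 + t.+1 <= K.+1)%N -> exists a c0 c1 : 'M[A]_d,
  [/\ P *m Ph *m P *m map_mx io a = w ^+ t *: P, P *m map_mx io a = map_mx io a,
      (1%:M - P) *m Ph *m P = w ^+ (t.+1 + t.+1) *: map_mx io c0
    & (1%:M - P) *m Ph *m (1%:M - P) = w ^+ t.+1 *: map_mx io c1].
Proof.
move=> tK; pose PA := proj A p.
have PAE : map_mx io PA = P by exact: map_proj.
have PP : P *m P = P by exact: proj_idem.
have [|c0 c0E] := @io_mdvw _ _ _ _ _ io_compl _ _ (t.+1 + t.+1) ((1%:M - PA) *m Phi *m PA).
  rewrite !map_mxM map_mxB map_mx1 PAE; apply/mdvwP => i j.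
  rewrite /P projC proj_mulr proj_mull /=.
  case: leqP => [_|ti]; first by rewrite mul0r mul0r; exact: dvw0.
  case: leqP => [jt|_]; last by rewrite mulr0; exact: dvw0.
  apply: dvwMr; apply: dvwMl; apply: dvw_le tK (Phi_offdiag _).
  by rewrite neq_ltn (leq_ltn_trans jt ti) orbT.
have [|c1 c1E] := @io_mdvw _ _ _ _ _ io_compl _ _ t.+1 ((1%:M - PA) *m Phi *m (1%:M - PA)).
  rewrite !map_mxM map_mxB map_mx1 PAE; apply/mdvwP => i j.
  rewrite /P projC proj_mulr proj_mull /=.
  case: (leqP (s j)) => [_|tj]; first by rewrite mulr0; exact: dvw0.
  apply: dvwMr; apply: dvwMl; apply: Phi_dvw tj _; exact: leq_trans (leq_addr _ _) tK.
(* [L] raises the factor [w ^+ s j] of each column of the corner to the common [w ^+ t]. In [X] the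
   complement of the corner is filled with the same power, so that the descent concerns a full
   square matrix. *)
pose L : 'M[Ahat]_d := \matrix_(i, j) (((i == j) && p i)%:R * w ^+ (t - s i)).
pose X := PA *m Phi *m PA + piA ^+ t *: (1%:M - PA).
have XE : map_mx io X = P *m Ph *m P + w ^+ t *: (1%:M - P).
  by rewrite map_mxD map_io_scale !map_mxM map_mxB map_mx1 PAE.
have PL : P *m L = L.
  apply/matrixP => i j; rewrite proj_mull !mxE /=.
  by case: (s i <= t)%N; rewrite ?andbT ?mul1r ?andbF ?mul0r.
have L_mulr (M : 'M[Ahat]_d) i j : (M *m L) i j = M i j * ((p j)%:R * w ^+ (t - s j)).
  rewrite mxE (bigD1 j) //= big1 ?addr0 => [|k /negPf kj]; first by rewrite !mxE eqxx.
  by rewrite mxE kj mul0r mulr0.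
have PP0 : (1%:M - P) *m P = 0 by rewrite mulmxBl mul1mx PP subrr.
have PP0' : P *m (1%:M - P) = 0 by rewrite mulmxBr mulmx1 PP subrr.
have UP : U *m P = P *m U.
  apply/matrixP => i j; rewrite proj_mulr proj_mull /=.
  have [->|/U0 ->] := eqVneq (s i) (s j); first by rewrite mulrC.
  by rewrite mul0r mulr0.
have main : mdvw w K.+1 (Ph *m L - w ^+ t *: (U *m P)).
  apply/mdvwP => i j; rewrite [X in dvw _ _ X]mxE L_mulr [X in _ + X]mxE [X in - X]mxE proj_mulr /=.
  case: leqP => jt; last by rewrite mul0r !mulr0 subrr; exact: dvw0.
  rewrite mul1r mulr1; have [sij|sij] := eqVneq (s i) (s j).
    rewrite -{2}(subnK jt) addnC exprD -mulrA [w ^+ (t - s j) * _]mulrC mulrA -mulrBl.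
    exact: dvwMr (Phi_diag sij).
  by rewrite U0 // mulr0 subr0; apply: dvwMr; exact: Phi_offdiag.
pose N0 := L *m V + (1%:M - P).
have XN0 : mdvw w K.+1 (map_mx io X *m N0 - w ^+ t *: 1%:M).
  have -> : map_mx io X *m N0 - w ^+ t *: 1%:M = P *m (Ph *m L - w ^+ t *: (U *m P)) *m V.
    rewrite XE /N0 mulmxDr !mulmxDl -!scalemxAl.
    rewrite -[P *m Ph *m P *m (1%:M - P)]mulmxA PP0' mulmx0 add0r.
    rewrite [(1%:M - P) *m (L *m V)]mulmxA -{2}PL [(1%:M - P) *m _]mulmxA PP0 !mul0mx scaler0.
    rewrite addr0 mulmxBr mulmxBl mulmx1 PP0 subr0 scalerBr addrA addrAC addrK.
    rewrite -[_ *m P *m (L *m V)]mulmxA [P *m (L *m V)]mulmxA PL.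
    rewrite mulmxBr mulmxBl !mulmxA; congr (_ - _).
    by rewrite -!scalemxAr -!scalemxAl UP !mulmxA PP -mulmxA UV mulmx1.
  by apply: mdvwMr; apply: mdvwMl.
have tK1 : (t < K.+1)%N by apply: leq_trans (leq_addr _ _) tK.
have [E EE] := mdvw_le tK1 XN0.
have [|J [J1 _]] := @invertible_1D _ _ unit1 _ (1%:M + w *: E).
  by exists E; rewrite addrC addrA addNr add0r expr1.
have XN : map_mx io X *m (N0 *m J) = w ^+ t *: 1%:M.
  rewrite mulmxA (_ : map_mx io X *m N0 = w ^+ t *: (1%:M + w *: E)) -?scalemxAl ?J1 //.
  by rewrite scalerDr scalerA -exprSr -EE addrC subrK.
have [N NE] := right_inverse_descent io_compl A_unit XN.
have PAA : PA *m PA = PA by exact: proj_idem.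
exists (PA *m N *m PA), c0, c1; split.
- have PAX : PA *m X = PA *m Phi *m PA.
    rewrite /X mulmxDr -scalemxAr !mulmxA PAA mulmxBr mulmx1 PAA subrr.
    by rewrite scaler0 addr0.
  have := congr1 (fun M => map_mx io (PA *m M *m PA)) NE.
  rewrite mulmxA PAX -scalemxAr mulmx1 -scalemxAl PAA map_io_scale PAE.
  rewrite !map_mxM PAE => e.
  by rewrite -e !mulmxA -[_ *m P *m P]mulmxA PP.
- by rewrite -PAE -map_mxM !mulmxA PAA.
- have := congr1 (map_mx io) c0E.
  by rewrite map_io_scale !map_mxM map_mxB map_mx1 PAE.
- have := congr1 (map_mx io) c1E.
  by rewrite map_io_scale !map_mxM map_mxB map_mx1 PAE.
Qed.

Lemma riccati_data t (p := [pred j | (s j <= t)%N]) (P := proj Ahat p) :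
  (t.+1 + t.+1 <= K.+1)%N -> exists X j q y (a c0 c1 : 'M[A]_d),
  [/\ X = Th' *m P *m j, X *m q = Th' *m P /\ P *m q = q, P *m X = P /\ X *m P = X,
      Ph *m X^s = X *m P *m Ph *m X^s & X = P + w ^+ t.+1 *: y] /\
  y *m (1%:M + w *: (Ph *m y^s *m map_mx io a)) =
    w *: (map_mx io c0 *m map_mx io a) + w *: (map_mx io c1 *m y^s *m map_mx io a).
Proof.
move=> tK; have PP : P *m P = P by exact: proj_idem.
have sP : P^s = P by exact: map_proj.
have PsiP : Psi *m P = P *m Psi *m P.
  apply/matrixP => i j; rewrite -mulmxA proj_mull !proj_mulr /=.
  case: (leqP (s j)) => js; last by rewrite !mulr0.
  by case: leqP => ti; rewrite ?mul1r // Psi0 ?mul0r ?mulr0 //; exact: leq_ltn_trans ti.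
have [X [j [q [XE Xq [PX XP] frame [E EE]]]]] :=
  flag_frame unit1 PP sP ThTh' Th'Th ThE Th1 PsiP.
have [a [c0 [c1 [aE Pa c0E c1E]]]] := threshold_data tK.
have eK : (t.+1 <= K.+1)%N by apply: leq_trans (leq_addr _ _) tK.
have PP0 : P *m (1%:M - P) = 0 by rewrite mulmxBr mulmx1 PP subrr.
(* Of the divisibility of [X - P] by [w ^+ K.+1], only [w ^+ t.+1] is taken out. The compression by
   [1 - P] and [P] loses nothing because [P X = P] and [X P = X]. *)
pose y := w ^+ (K.+1 - t.+1) *: ((1%:M - P) *m E *m P).
have yP : y *m P = y by rewrite /y -scalemxAl -[(1%:M - P) *m E *m P *m P]mulmxA PP.
have Py : P *m y = 0 by rewrite /y -scalemxAr !mulmxA PP0 !mul0mx scaler0.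
have Xy : X = P + w ^+ t.+1 *: y.
  rewrite /y scalerA -exprD subnKC // scalemxAl scalemxAr -EE.
  rewrite mulmxBl mul1mx mulmxBr PX PP subrr subr0 mulmxBl XP PP.
  by rewrite addrC subrK.
exists X, j, q, y, a, c0, c1; split=> //.
apply: (@riccati _ _ sgh (sgh_w _ _) Ahat_tfree) Xy yP Py frame aE Pa c0E c1E => //.
Qed.

(** One letter per entry of each of two unknown matrices; the boolean tells which threshold the
    matrix belongs to. *)
Local Notation letter := (bool * ('I_d * 'I_d))%type.

(** Coefficients chosen so that evaluation of the letters at the twisted entries of y sums to
    [w M y^s N], which is how every unknown enters the equations. *)
Definition letter_mx b (M N : 'M[T]_d) (x : letter) : 'M[T]_d :=
  if x.1 == b then (pi%:A : T) *: (M *m delta_mx x.2.1 x.2.2 *m N) else 0.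

Local Notation th := (theta pr io).

Lemma theta_pi : th (pi%:A) = w.
Proof. by rewrite /theta /= !rmorph_alg. Qed.

Lemma map_theta_scale k m1 m2 (M : 'M[T]_(m1, m2)) :
  map_mx th ((pi%:A : T) ^+ k *: M) = w ^+ k *: map_mx th M.
Proof. by rewrite map_mxZ rmorphXn theta_pi. Qed.

Lemma map_letter_mx b (M N : 'M[T]_d) x : map_mx th (letter_mx b M N x) =
  if x.1 == b then w *: (map_mx th M *m delta_mx x.2.1 x.2.2 *m map_mx th N) else 0.
Proof.
rewrite /letter_mx; case: eqP => _; last by rewrite map_mx0.
by rewrite map_mxZ theta_pi !map_mxM map_delta_mx.
Qed.

Lemma sum_letter_mx (y : bool -> 'M[Ahat]_d) b M N :
  \sum_(x : letter) sgh (y x.1 x.2.1 x.2.2) *: map_mx th (letter_mx b M N x) =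
  w *: (map_mx th M *m (y b)^s *m map_mx th N).
Proof.
under eq_bigr => x _ do rewrite map_letter_mx.
rewrite -(pair_bigA _ (fun c ij => sgh (y c ij.1 ij.2) *: (if c == b then
  w *: (map_mx th M *m delta_mx ij.1 ij.2 *m map_mx th N) else 0))) /=.
rewrite (bigD1 b) //= [X in _ + X]big1 ?addr0 => [|c /negPf cb]; last first.
  by apply: big1 => ij _; rewrite cb scaler0.
rewrite eqxx -(pair_bigA _ (fun i j => sgh (y b i j) *:
  (w *: (map_mx th M *m delta_mx i j *m map_mx th N)))) /=.
rewrite [in RHS](matrix_sum_delta (y b)^s) mulmx_sumr mulmx_suml scaler_sumr.
apply: eq_bigr => i _; rewrite mulmx_sumr mulmx_suml scaler_sumr.
apply: eq_bigr => j _; rewrite mxE -scalemxAr -scalemxAl !scalerA.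
by rewrite mulrC.
Qed.

Lemma letter_mx_dvw b M N x : mdvw w 1 (map_mx th (letter_mx b M N x)).
Proof.
rewrite map_letter_mx; case: eqP => _; last exact: mdvw0.
by eexists; rewrite expr1.
Qed.

Lemma theta_rational_ev (y : bool -> 'M[Ahat]_d) C D L (Y : 'M[Ahat]_d) :
  (forall x, mdvw w 1 (map_mx th (D x))) -> (forall x, mdvw w 1 (map_mx th (L x))) ->
  Y *m (1%:M - \sum_(x : letter) sgh (y x.1 x.2.1 x.2.2) *: map_mx th (L x)) =
    map_mx th C + \sum_(x : letter) sgh (y x.1 x.2.1 x.2.2) *: map_mx th (D x) ->
  forall i j, sev w (sgh \o (fun x : letter => y x.1 x.2.1 x.2.2))
    (th \o (fun v => rational_series C D L v i j)) (Y i j).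
Proof.
move=> dD dL YE i j.
apply: eq_sev (rational_series_ev dD dL YE i j) => v.
have := congr1 (fun M : 'M_d => M i j) (rational_series_rmorph th C D L v).
by rewrite mxE => <-.
Qed.

Lemma dfil_letter_mx c b M N :
  (forall (x : letter) i j, dfil c 1 0 (pi *: (M *m delta_mx x.2.1 x.2.2 *m N) i j)) ->
  forall x i j, dfil c 1 0 (letter_mx b M N x i j).
Proof.
move=> H x i j; rewrite /letter_mx; case: eqP => _; last by rewrite mxE; exact: dfil0.
by rewrite mxE mulr_algl; exact: H.
Qed.

Theorem slope_series t rk (iota : 'I_rk -> 'I_d) (mx : 'M[Ahat]_rk) :
  (t.+2 + t.+2 <= K.+1)%N -> injective iota ->
  (forall j, (s j == t.+1) = (j \in codom iota)) ->
  (forall a b, mx a b = U (iota a) (iota b)) ->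
  exists (C : nat -> nucmat w) (cv : ord_to_infty C) (nu : nat -> int),
    [/\ forall r, nu r = 1 \/ nu r = -1,
        forall r, exists Cr : nidx (C r) -> nidx (C r) -> A,
          nuclear_overconvergent pr Cr /\ forall x y, C r x y = io (Cr x y)
      & finite_class w sgh mx = delta_series sgh nu cv].
Proof.
move=> tK iotaI iotaE mxE'.
have tK1 : (t.+1 + t.+1 <= K.+1)%N by apply: leq_trans tK; rewrite leq_add.
have tK2 : (t.+1 <= K.+1)%N by apply: leq_trans tK1; rewrite leq_addr.
(* The thresholds [t] and [t.+1] cut off the two steps around the piece of slope [t.+1]. *)
pose p1 := [pred j | (s j <= t)%N]; pose p2 := [pred j | (s j <= t.+1)%N].
have [P1 P1E] : exists P, P = proj Ahat p1 by eexists.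
have [P2 P2E] : exists P, P = proj Ahat p2 by eexists.
have [X1 [j1 [q1 [y1 [a1 [c01 [c11]]]]]]] := riccati_data tK1.
rewrite -[proj _ _]/(proj Ahat p1) -P1E.
move=> [[X1E [_ _] [P1X1 X1P1] _ X1y] y1E].
have [X2 [j2 [q2 [y2 [a2 [c02 [c12]]]]]]] := riccati_data tK.
rewrite -[proj _ _]/(proj Ahat p2) -P2E.
move=> [[X2E [X2q2 Pq2] [P2X2 X2P2] frame X2y] y2E].
have P11 : P1 *m P1 = P1 by rewrite P1E; exact: proj_idem.
have P22 : P2 *m P2 = P2 by rewrite P2E; exact: proj_idem.
have s1 : P1^s = P1 by rewrite P1E map_proj.
have s2 : P2^s = P2 by rewrite P2E map_proj.
have P12 : P1 *m P2 = P1.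
  rewrite P1E P2E projM; congr (proj _ _); apply/funext => j /=.
  by case: (leqP (s j) t) => //= h; rewrite leqW.
have P21 : P2 *m P1 = P1.
  rewrite P1E P2E projM; congr (proj _ _); apply/funext => j /=.
  by case: (leqP (s j) t) => //= h; rewrite ?andbF // leqW.
have PsiP1 : Psi *m P1 = P1 *m Psi *m P1.
  apply/matrixP => i j; rewrite P1E -mulmxA proj_mull !proj_mulr /=.
  case: (leqP (s j)) => js; last by rewrite !mulr0.
  by case: leqP => ti; rewrite ?mul1r // Psi0 ?mul0r ?mulr0 //; exact: leq_ltn_trans ti.
pose pr3 := [pred j | s j == t.+1].
have [RR RRE] : exists M, M = proj Ahat pr3 by eexists.
have RRP : RR = P2 - P1.
  apply/matrixP => i j; rewrite RRE P1E P2E !mxE /=; case: eqP => _ /=; last by rewrite subrr.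
  by case: (ltngtP (s i) t.+1) => h; rewrite ?ltnS ?subrr ?subr0 //;
    move: h; rewrite ?ltnS => h; rewrite ?h ?ltnn ?subrr ?subr0 // leqNgt ltnW ?subrr.
have RR2 : RR *m RR = RR by rewrite RRE proj_idem.
have RP1 : RR *m P1 = 0 by rewrite RRP mulmxBl P21 P11 subrr.
have RP2 : RR *m P2 = RR by rewrite RRP mulmxBl P22 P12.
have P2R : P2 *m RR = RR by rewrite RRP mulmxBr P22 P21.
have [c cE] : exists c, c = RR *m Th *m X2 *m RR by eexists.
have conj := graded_conjugate RRP cE P11 P22 P12 P21 s1 s2 ThTh' ThE PsiP1 X1E P1X1 X1P1
  X2E X2q2 P2X2 X2P2 frame Pq2.
have Rc : RR *m c = c by rewrite cE !mulmxA RR2.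
have cR : c *m RR = c by rewrite cE -!mulmxA RR2.
have c1 : mdvw w 1 (c - RR).
  have -> : c - RR = RR *m ((Th - 1%:M) *m X2 + (X2 - P2)) *m RR.
    rewrite cE mulmxBl mul1mx addrA subrK mulmxBr RP2 mulmxBl RR2.
    by rewrite !mulmxA.
  apply: mdvwMr; apply: mdvwMl; apply: mdvwD.
    by apply: mdvwMr; apply: mdvw_le Th1.
  by rewrite X2y addrC addKr; exists (w ^+ t.+1 *: y2); rewrite scalerA -exprD.
have [c' [Rc' c'R cc' c'c]] := corner_inverse unit1 RR2 Rc cR c1.
have RPsiR : RR *m Psi *m RR = w ^+ t.+1 *: (RR *m U *m RR).
  apply/matrixP => i j; rewrite RRE [RHS]mxE !proj_mulr !proj_mull /=.
  case: (s i =P _) => si; last by rewrite !mul0r mulr0.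
  case: (s j =P _) => sj; last by rewrite !mulr0.
  by rewrite !mul1r !mulr1 PsiU ?sj.
pose rho0 := c' *m (RR *m U *m RR) *m c^s.
have [v1 v1E] : exists v1 : 'M[A]_d, RR *m Ph *m RR = w ^+ t.+1 *: (RR *m map_mx io v1 *m RR).
  have RAE : map_mx io (proj A pr3) = RR by rewrite RRE map_proj.
  have [|v1 h] := @io_mdvw _ _ _ _ _ io_compl _ _ t.+1 (proj A pr3 *m Phi *m proj A pr3).
    rewrite !map_mxM RAE RRE; apply/mdvwP => i j; rewrite proj_mulr proj_mull /=.
    case: (s j =P _) => sj; last by rewrite mulr0; exact: dvw0.
    by apply: dvwMr; apply: dvwMl; apply: Phi_dvw; rewrite ?sj.
  exists v1; have := congr1 (map_mx io) h; rewrite !map_mxM RAE map_io_scale => e.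
  have <- : RR *m (RR *m Ph *m RR) *m RR = RR *m Ph *m RR.
    by rewrite !mulmxA RR2 -[_ *m RR *m RR]mulmxA RR2.
  by rewrite e -scalemxAr -scalemxAl.
(* The right factor of [conj] divided by [w ^+ t.+1], after inserting [X1 = P1 + w ^+ t.+1 y1] and
   [X2 = P2 + w ^+ t.+2 y2]. *)
pose expr := map_mx io v1 + w *: (Ph *m y2^s) - y1 *m (Ph + w ^+ t.+2 *: (Ph *m y2^s)).
have rhoE : rho0 = RR *m expr *m RR.
  apply: (@scale_w_inj _ w Ahat_tfree t.+1) => /=.
  have -> : w ^+ t.+1 *: rho0 = (RR - RR *m X1) *m Ph *m X2^s *m RR.
    have := congr1 (mulmx c') conj; rewrite mulmxA c'c => e.
    have -> : w ^+ t.+1 *: rho0 = c' *m (RR *m Psi *m RR) *m c^s.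
      by rewrite RPsiR -scalemxAr -scalemxAl.
    by rewrite -mulmxA -e !mulmxA mulmxBr !mulmxA RR2.
  have -> : RR - RR *m X1 = RR - w ^+ t.+1 *: (RR *m y1).
    by rewrite X1y mulmxDr RP1 add0r -scalemxAr.
  have QE : Ph *m X2^s *m RR = (Ph + w ^+ t.+2 *: (Ph *m y2^s)) *m RR.
    rewrite X2y map_mxD (map_scale_w (sgh_w _ _)) s2 mulmxDr !mulmxDl -[_ *m P2 *m RR]mulmxA P2R.
    by rewrite -scalemxAr.
  have [Q Q_E] : exists Q, Q = Ph + w ^+ t.+2 *: (Ph *m y2^s) by eexists.
  rewrite -!mulmxA [Ph *m _]mulmxA QE /expr -Q_E.
  rewrite mulmxBl -scalemxAl [in RHS]mulmxBl mulmxBr scalerBr; congr (_ - _); last first.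
    by rewrite !mulmxA.
  rewrite [in RHS]mulmxDl [in RHS]mulmxDr scalerDr [RR *m (map_mx io v1 *m _)]mulmxA -v1E.
  rewrite Q_E mulmxDl mulmxDr !mulmxA; congr (_ + _).
  by rewrite -2!scalemxAr -2!scalemxAl scalerA -exprSr.
have pr3I e : pr3 (iota e) by rewrite /= iotaE codom_f.
have rhoI a b : rho0 (iota a) (iota b) = expr (iota a) (iota b).
  by rewrite rhoE RRE proj_mulr proj_mull !pr3I mul1r mulr1.
(* The block cut out by [iota]; it is multiplicative across [RR], which projects onto exactly these
   coordinates. *)
pose r (M : 'M[Ahat]_d) : 'M[Ahat]_rk := \matrix_(a, b) M (iota a) (iota b).
have rM M N : r (M *m RR *m N) = r M *m r N.
  apply/matrixP => a b; rewrite !mxE.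
  transitivity (\sum_(j <- codom iota) (M *m RR) (iota a) j * N j (iota b)).
    have uI : injectiveb iota by exact/injectiveP.
    rewrite (big_uniq _ uI) /=.
    rewrite [RHS]big_mkcond; apply: eq_bigr => j _; case: ifP => // jI.
    by rewrite RRE proj_mulr /= iotaE jI mulr0 mul0r.
  rewrite /codom /image_mem big_map big_enum /=; apply: eq_bigr => e _.
  by rewrite [r M a e]mxE [r N e b]mxE RRE proj_mulr pr3I mulr1.
have rR : r RR = 1%:M.
  by apply/matrixP => a b; rewrite RRE !mxE pr3I andbT (inj_eq iotaI).
have rs M : (r M)^s = r (M^s) by apply/matrixP => a b; rewrite !mxE.
have -> : finite_class w sgh mx = finite_class w sgh (r rho0).
  apply: (@cls_sim_fin _ _ _ _ _ _ (r c) (r c')).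
  - by rewrite -rM cR cc' rR.
  - by rewrite -rM c'R c'c rR.
  - have -> : mx = r U by apply/matrixP => a b; rewrite mxE.
    by rewrite rs -!rM /rho0 !mulmxA.
have lift (M : 'M[A]_d) : exists M' : 'M[T]_d, map_mx th M' = map_mx io M.
  have [f fE] := choice pr_surj; exists (map_mx f M).
  by apply/matrixP => i j; rewrite !mxE /theta /= fE.
pose y (b : bool) := if b then y2 else y1.
have [Ph' PhE] := lift Phi; have [v1' v1E'] := lift v1.
have [a1' a1E] := lift a1; have [a2' a2E] := lift a2.
have [c01' c01E] := lift c01; have [c11' c11E] := lift c11.
have [c02' c02E] := lift c02; have [c12' c12E] := lift c12.
pose a' (b : bool) := if b then a2' else a1'.
pose c0' (b : bool) := if b then c02' else c01'.
pose c1' (b : bool) := if b then c12' else c11'.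
have yE b : y b *m (1%:M + w *: (Ph *m (y b)^s *m map_mx th (a' b))) =
    w *: (map_mx th (c0' b) *m map_mx th (a' b)) +
    w *: (map_mx th (c1' b) *m (y b)^s *m map_mx th (a' b)).
  by case: b; rewrite /y /a' /c0' /c1' ?a1E ?a2E ?c01E ?c11E ?c02E ?c12E.
pose delta (x : letter) : 'M[T]_d := delta_mx x.2.1 x.2.2.
(* All entries whose degree bounds matter: entries 0 to 2 give the coefficients of [Fm], entries 3
   to 6 those of [lin1] and [lin2]. *)
pose fam (ijx : 'I_7 * bool * letter * 'I_d * 'I_d) : T :=
  let: (k, b, x, i, j) := ijx in
  nth 0 [:: c0' b *m a' b; c1' b *m delta x *m a' b; Ph' *m delta x *m a' b; v1'; Ph';
    Ph' *m delta x *m 1%:M; (pi%:A : T) ^+ t.+1 *: Ph' *m delta x *m 1%:M] k i j.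
have [c_ [m_ famE]] := dfil_family fam.
have famP k (k7 : (k < 7)%N) b x i j := famE (Ordinal k7, b, x, i, j).
(* The Riccati equation solved for y: its right-hand side times the inverse of [1 + w Ph y^s a], the
   letters of the denominator being negated as [rational_series] inverts 1 minus their sum. *)
pose Fm b := rational_series ((pi%:A : T) *: (c0' b *m a' b))
  (letter_mx b (c1' b) (a' b)) (fun x => - letter_mx b Ph' (a' b) x).
pose lin1 := rational_series v1' (letter_mx true Ph' 1%:M) (fun=> 0).
pose lin2 := rational_series Ph' (letter_mx true ((pi%:A : T) ^+ t.+1 *: Ph') 1%:M) (fun=> 0).
pose s0 (x : letter) := y x.1 x.2.1 x.2.2.
pose F (x : letter) v := Fm x.1 v x.2.1 x.2.2.
(* In [expr] the matrix [y1] also occurs without twist; it is replaced by its own series, whose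
   value at the twisted point is [y1] again. *)
pose G (a b : 'I_rk) v := lin1 v (iota a) (iota b) -
  \sum_mu smul (fun v => Fm false v (iota a) mu) (fun v => lin2 v mu (iota b)) v.
(* Every coefficient of [Fm], even the constant one, carries a factor [pi] and so has offset 0; the
   series of [G] may keep the offset [m_]. *)
have dFm b v i j : dfil c_ (size v) 0 (Fm b v i j).
  apply: dfil_rational_series => [k l|x k l|x k l].
  - rewrite mxE mulr_algl; apply: dfil_le (famP 0%N isT b (b, (k, k)) k l).2 => //.
  - by apply: dfil_letter_mx => x' k' l'; exact: (famP 1%N isT b x' k' l').2.
  - rewrite mxE; apply: dfilN; apply: dfil_letter_mx => x' k' l'.
    exact: (famP 2%N isT b x' k' l').2.
have dlin1 v i j : dfil c_ (size v) m_ (lin1 v i j).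
  apply: dfil_rational_series => [k l|x k l|x k l]; last by rewrite mxE; exact: dfil0.
  - exact: (famP 3%N isT true (true, (k, k)) k l).1.
  - apply: (@dfil_le _ _ _ c_ _ 1 _ 0) => //; apply: dfil_letter_mx => x' k' l'.
    exact: (famP 5%N isT true x' k' l').2.
have dlin2 v i j : dfil c_ (size v) m_ (lin2 v i j).
  apply: dfil_rational_series => [k l|x k l|x k l]; last by rewrite mxE; exact: dfil0.
  - exact: (famP 4%N isT true (true, (k, k)) k l).1.
  - apply: (@dfil_le _ _ _ c_ _ 1 _ 0) => //; apply: dfil_letter_mx => x' k' l'.
    exact: (famP 6%N isT true x' k' l').2.
have dLN b x : mdvw w 1 (map_mx th (- letter_mx b Ph' (a' b) x)).
  by rewrite map_mxN; apply: mdvwN; exact: letter_mx_dvw.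
have eFm b i j : sev w (sgh \o s0) (th \o (fun v => Fm b v i j)) (y b i j).
  apply: (@theta_rational_ev y) => // [x|]; first exact: letter_mx_dvw.
  under eq_bigr => x _ do rewrite map_mxN scalerN.
  rewrite sumrN opprK !sum_letter_mx PhE yE map_mxZ theta_pi map_mxM.
  by [].
have d0 (x : letter) : mdvw w 1 (map_mx th (0 : 'M_d)) by rewrite map_mx0; exact: mdvw0.
have lin_ev C M i j : sev w (sgh \o s0)
    (th \o (fun v => rational_series C (letter_mx true M 1%:M) (fun=> 0) v i j))
    ((map_mx th C + w *: (map_mx th M *m y2^s)) i j).
  apply: (@theta_rational_ev y) => // [x|]; first exact: letter_mx_dvw.
  rewrite big1 => [|x _]; last by rewrite map_mx0 scaler0.
  by rewrite subr0 mulmx1 sum_letter_mx map_mx1 mulmx1.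
apply: (@overconvergent_fixed_point _ _ _ _ _ _ _ _ pi0 io_compl _ F s0 c_ m_ _ G).
- by move=> x v; apply: dFm.
- move=> a b v; apply: dfilD; first exact: dlin1.
  apply: dfilN; apply: dfil_sum => mu _.
  apply: (@dfil_smul _ _ _ _ _ _ (fun v => Fm false v (iota a) mu)
    (fun v => lin2 v mu (iota b))) => u; [exact: dFm|exact: dlin2].
- by move=> x; apply: eFm.
- move=> a b; rewrite mxE rhoI.
  have -> : expr (iota a) (iota b) = (map_mx th v1' + w *: (map_mx th Ph' *m y2^s)) (iota a) (iota b)
     + - \sum_mu y1 (iota a) mu * (map_mx th Ph' + w *: (map_mx th ((pi%:A : T) ^+ t.+1 *: Ph') *m y2^s)) mu (iota b).
    rewrite map_theta_scale v1E' PhE -scalemxAl scalerA -exprS /expr.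
    by rewrite [LHS]mxE; congr (_ + _); rewrite [LHS]mxE [X in - X]mxE.
  apply: (@eq_sev _ _ _ _ (fun v => th (lin1 v (iota a) (iota b)) +
      - \sum_mu smul (th \o (fun v => Fm false v (iota a) mu))
         (th \o (fun v => lin2 v mu (iota b))) v)).
    move=> v; rewrite -[RHS]/(th (G a b v)) (rmorphB th) (rmorph_sum th).
    congr (_ - _); apply: eq_bigr => mu _.
    by rewrite (smul_rmorph th).
  apply: sevD; first exact: lin_ev.
  apply: sevN; apply: sev_sum => mu; apply: sev_mul.
  + by move=> v; apply: theta_dfil (dFm _ _ _ _).
  + exact: (eFm false).
  + exact: lin_ev.
Qed.

End SlopeData.

(** * Approximation of the adapted basis and rescaling *)

Section Rescaling.
Variables (R : idomainType) (pi : R) (n : nat) (A Ahat : comAlgType R)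
  (pr : {lrmorphism dagger n pi -> A}) (io : {lrmorphism A -> Ahat})
  (sg : {lrmorphism A -> A}) (sgh : {lrmorphism Ahat -> Ahat}).
Hypotheses (pi0 : pi != 0) (io_compl : pi_completion pi io).
Hypothesis pr_surj : forall a, exists x, pr x = a.
Hypothesis A_unit : forall x : A, exists z, (1 + pi%:A * x) * z = 1.
Local Notation w := (pi%:A : Ahat).
Hypothesis Ahat_tfree : forall x : Ahat, w * x = 0 -> x = 0.
Hypothesis sgh_io : forall a, sgh (io a) = io (sg a).
Local Notation "M ^s" := (map_mx sgh M) (at level 2, format "M ^s").

Variables (m d : nat) (lv : 'I_d -> nat).
Hypothesis lvm : forall i, (lv i < m)%N.

(** Conjugation by [D] multiplies the entry (i, j) by the power [N * (lv j - lv i)] of [w]. Above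
    the diagonal this gains at least [N]; below it at most [N * m] is lost, whence the precision
    [N * m + N]. The extra factor [w] shifts all slopes by one. *)
Lemma upper_rescaling (N k : nat) (Phi1 : 'M[A]_d) (Th0 Psi0 : 'M[Ahat]_d) :
  (k <= N)%N ->
  Th0 *m map_mx io Phi1 = Psi0 *m Th0^s -> mdvw w (N * m + N) (Th0 - 1%:M) ->
  (forall i j, (lv j < lv i)%N -> Psi0 i j = 0) ->
  exists (Phi : 'M[A]_d) (Th Psi : 'M[Ahat]_d),
  [/\ Th *m map_mx io Phi = Psi *m Th^s, mdvw w k (Th - 1%:M),
      forall i j, (lv j < lv i)%N -> Psi i j = 0,
      forall i j, lv i = lv j -> Psi i j = w * Psi0 i j
    & forall i j, (lv i < lv j)%N -> dvw w k (Psi i j)].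
Proof.
move=> kN ThE [E EE] Psi00.
pose D : 'M[Ahat]_d := \matrix_(i, j) ((i == j)%:R * w ^+ (N * lv i)).
have D_l (M : 'M[Ahat]_d) i j : (D *m M) i j = w ^+ (N * lv i) * M i j.
  rewrite mxE (bigD1 i) //= big1 ?addr0 => [|l /negPf li]; first by rewrite mxE eqxx mul1r.
  by rewrite mxE eq_sym li !mul0r.
have D_r (M : 'M[Ahat]_d) i j : (M *m D) i j = M i j * w ^+ (N * lv j).
  rewrite mxE (bigD1 j) //= big1 ?addr0 => [|l /negPf lj]; first by rewrite mxE eqxx mul1r.
  by rewrite mxE lj mul0r mulr0.
have D_inj (M M' : 'M[Ahat]_d) : D *m M = D *m M' -> M = M'.
  move=> /matrixP e; apply/matrixP => i j.
  have /(_ (N * lv i)) H := @scale_w_inj _ w Ahat_tfree _ 1 1.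
  have := H ((M i j)%:M) ((M' i j)%:M); rewrite /= !scale_scalar_mx.
  have := e i j; rewrite !D_l => -> /(_ erefl) /matrixP/(_ 0 0).
  by rewrite !mxE !mulr1n.
have sD : D^s = D.
  by apply/matrixP => i j; rewrite !mxE rmorphM rmorph_nat rmorphXn /= rmorph_alg.
have Nlv i : (N * lv i <= N * m)%N by rewrite leq_mul2l ltnW ?orbT.
pose Th : 'M[Ahat]_d := 1%:M +
  \matrix_(i, j) (w ^+ (N * m + N + N * lv j - N * lv i) * E i j).
have DTh : D *m Th = Th0 *m D.
  have -> : Th0 = 1%:M + w ^+ (N * m + N) *: E by rewrite -EE addrC subrK.
  rewrite mulmxDr mulmxDl mulmx1 mul1mx; congr (_ + _); apply/matrixP => i j.
  rewrite D_l D_r !mxE mulrA -exprD [RHS]mulrAC -exprD; congr (w ^+ _ * _).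
  by have := Nlv i; lia.
have Phi1E : mdvw w (N * m + N) (map_mx io Phi1 - Psi0).
  have -> : map_mx io Phi1 - Psi0 = Psi0 *m (Th0^s - 1%:M) - (Th0 - 1%:M) *m map_mx io Phi1.
    by rewrite mulmxBr mulmx1 mulmxBl mul1mx ThE opprB [RHS]addrC addrA subrK.
  apply: mdvwB; last by apply: mdvwMr; exists E.
  apply: mdvwMl; exists (E^s).
  have -> : Th0^s - 1%:M = (Th0 - 1%:M)^s by rewrite map_mxB map_mx1.
  by rewrite EE map_mxZ rmorphXn /= rmorph_alg.
pose Psi : 'M[Ahat]_d := \matrix_(i, j)
  (if (lv i <= lv j)%N then w ^+ (N * (lv j - lv i)).+1 * Psi0 i j else 0).
have DPsi : D *m Psi = w *: (Psi0 *m D).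
  apply/matrixP => i j; rewrite D_l [RHS]mxE D_r mxE.
  case: leqP => ij; last by rewrite Psi00 // mul0r !mulr0.
  rewrite mulrA -exprD addnS exprS -mulrA; congr (_ * _); rewrite mulrC; congr (_ * w ^+ _).
  by rewrite -mulnDr subnKC.
(* For [lv i <= lv j] the conjugating power is non-negative; for the other entries [Psi0] vanishes,
   so [Phi1] is small enough to be divided over [A]. *)
have /choice[f fE] : forall ij : 'I_d * 'I_d, exists y,
    w ^+ (N * lv ij.1) * io y = w * (io (Phi1 ij.1 ij.2) * w ^+ (N * lv ij.2)).
  move=> [i j] /=; have [ij|ij] := leqP (lv i) (lv j).
    exists ((pi%:A) ^+ (N * (lv j - lv i)).+1 * Phi1 i j); rewrite io_scale mulrA -exprD addnS exprS.
    rewrite -mulrA; congr (_ * _); rewrite mulrC; congr (_ * w ^+ _).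
    by rewrite -mulnDr subnKC.
  have [y yE] : dvw (pi%:A : A) (N * lv i) (Phi1 i j).
    apply: (io_dvw io_compl); have /mdvwP/(_ i j) := Phi1E; rewrite !mxE Psi00 // subr0.
    by apply: dvw_le; have := Nlv i; lia.
  exists ((pi%:A) ^+ (N * lv j).+1 * y); rewrite yE !io_scale exprS.
  rewrite -[w * w ^+ _ * _]mulrA mulrCA; congr (w * _).
  by rewrite -mulrA; congr (_ * _); exact: mulrC.
pose Phi : 'M[A]_d := \matrix_(i, j) f (i, j).
have DPhi : D *m map_mx io Phi = w *: (map_mx io Phi1 *m D).
  by apply/matrixP => i j; rewrite D_l [RHS]mxE D_r !mxE (fE (i, j)).
exists Phi, Th, Psi; split.
- apply: D_inj; rewrite !mulmxA DTh DPsi -mulmxA DPhi -scalemxAr -scalemxAl mulmxA ThE.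
  by rewrite -!mulmxA -{1}sD -map_mxM -DTh map_mxM sD.
- rewrite addrC addKr; apply/mdvwP => i j; rewrite mxE; apply: dvwMr.
  rewrite -[_ ^+ _]mulr1; apply: dvw_le (dvw_exp _ _ _).
  by have := Nlv i; lia.
- by move=> i j ij; rewrite mxE leqNgt ij.
- by move=> i j ij; rewrite mxE ij leqnn subnn muln0 expr1.
- move=> i j ij; rewrite mxE (ltnW ij); apply: dvwMr.
  rewrite -[_ ^+ _]mulr1; apply: dvw_le (dvw_exp _ _ _).
  by apply: leq_trans kN _; rewrite leqW // leq_pmulr // subn_gt0.
Qed.

(** [S] passes from an overconvergent basis to an adapted one, but only over [Ahat]. With an
    approximation [T] over [A], the matrix [Phi1] of the map in the basis [T] stays overconvergent,
    and [Th0 = S' T], close to 1, compares it with the adapted basis. *)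
Theorem ordinary_matrix_series n0 (S : 'M[Ahat]_(n0, d)) (S' : 'M[Ahat]_(d, n0))
    (Phi0 : 'M[A]_n0) (Psi0 U V : 'M[Ahat]_d) t rk (iota : 'I_rk -> 'I_d)
    (mx : 'M[Ahat]_rk) :
  S *m S' = 1%:M -> S' *m S = 1%:M -> map_mx io Phi0 *m S^s = S *m Psi0 ->
  (forall i j, (lv j < lv i)%N -> Psi0 i j = 0) ->
  (forall i j, lv i = lv j -> Psi0 i j = w ^+ lv j * U i j) ->
  (forall i j, lv i != lv j -> U i j = 0) -> U *m V = 1%:M ->
  injective iota -> (forall j, (lv j == t) = (j \in codom iota)) ->
  (forall a b, mx a b = U (iota a) (iota b)) ->
  exists (C : nat -> nucmat w) (cv : ord_to_infty C) (nu : nat -> int),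
    [/\ forall r, nu r = 1 \/ nu r = -1,
        forall r, exists Cr : nidx (C r) -> nidx (C r) -> A,
          nuclear_overconvergent pr Cr /\ forall x y, C r x y = io (Cr x y)
      & finite_class w sgh mx = delta_series sgh nu cv].
Proof.
move=> SS' S'S PhiS Psi00 PsiU U0 UV iotaI iotaE mxE'.
have unit1 := complete_unit (Ahat_sepw io_compl) (Ahat_complw io_compl).
(* [K] meets the demand of the upper threshold [t.+1]; [b] is the precision spent by the
   rescaling. *)
pose K := (t.+2 + t.+2)%N; pose N := K.+1; pose b := (N * m + N)%N.
have [T [E TE]] := io_approx io_compl b S.
have b1 : (1 <= b)%N by rewrite /b /N addnS.
pose Th0 := S' *m map_mx io T.
have Th0E : mdvw w b (Th0 - 1%:M).
  by rewrite -S'S /Th0 -mulmxBr TE; apply: mdvwMl; exists E.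
have [J [J1 J2]] := invertible_1D unit1 (mdvw_le b1 Th0E).
have TJ : map_mx io T *m (J *m S') = w ^+ 0 *: 1%:M.
  rewrite scale1r mulmxA -SS'; congr (_ *m _).
  by rewrite -[LHS]mul1mx -SS' -mulmxA [S' *m _]mulmxA J1 mulmx1.
have [T' TT'] := right_inverse_descent io_compl A_unit TJ.
rewrite scale1r in TT'.
pose Phi1 := T' *m Phi0 *m map_mx sg T.
have sgio : map_mx io (map_mx sg T) = (map_mx io T)^s.
  by apply/matrixP => i j; rewrite !mxE sgh_io.
have Th0Phi : Th0 *m map_mx io Phi1 = Psi0 *m Th0^s.
  rewrite /Th0 /Phi1 map_mxM map_mxM sgio !mulmxA -[S' *m _ *m _]mulmxA -map_mxM TT'.
  rewrite map_mx1 mulmx1 [in RHS]map_mxM !mulmxA; congr (_ *m _).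
  rewrite -[LHS]mulmx1 -(map_mx1 sgh) -SS' map_mxM mulmxA -[S' *m _ *m _]mulmxA PhiS.
  by rewrite !mulmxA S'S mul1mx.
have [Phi [Th [Psi [ThE Th1 PsiL PsiD PsiK]]]] :=
  upper_rescaling (leqnn N) Th0Phi Th0E Psi00.
have [Th' [ThTh' Th'Th]] := invertible_1D unit1 (mdvw_le (isT : (1 <= N)%N) Th1).
(* With slopes [(lv i).+1], the lowest piece also lies above a threshold. *)
apply: (@slope_series _ _ _ _ _ pr io sgh pi0 io_compl pr_surj A_unit Ahat_tfree d
  (fun i => (lv i).+1) Phi Th Th' Psi U V K ThTh' Th'Th ThE Th1 _ _ _ _ UV t rk iota mx) => //.
by move=> i j [ij]; rewrite PsiD // PsiU // mulrA -exprS.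
Qed.

End Rescaling.

(** * Bases, unit roots and base change *)

Section Bases.
Variables (B : comNzRingType) (V : lmodType B).

Lemma is_basis_span r (e : 'I_r -> V) v : is_basis e -> exists c : 'I_r -> B, v = \sum_i c i *: e i.
Proof. by move=> /(_ v)[c [-> _]]; exists c. Qed.

Lemma is_basis_free r (e : 'I_r -> V) (c c' : 'I_r -> B) : is_basis e ->
  \sum_i c i *: e i = \sum_i c' i *: e i -> c =1 c'.
Proof.
move=> /(_ (\sum_i c i *: e i))[a [_ u]] cc'.
have h (f : 'I_r -> B) : \sum_i c i *: e i = \sum_i f i *: e i -> a = finfun f.
  by move=> E; apply: u; rewrite E; apply: eq_bigr => i _; rewrite ffunE.
have := h c erefl; rewrite (h c' cc') => /ffunP e' i.
by have := e' i; rewrite !ffunE.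
Qed.

Lemma is_basis_intro r (e : 'I_r -> V) :
  (forall v, exists c : 'I_r -> B, v = \sum_i c i *: e i) ->
  (forall c : 'I_r -> B, \sum_i c i *: e i = 0 -> forall i, c i = 0) -> is_basis e.
Proof.
move=> sp fr v; have [c cE] := sp v; exists [ffun i => c i]; split.
  by rewrite {1}cE; apply: eq_bigr => i _; rewrite ffunE.
move=> c' c'E; apply/ffunP => i; rewrite ffunE; apply/eqP; rewrite -subr_eq0; apply/eqP.
apply: (fr (fun i => c i - c' i)); under eq_bigr => j _ do rewrite scalerBl.
by rewrite sumrB -cE -c'E subrr.
Qed.

Lemma basis_matrix r d (e : 'I_r -> V) (v : 'I_d -> V) : is_basis e ->
  exists S : 'M[B]_(r, d), forall j, v j = \sum_i S i j *: e i.
Proof.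
move=> eb; have /choice[c cE] : forall j, exists c : 'I_r -> B, v j = \sum_i c i *: e i.
  by move=> j; apply: is_basis_span.
exists (\matrix_(i, j) c j i) => j; rewrite {1}cE.
by apply: eq_bigr => i _; rewrite mxE.
Qed.

Lemma basis_change_inv r d (e : 'I_r -> V) (v : 'I_d -> V) (S : 'M[B]_(r, d))
    (S' : 'M[B]_(d, r)) :
  is_basis e -> (forall j, v j = \sum_i S i j *: e i) ->
  (forall j, e j = \sum_i S' i j *: v i) -> S *m S' = 1%:M.
Proof.
move=> eb vE eE; apply/matrixP => i j; rewrite mxE.
apply: (is_basis_free (c := fun i => \sum_k S i k * S' k j) (c' := fun i => (1%:M : 'M[B]_r) i j) eb).
rewrite [RHS](bigD1 j) //= [X in _ = _ + X]big1 ?addr0 => [|k /negPf kj].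
  rewrite mxE eqxx scale1r eE; under [RHS]eq_bigr => k _ do rewrite vE scaler_sumr.
  rewrite exchange_big; apply: eq_bigr => k _ /=; rewrite scaler_suml.
  by apply: eq_bigr => l _; rewrite scalerA mulrC.
by rewrite mxE kj scale0r.
Qed.

(** By surjectivity of the linearization the images of the basis span; the coefficients expressing
    the basis through them form a right inverse. *)
Lemma unit_root_right_inverse (sg : B -> B) (psi : V -> V) r (e : 'I_r -> V) (u : 'M[B]_r) :
  is_basis e -> sigma_module sg psi -> unit_root sg psi -> matrix_of psi e u ->
  exists v : 'M[B]_r, u *m v = 1%:M.
Proof.
move=> eb [_ [psiD psiZ]] [surj _] uE.
have psi0 : psi 0 = 0 by apply: (addrI (psi 0)); rewrite -psiD !addr0.
have psiE x : exists c : 'I_r -> B, psi x = \sum_i c i *: psi (e i).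
  have [c ->] := is_basis_span x eb; exists (sg \o c).
  elim/big_ind2: _ => [|a b c' d' ab cd|i _]; [exact: psi0| |exact: psiZ].
  by rewrite psiD ab cd.
have /choice[v vE] : forall j, exists c : 'I_r -> B, e j = \sum_i c i *: psi (e i).
  move=> j; have [s ->] := surj (e j); elim: s => [|x s [c cE]].
    by exists (fun=> 0); rewrite big_nil big1 // => i _; rewrite scale0r.
  have [c' c'E] := psiE x.2; exists (fun i => x.1 * c' i + c i).
  rewrite big_cons cE c'E scaler_sumr -big_split; apply: eq_bigr => i _ /=.
  by rewrite scalerDl scalerA.
exists (\matrix_(i, j) v j i); apply: (basis_change_inv eb uE) => j.
by rewrite {1}vE; apply: eq_bigr => i _; rewrite mxE.
Qed.

End Bases.

Section BaseChange.
Variables (A B : comNzRingType) (io : {rmorphism A -> B}) (M0 : lmodType A) (M : lmodType B).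

Lemma basis_base_change (h : M0 -> M) r (e : 'I_r -> M0) :
  (forall u v, h (u + v) = h u + h v) -> (forall a u, h (a *: u) = io a *: h u) ->
  linearization_bij io h -> is_basis e -> is_basis (h \o e).
Proof.
move=> hD hZ [surj inj] eb.
have h0 : h 0 = 0 by apply: (addrI (h 0)); rewrite -hD !addr0.
have hE (c : 'I_r -> A) : h (\sum_i c i *: e i) = \sum_i io (c i) *: h (e i).
  elim/big_ind2: _ => [|a b c' d' ab cd|i _]; [exact: h0| |exact: hZ].
  by rewrite hD ab cd.
apply: is_basis_intro => [v|c c0 i].
  have [s ->] := surj v; elim: s => [|x s [c cE]].
    by exists (fun=> 0); rewrite big_nil big1 // => i _; rewrite scale0r.
  have [c' c'E] := is_basis_span x.2 eb; exists (fun i => x.1 * io (c' i) + c i).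
  rewrite big_cons cE {1}c'E hE scaler_sumr -big_split; apply: eq_bigr => i _ /=.
  by rewrite scalerDl scalerA.
have /choice[k kE] : forall u, exists c : 'I_r -> A, u = \sum_i c i *: e i.
  by move=> u; apply: is_basis_span.
have := inj [seq (c i, e i) | i <- index_enum 'I_r].
rewrite big_map => /(_ c0).
(* The vanishing tensor is tested on the balanced map that extracts the [i]-th coordinate. *)
move=> /(_ B (fun a u => a * io (k u i))); rewrite big_map /=.
have kD u u' : k (u + u') i = k u i + k u' i.
  have := is_basis_free (c := k (u + u')) (c' := fun i => k u i + k u' i) eb; apply.
  under [RHS]eq_bigr => j _ do rewrite scalerDl.
  by rewrite big_split /= -!kE.
have kZ a u : k (a *: u) i = a * k u i.
  have := is_basis_free (c := k (a *: u)) (c' := fun i => a * k u i) eb; apply.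
  under [RHS]eq_bigr => j _ do rewrite -scalerA.
  by rewrite -scaler_sumr -!kE.
have ke j : k (e j) i = (i == j)%:R.
  have := is_basis_free (c := k (e j)) (c' := fun i => (i == j)%:R) eb; apply.
  rewrite -kE (bigD1 j) //= big1 ?addr0 => [|l /negPf ->]; last by rewrite scale0r.
  by rewrite eqxx scale1r.
move=> H; have := H _ _ _; rewrite (bigD1 i) //= big1 => [|j /negPf ji].
  rewrite ke eqxx rmorph1 mulr1 addr0; apply.
  - by move=> a a' u; rewrite mulrDl.
  - by move=> a u u'; rewrite kD rmorphD mulrDr.
  - by move=> a b u; rewrite kZ rmorphM mulrA.
by rewrite ke eq_sym ji rmorph0 mulr0.
Qed.

End BaseChange.

(** * Indices by level and position *)

Section GradedIndex.
Variables (m : nat) (r : nat -> nat).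
Definition gidx : finType := {l : 'I_m & 'I_(r l)}.
Definition glevel (i : 'I_#|gidx|) : nat := tag (enum_val i).
Definition gpos (i : 'I_#|gidx|) : nat := tagged (enum_val i).

Lemma glevel_lt i : (glevel i < m)%N. Proof. exact: ltn_ord. Qed.
Lemma gpos_lt i : (gpos i < r (glevel i))%N. Proof. exact: ltn_ord. Qed.

Lemma gidx_inj i j : glevel i = glevel j -> gpos i = gpos j -> i = j.
Proof.
rewrite /glevel /gpos => e1 e2; apply: enum_val_inj.
case: (enum_val i) e1 e2 => [l b]; case: (enum_val j) => [l' b'] /= /val_inj e.
by subst l' => /val_inj ->.
Qed.

Lemma gidx_sum (W : nmodType) (f : nat -> nat -> W) :
  \sum_i f (glevel i) (gpos i) = \sum_(l < m) \sum_(b < r l) f l b.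
Proof.
rewrite (sig_big_dep _ _ (fun (l : 'I_m) (b : 'I_(r l)) => f l b)) /=.
by rewrite (big_enum_val (A := predT) (fun x : gidx => f (tag x) (tagged x))).
Qed.

Lemma gidx_sum_level (W : nmodType) l (f : nat -> W) : (l < m)%N ->
  \sum_i (if glevel i == l then f (gpos i) else 0) = \sum_(b < r l) f b.
Proof.
move=> lm; rewrite (gidx_sum (fun l' b => if l' == l then f b else 0)).
rewrite (bigD1 (Ordinal lm)) //= [X in _ + X]big1 ?addr0 => [|l' ll'].
  by apply: eq_bigr => b _; rewrite eqxx.
by rewrite big1 // => b _; case: eqP => // e; case/eqP: ll'; apply: val_inj.
Qed.

End GradedIndex.

(** * Bases adapted to the filtration *)

Section AdaptedBasis.
Variables (B : comNzRingType) (sg : {rmorphism B -> B}) (w : B) (M : lmodType B)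
  (phi : M -> M) (F : nat -> {pred M}) (U : nat -> lmodType B) (gr : forall l, M -> U l)
  (psi : forall l, U l -> U l).
Hypothesis M_ordinary : ordinary_filtration sg w phi F gr psi.
Variables (r : nat -> nat) (b : forall l, 'I_(r l) -> U l) (u : forall l, 'M[B]_(r l)).
Hypothesis b_basis : forall l, is_basis (@b l).
Hypothesis uE : forall l, matrix_of (@psi l) (@b l) (u l).

Lemma filtration_mono l l' x : (l <= l')%N -> x \in F l -> x \in F l'.
Proof.
case: M_ordinary => _ inc _ _ _; move=> ll' xF; rewrite -(subnK ll').
by elim: (l' - l)%N => //= k; rewrite addSn; exact: inc.
Qed.

Lemma filtration_lin l a x y : x \in F l -> y \in F l -> a *: x + y \in F l.
Proof. by case: M_ordinary => _ _ _ /(_ l)[[[_ lin] _] _] _; exact: lin. Qed.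

Lemma filtration0 l : 0 \in F l.
Proof. by case: M_ordinary => _ _ _ /(_ l)[[[]]]. Qed.

Lemma filtration_sum l (I : Type) (s : seq I) (c : I -> B) (x : I -> M) :
  (forall i, x i \in F l) -> \sum_(i <- s) c i *: x i \in F l.
Proof.
move=> xF; elim: s => [|i s IH]; first by rewrite big_nil; exact: filtration0.
by rewrite big_cons; apply: filtration_lin.
Qed.

Lemma gr_sum l (I : Type) (s : seq I) (c : I -> B) (x : I -> M) :
  (forall i, x i \in F l.+1) ->
  gr l (\sum_(i <- s) c i *: x i) = \sum_(i <- s) c i *: gr l (x i).
Proof.
case: M_ordinary => _ _ _ _ /(_ l)[_ lin ker _ _] xF.
elim: s => [|i s IH].
  by rewrite !big_nil; apply/ker; exact: filtration0.
by rewrite !big_cons lin ?IH //; exact: filtration_sum.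
Qed.

Lemma lifts_exist : exists v : nat -> nat -> M,
  (forall l k, v l k \in F l.+1) /\ forall l (k : 'I_(r l)), gr l (v l k) = b k.
Proof.
have /choice[v vE] : forall lk : nat * nat, exists x, x \in F lk.1.+1 /\
    forall k : 'I_(r lk.1), k = lk.2 :> nat -> gr lk.1 x = b k.
  move=> [l k] /=; have [kr|rk] := ltnP k (r l); last first.
    (* Positions beyond the rank get the default 0, so that the lifts form a function on pairs of
       naturals. *)
    exists 0; split=> [|k' k'k]; first exact: filtration0.
    by have := ltn_ord k'; rewrite k'k ltnNge rk.
  case: M_ordinary => _ _ _ _ /(_ l)[_ _ _ sur _].
  have [x xF xE] := sur (b (Ordinal kr)); exists x; split=> // k' k'k.
  by rewrite xE; congr (b _); apply: val_inj.
exists (fun l k => v (l, k)); split=> [l k|l k]; first exact: (vE (l, k)).1.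
exact: (vE (l, val k)).2.
Qed.

Variable v : nat -> nat -> M.
Hypothesis vF : forall l k, v l k \in F l.+1.
Hypothesis vb : forall l (k : 'I_(r l)), gr l (v l k) = b k.

Lemma adapted_lower m (c : nat -> nat -> B) :
  \sum_(l < m) \sum_(k < r l) c l k *: v l k \in F m.
Proof.
under eq_bigr => l _ do rewrite -[\sum_(k < r l) _]scale1r.
apply: filtration_sum => l; apply: filtration_sum => k.
by apply: filtration_mono (vF _ _); exact: ltn_ord.
Qed.

Lemma gr_adapted m (c : nat -> nat -> B) :
  gr m (\sum_(l < m.+1) \sum_(k < r l) c l k *: v l k) = \sum_(k < r m) c m k *: b k.
Proof.
case: (M_ordinary) => _ inc _ _ /(_ m)[_ lin ker _ _].
rewrite big_ord_recr /= -[\sum_(l < m) _]scale1r lin.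
- rewrite (ker _ _).2 ?scaler0 ?add0r; [|exact/inc/adapted_lower|exact: adapted_lower].
  by rewrite gr_sum //; apply: eq_bigr => k _; rewrite vb.
- exact/inc/adapted_lower.
- exact: filtration_sum.
Qed.

Lemma adapted_span m x : x \in F m -> exists c : nat -> nat -> B,
  x = \sum_(l < m) \sum_(k < r l) c l k *: v l k.
Proof.
elim: m x => [|m IH] x xF.
  case: M_ordinary => F0 _ _ _ _; exists (fun _ _ => 0); rewrite big_ord0.
  by apply/eqP; rewrite -F0.
case: (M_ordinary) => _ inc _ _ /(_ m)[_ lin ker _ _].
have [a aE] := is_basis_span (gr m x) (b_basis (l := m)).
pose y := \sum_(k < r m) a k *: v m k.
have yF : y \in F m.+1 by apply: filtration_sum.
have xyE : -1 *: y + x = x - y by rewrite scaleN1r addrC.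
have xyF : x - y \in F m.+1 by rewrite -xyE; apply: filtration_lin.
have [|c cE] := IH (x - y).
  apply/ker => //; rewrite -xyE lin // aE gr_sum // scaleN1r.
  by rewrite (eq_bigr (fun k => a k *: b k)) ?addNr // => k _; rewrite vb.
exists (fun l k => if l == m then (if insub k is Some k' then a k' else 0) else c l k).
rewrite big_ord_recr /= -[LHS](subrK y) cE; congr (_ + _).
  apply: eq_bigr => l _; apply: eq_bigr => k _.
  by rewrite (ltn_eqF (ltn_ord l)).
by apply: eq_bigr => k _; rewrite eqxx valK.
Qed.

Lemma adapted_free m (c : nat -> nat -> B) :
  \sum_(l < m) \sum_(k < r l) c l k *: v l k = 0 ->
  forall l k, (l < m)%N -> (k < r l)%N -> c l k = 0.
Proof.
elim: m => // m IH c0 l k.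
have cm (k' : 'I_(r m)) : c m k' = 0.
  apply: (is_basis_free (c := fun k' => c m k') (c' := fun=> 0) (b_basis (l := m))).
  rewrite -gr_adapted c0 [RHS]big1 => [|i _]; last by rewrite scale0r.
  case: (M_ordinary) => _ _ _ _ /(_ m)[_ lin ker _ _].
  by apply/ker; exact: filtration0.
rewrite ltnS leq_eqVlt => /orP[/eqP -> km|lm kr]; first exact: (cm (Ordinal km)).
apply: (IH _ l k lm kr); rewrite -[RHS]c0 big_ord_recr /= [X in _ + X]big1 ?addr0 // => i _.
by rewrite cm scale0r.
Qed.

(** Stability of the step gives triangularity, and passing to the top quotient identifies the
    diagonal block. *)
Lemma phi_adapted l (k : 'I_(r l)) : (forall x, x \in F l.+1 -> phi x \in F l.+1) ->
  exists c : nat -> nat -> B,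
  phi (v l k) = \sum_(l' < l.+1) \sum_(k' < r l') c l' k' *: v l' k' /\
  forall k' : 'I_(r l), c l k' = w ^+ l * u l k' k.
Proof.
move=> phiF; have [c cE] := adapted_span (phiF _ (vF l k)); exists c; split=> // k'.
apply: (is_basis_free (c := fun k' => c l k') (c' := fun k' => w ^+ l * u l k' k) (b_basis (l := l))).
rewrite -gr_adapted -cE.
case: (M_ordinary) => _ _ _ _ /(_ l)[_ _ _ _ ->]; last exact: vF.
by rewrite vb uE scaler_sumr; apply: eq_bigr => i _; rewrite scalerA.
Qed.

End AdaptedBasis.

(** * Absence of torsion *)

Section TorsionFree.
Variables (R : idomainType) (pi : R) (A Ahat : comAlgType R) (io : {lrmorphism A -> Ahat}).
Hypotheses (pi0 : pi != 0) (io_compl : pi_completion pi io).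

(** Multiplication by [pi] is injective on [R] and sends a (x) 1 to [pi] a (x) 1 = 0; flatness makes
    a (x) 1 vanish, and multiplication recovers a. *)
Lemma flat_torsion_free (a : A) : flat (in_alg A) -> pi *: a = 0 -> a = 0.
Proof.
move=> fl pa; have inj : injective (( *:%R pi : R^o -> R^o) : {linear R^o -> R^o}).
  by move=> x y; apply: mulfI.
have := fl _ _ _ inj [:: (a, 1)] _ A (fun x y => x * (y%:A)).
rewrite big_seq1 /= scale1r mulr1; apply.
- move=> W b bD bD' bZ; rewrite big_seq1 /=.
  have -> : b a (pi *: (1 : R^o)) = b 0 1.
    by rewrite -bZ /= mulr_algr pa.
  by apply: (addrI (b 0 1)); rewrite -bD !addr0.
- by move=> x x' y; rewrite mulrDl.
- by move=> x y y'; rewrite -mulrDr -scalerDl.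
- by move=> x c y; rewrite /= -mulrA; congr (_ * _); rewrite mulr_algl scalerA.
Qed.

(** Write x as [io a] plus a multiple of [pi ^+ m]: then [pi *: a] is divisible by [pi ^+ m.+1],
    hence a by [pi ^+ m], and x by every power of [pi]. *)
Lemma completion_torsion_free : (forall a : A, pi *: a = 0 -> a = 0) ->
  forall x : Ahat, pi%:A * x = 0 -> x = 0.
Proof.
case: io_compl => sep _ app div Atf x; rewrite mulr_algl => px; apply: sep => m.
have [a [y xE]] := app m x.
have [|b bE] := div m.+1 (pi *: a).
  exists (- y); apply/eqP; rewrite linearZ scalerN -addr_eq0 exprS -scalerA -scalerDr -xE.
  by rewrite px.
have aE : a = pi ^+ m *: b.
  apply/eqP; rewrite -subr_eq0; apply/eqP/Atf.
  by rewrite scalerBr bE scalerA -exprS subrr.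
by exists (io b + y); rewrite xE aE linearZ scalerDr.
Qed.

End TorsionFree.

(** * From the filtered module to matrices *)

Section GradedPiece.
Variables (R : idomainType) (pi : R) (n : nat) (A Ahat : comAlgType R)
  (pr : {lrmorphism dagger n pi -> A}) (io : {lrmorphism A -> Ahat})
  (sg : {lrmorphism A -> A}) (sgh : {lrmorphism Ahat -> Ahat}).
Hypotheses (pi0 : pi != 0) (io_compl : pi_completion pi io).
Hypothesis pr_surj : forall a, exists x, pr x = a.
Hypothesis A_unit : forall x : A, exists z, (1 + pi%:A * x) * z = 1.
Local Notation w := (pi%:A : Ahat).
Hypothesis Ahat_tfree : forall x : Ahat, w * x = 0 -> x = 0.
Hypothesis sgh_io : forall a, sgh (io a) = io (sg a).
Variables (M : lmodType Ahat) (phi : M -> M) (F : nat -> {pred M})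
  (U : nat -> lmodType Ahat) (gr : forall l, M -> U l) (psi : forall l, U l -> U l).
Hypothesis M_sigma : sigma_module sgh phi.
Hypothesis M_overconvergent : overconvergent io sg phi.
Hypothesis M_ordinary : ordinary_filtration sgh w phi F gr psi.
Variables (r : nat -> nat) (b : forall l, 'I_(r l) -> U l) (u u' : forall l, 'M[Ahat]_(r l)).
Hypothesis b_basis : forall l, is_basis (@b l).
Hypothesis uE : forall l, matrix_of (@psi l) (@b l) (u l).
Hypothesis uu' : forall l, u l *m u' l = 1%:M.

Definition block_entry (a : forall l, 'M[Ahat]_(r l)) l k k' : Ahat :=
  if (insub k, insub k') is (Some x, Some y) then a l x y else 0.

Lemma block_entryE a l (x y : 'I_(r l)) : block_entry a l x y = a l x y.
Proof. by rewrite /block_entry !valK. Qed.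

Definition block_diagonal m (a : forall l, 'M[Ahat]_(r l)) : 'M[Ahat]_#|gidx m r| :=
  \matrix_(i, j) if glevel i == glevel j then block_entry a (glevel j) (gpos i) (gpos j) else 0.

Lemma block_diagonal_inv m : block_diagonal m u *m block_diagonal m u' = 1%:M.
Proof.
apply/matrixP => i j; rewrite !mxE.
have [eij|nij] := eqVneq (glevel i) (glevel j); last first.
  rewrite big1 => [|k _]; last first.
    by rewrite !mxE; case: eqP => [<-|_]; rewrite ?mul0r // (negPf nij) mulr0.
  by case: eqP => // ij; rewrite ij eqxx in nij.
pose x := Ordinal (gpos_lt j).
have yP : (gpos i < r (glevel j))%N by rewrite -eij gpos_lt.
transitivity (\sum_(k : 'I_#|gidx m r|) (if glevel k == glevel j then
    block_entry u (glevel j) (Ordinal yP) (gpos k) * block_entry u' (glevel j) (gpos k) x else 0)).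
  apply: eq_bigr => k _; rewrite !mxE eij eq_sym.
  by case: eqP => [->|_]; rewrite ?mul0r.
rewrite (@gidx_sum_level m r _ (glevel j) (fun p => block_entry u (glevel j) (Ordinal yP) p *
  block_entry u' (glevel j) p x)); last exact: glevel_lt.
under eq_bigr => p _ do rewrite !block_entryE.
have /matrixP/(_ (Ordinal yP) x) := uu' (glevel j); rewrite !mxE => ->.
congr (_%:R); rewrite -val_eqE /=; congr (nat_of_bool _).
by apply/eqP/eqP => [h|-> //]; apply: gidx_inj.
Qed.

Theorem graded_piece_series t :
  exists (C : nat -> nucmat w) (cv : ord_to_infty C) (nu : nat -> int),
    [/\ forall k, nu k = 1 \/ nu k = -1,
        forall k, exists Cr : nidx (C k) -> nidx (C k) -> A,
          nuclear_overconvergent pr Cr /\ forall x y, C k x y = io (Cr x y)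
      & finite_class w sgh (u t) = delta_series sgh nu cv].
Proof.
have [M0 [phi0 [h [[[n0 [e0 e0b]] [phi0D phi0Z]] [hD hZ] hbij hphi]]]] := M_overconvergent.
have [_ [phiD phiZ]] := M_sigma.
have e1b := basis_base_change hD hZ hbij e0b.
have [Phi0 Phi0E] := basis_matrix (phi0 \o e0) e0b.
have /choice[k kE] : forall i, exists k, h (e0 i) \in F k.
  by case: M_ordinary => _ _ ex _ _ i; apply: ex.
(* The first term makes step [m] contain a basis, hence all of [M]; the second makes it lie beyond
   piece [t]. *)
pose m := maxn (\max_i k i) t.+1.
have tm : (t < m)%N by rewrite leq_max leqnn orbT.
have Fm x : x \in F m.
  have [c ->] := is_basis_span x e1b; apply: (filtration_sum M_ordinary) => i.
  apply: (filtration_mono M_ordinary _ (kE i)).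
  by rewrite leq_max (leq_bigmax_cond (F := k)).
have [v [vF vb]] := lifts_exist M_ordinary b.
pose d := #|gidx m r|; pose vd (i : 'I_d) := v (glevel i) (gpos i).
have vdb : is_basis vd.
  apply: is_basis_intro => [x|c c0 i].
    have [c ->] := adapted_span M_ordinary b_basis vF vb (Fm x).
    by exists (fun i => c (glevel i) (gpos i)); rewrite (@gidx_sum m r _ (fun l p => c l p *: v l p)).
  (* Coefficients indexed by the basis are extended by 0 to all pairs of naturals, the form in which
     freeness is stated. *)
  pose cc l p := if [pick k : 'I_d | (glevel k == l) && (gpos k == p)] is Some k then c k else 0.
  have ccE j : cc (glevel j) (gpos j) = c j.
    rewrite /cc; case: pickP => [j' /andP[/eqP e /eqP e']|/(_ j)]; last by rewrite !eqxx.
    by rewrite (gidx_inj e e').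
  rewrite -ccE; apply: (adapted_free M_ordinary b_basis vF vb (m := m)).
  - rewrite -(@gidx_sum m r _ (fun l p => cc l p *: v l p)) -[RHS]c0.
    by apply: eq_bigr => j _; rewrite ccE.
  - exact: glevel_lt.
  - exact: gpos_lt.
have /choice[c cE] : forall j : 'I_d, exists c : nat -> nat -> Ahat,
    phi (vd j) = \sum_(l < (glevel j).+1) \sum_(p < r l) c l p *: v l p /\
    forall p : 'I_(r (glevel j)), c (glevel j) p =
      w ^+ glevel j * block_entry u (glevel j) p (gpos j).
  move=> j; pose x := Ordinal (gpos_lt j).
  have [|c [cE cu]] := phi_adapted M_ordinary b_basis uE vF vb x.
    by case: M_ordinary => _ _ _ /(_ (glevel j).+1)[].
  by exists c; split=> // p; rewrite cu -(block_entryE u p x).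
pose Psi0 : 'M[Ahat]_d := \matrix_(i, j)
  if (glevel i <= glevel j)%N then c j (glevel i) (gpos i) else 0.
have Psi0E j : phi (vd j) = \sum_i Psi0 i j *: vd i.
  under eq_bigr => i _ do rewrite mxE.
  rewrite (@gidx_sum m r _ (fun l p => (if (l <= glevel j)%N then c j l p else 0) *: v l p)).
  rewrite (cE j).1 (big_ord_widen m (fun l => \sum_(p < r l) c j l p *: v l p)) ?glevel_lt //.
  rewrite big_mkcond; apply: eq_bigr => l _; rewrite ltnS; case: leqP => // _.
  by rewrite big1 // => p _; rewrite scale0r.
have [S SE] := basis_matrix vd e1b.
have [S' S'E] := basis_matrix (h \o e0) vdb.
have SS' := basis_change_inv e1b SE S'E.
have S'S := basis_change_inv vdb S'E SE.
have phiE (I : finType) (a : I -> Ahat) (x : I -> M) :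
    phi (\sum_i a i *: x i) = \sum_i sgh (a i) *: phi (x i).
  have phi00 : phi 0 = 0 by apply: (addrI (phi 0)); rewrite -phiD !addr0.
  elim/big_ind2: _ => [|x1 y1 x2 y2 e1 e2|i _]; [exact: phi00| |exact: phiZ].
  by rewrite phiD e1 e2.
have hE (I : finType) (a : I -> A) (x : I -> M0) :
    h (\sum_i a i *: x i) = \sum_i io (a i) *: h (x i).
  have h00 : h 0 = 0 by apply: (addrI (h 0)); rewrite -hD !addr0.
  elim/big_ind2: _ => [|x1 y1 x2 y2 e1 e2|i _]; [exact: h00| |exact: hZ].
  by rewrite hD e1 e2.
have PhiS : map_mx io Phi0 *m map_mx sgh S = S *m Psi0.
  apply/matrixP => i j; rewrite !mxE.
  apply: (is_basis_free (c := fun i => \sum_l (map_mx io Phi0) i l * (map_mx sgh S) l j)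
    (c' := fun i => \sum_l S i l * Psi0 l j) e1b).
  transitivity (phi (vd j)).
    rewrite SE phiE; apply/esym.
    transitivity (\sum_l \sum_i ((map_mx io Phi0) i l * (map_mx sgh S) l j) *: (h \o e0) i).
      apply: eq_bigr => l _; rewrite /= -hphi -[phi0 (e0 l)]/((phi0 \o e0) l) Phi0E hE scaler_sumr.
      by apply: eq_bigr => i' _; rewrite !mxE scalerA mulrC.
    by rewrite exchange_big; apply: eq_bigr => i' _; rewrite scaler_suml.
  rewrite Psi0E; under eq_bigr => l _ do rewrite SE scaler_sumr.
  rewrite exchange_big; apply: eq_bigr => i' _ /=; rewrite scaler_suml.
  by apply: eq_bigr => l _; rewrite scalerA mulrC.
pose iota (a : 'I_(r t)) : 'I_d := enum_rank (existT (fun l : 'I_m => 'I_(r l)) (Ordinal tm) a).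
have iotal a : glevel (iota a) = t by rewrite /glevel /iota enum_rankK.
have iotap a : gpos (iota a) = a by rewrite /gpos /iota enum_rankK.
apply: (@ordinary_matrix_series _ _ _ _ _ pr io sg sgh pi0 io_compl pr_surj A_unit Ahat_tfree
  sgh_io m d (@glevel m r) (@glevel_lt m r) n0 S S' Phi0 Psi0 (block_diagonal m u)
  (block_diagonal m u') t (r t) iota (u t) SS' S'S PhiS).
- by move=> i j ij; rewrite mxE leqNgt ij.
- move=> i j ij; rewrite !mxE ij leqnn eqxx.
  have ip : (gpos i < r (glevel j))%N by rewrite -ij gpos_lt.
  exact: ((cE j).2 (Ordinal ip)).
- by move=> i j ij; rewrite mxE (negPf ij).
- exact: block_diagonal_inv.
- by move=> x y /(congr1 (@gpos m r)); rewrite !iotap => /val_inj.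
- move=> j; apply/eqP/codomP => [jt|[a ->]]; last exact: iotal.
  have jr : (gpos j < r t)%N by rewrite -jt gpos_lt.
  by exists (Ordinal jr); apply: gidx_inj; rewrite ?iotal ?iotap.
- by move=> x y; rewrite mxE !iotal eqxx !iotap block_entryE.
Qed.

End GradedPiece.

Theorem theorem7p2
  (* R with uniformizer pi and residue field k = F_q, q = #|k| *)
  (R : idomainType) (pi : R) (k : finFieldType) (res : {rmorphism R -> k})
  (hR : padic_integer_ring pi res)
  (* A = R[X]^dagger / (g_1, ..., g_s), flat over R *)
  (n s d : nat) (g : 'I_s -> {mpoly R[n]})
  (hg : forall j, ~ exists y : {mpoly R[n]}, g j = pi *: y)
  (A : comAlgType R) (pr : {lrmorphism dagger n pi -> A})
  (pr_surj : forall a, exists x, pr x = a)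
  (pr_ker : forall x, pr x = 0 <-> exists h : 'I_s -> dagger n pi,
     dagger_val x = \sum_j dagger_val (h j) * mps_of_mpoly (g j))
  (A_flat : flat (in_alg A))
  (* Abar = A / pi A, with Spec Abar smooth, connected, of dimension d *)
  (Abar : comAlgType k) (red : {rmorphism A -> Abar})
  (red_surj : forall y, exists a, red a = y)
  (red_ker : forall a, red a = 0 <-> exists b, a = pi *: b)
  (red_alg : forall c : R, red c%:A = (res c)%:A)
  (X_smooth : smooth Abar) (X_connected : connected_spec Abar)
  (X_dim : krull_dim Abar d)
  (Ahat : comAlgType R) (io : {lrmorphism A -> Ahat})
  (io_compl : pi_completion pi io)
  (sg : {lrmorphism A -> A}) (sg_frob : forall a, red (sg a) = red a ^+ #|k|)
  (sgh : {lrmorphism Ahat -> Ahat}) (sgh_io : forall a, sgh (io a) = io (sg a))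
  (sg_free : free_over_image sg (#|k| ^ d)%N)
  (Om : lmodType A) (D : A -> Om) (Om_diff : separated_differentials pi D)
  (Om_free : finite_free Om)
  (* an overconvergent ordinary sigma-module, with its filtration *)
  (M : lmodType Ahat) (phi : M -> M) (M_sigma : sigma_module sgh phi)
  (M_overconvergent : overconvergent io sg phi)
  (F : nat -> {pred M}) (U : nat -> lmodType Ahat) (gr : forall i, M -> U i)
  (psi : forall i, U i -> U i)
  (M_ordinary : ordinary_filtration sgh (pi%:A : Ahat) phi F gr psi)
  (* mx is the matrix of the i-th graded piece in the basis e *)
  (i rk : nat) (e : 'I_rk -> U i) (e_basis : is_basis e)
  (mx : 'M[Ahat]_rk) (mxE : matrix_of (psi i) e mx) :
  exists (C : nat -> nucmat (pi%:A : Ahat)) (cv : ord_to_infty C)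
    (nu : nat -> int),
    [/\ forall r, nu r = 1 \/ nu r = -1,
        forall r, exists Cr : nidx (C r) -> nidx (C r) -> A,
          nuclear_overconvergent pr Cr /\ forall x y, C r x y = io (Cr x y)
      & finite_class (pi%:A : Ahat) sgh mx = delta_series sgh nu cv].
Proof.
have pi0 : pi != 0 by case: hR => _ [].
have A_unit (x : A) : exists z, (1 + pi%:A * x) * z = 1.
  have [y <-] := pr_surj x; have [z zE] := dagger_unit hR (- y).
  exists (pr z); rewrite mulr_algl -linearZ -[1 in LHS](rmorph1 pr) -rmorphD -rmorphM.
  by move: zE; rewrite scalerN opprK => ->; rewrite rmorph1.
have tfree := completion_torsion_free io_compl (fun a => flat_torsion_free pi0 A_flat (a := a)).
have pieces l : sigma_module sgh (@psi l) /\ unit_root sgh (@psi l).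
  by case: M_ordinary => _ _ _ _ /(_ l)[].
have bases l : exists x : {r : nat & 'I_r -> U l}, is_basis (projT2 x).
  by have [[[r [b bP]] _] _] := pieces l; exists (existT _ r b).
(* Bases of all pieces are chosen at once, with the prescribed [e] transported into place at level
   [i]. *)
pose B l : {r : nat & 'I_r -> U l} := match @eqP _ i l with
  | ReflectT il => eq_rect i (fun l => {r : nat & 'I_r -> U l}) (existT _ rk e) l il
  | ReflectF _ => sval (cid (bases l)) end.
have BP l : is_basis (projT2 (B l)).
  by rewrite /B; case: eqP => [il|_]; [case: l / il|exact: (proj2_sig (cid (bases l)))].
have Bi : B i = existT _ rk e.
  by rewrite /B; case: eqP => // ii; rewrite (eq_axiomK ii).
have mats l : exists u : 'M_(projT1 (B l)), matrix_of (@psi l) (projT2 (B l)) u.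
  have [u uE] := basis_matrix (@psi l \o projT2 (B l)) (BP l).
  by exists u => j; rewrite -uE.
pose u l := sval (cid (mats l)).
have uP l : matrix_of (@psi l) (projT2 (B l)) (u l) by exact: (proj2_sig (cid (mats l))).
have invs l : exists u' : 'M_(projT1 (B l)), u l *m u' = 1%:M.
  by have [sl ul] := pieces l; exact: unit_root_right_inverse (BP l) sl ul (uP l).
have := @graded_piece_series _ _ _ _ _ pr io sg sgh pi0 io_compl pr_surj A_unit tfree sgh_io
  M phi F U gr psi M_sigma M_overconvergent M_ordinary (fun l => projT1 (B l))
  (fun l => projT2 (B l)) u (fun l => sval (cid (invs l))) BP uP
  (fun l => proj2_sig (cid (invs l))) i.
move: (u i) (uP i); rewrite Bi /= => m mE.
have -> // : m = mx.
apply/matrixP => a j.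
apply: (is_basis_free (c := fun a => m a j) (c' := fun a => mx a j) e_basis).
by rewrite -mE -mxE.
Qed.
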